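(* Let $E(x)$ be defined for real $x\ge 1$ by \[ E(x)=\sum_{1\le k\le x}(x-k)\,\mathfrak{S}(k)-\frac12 x^2+\frac12 x\log x-\frac12\bigl(1-\gamma-\log 2\pi\bigr)x , \] where the sum runs over positive integers $k\le x$. Let $\rho_1=\frac12+i\gamma_1$ (with $\gamma_1=14.134725\ldots$) be the nontrivial zero of the Riemann zeta-function $\zeta(s)$ with smallest positive imaginary part (a simple zero), let $s_1=\frac{\rho_1}{2}-1=-\frac34+i\frac{\gamma_1}{2}$, and let \[ c_1=\left(\frac{4C_2}{2^{s_1+1}+1}\right)\frac{\zeta(s_1)\,\zeta(s_1+1)}{2\,\zeta'(\rho_1)\,s_1(s_1+1)}\,\mathcal{G}(s_1), \qquad \mathcal{G}(s)=\prod_{p>2}\Bigl(1+\frac{2}{(p-2)(p^{s+1}+1)}\Bigr). \] Then \[ \limsup_{x\to\infty}\frac{E(x)}{x^{1/4}}\ge |c_1| \qquad\text{and}\qquad \liminf_{x\to\infty}\frac{E(x)}{x^{1/4}}\le -|c_1| . \]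
   Context: The singular series $\mathfrak{S}(k)$ is defined for positive integers $k$ by \[ \mathfrak{S}(k)=\begin{cases} 2C_2\displaystyle\prod_{p\mid k,\ p>2}\frac{p-1}{p-2} & \text{if $k$ is even},\\ 0 & \text{if $k$ is odd},\end{cases} \qquad C_2=\prod_{p>2}\Bigl(1-\frac{1}{(p-1)^2}\Bigr), \] where $p$ runs over primes and an empty product equals $1$. Here $\gamma$ denotes the Euler–Mascheroni constant. The product defining $\mathcal{G}(s)$ converges for $\operatorname{Re}s>-1$. *)

(* Defs.v *)
From Stdlib Require Import Reals ZArith Znumtheory List.
From Coquelicot Require Import Coquelicot.
Open Scope R_scope.

Definition odd_primes (n : nat) : list nat :=
  filter (fun p => if prime_dec (Z.of_nat p) then true else false)
         (seq 3 (n - 2)).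

Definition Rprod (f : nat -> R) (l : list nat) : R :=
  fold_right Rmult 1 (map f l).

Definition Cprod (f : nat -> C) (l : list nat) : C :=
  fold_right Cmult (RtoC 1) (map f l).

Definition twin_C2 : R :=
  real (Lim_seq (fun n => Rprod (fun p => 1 - 1 / (INR p - 1) ^ 2) (odd_primes n))).

(* A divisor of [k >= 1] is at most [k], so [odd_primes k] contains all the
   odd primes dividing [k]. *)
Definition sing_series (k : nat) : R :=
  if Nat.even k then
    2 * twin_C2 * Rprod (fun p => (INR p - 1) / (INR p - 2))
                   (filter (fun p => Nat.eqb (Nat.modulo k p) 0) (odd_primes k))
  else 0.

Definition euler_gamma : R :=
  real (Lim_seq (fun n => sum_n_m (fun k => / INR k) 1 n - ln (INR n))).

(* Meant for [1 <= x]; [Int_part] is the floor function. *)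
Definition errE (x : R) : R :=
  sum_n_m (fun k => (x - INR k) * sing_series k) 1 (Z.to_nat (Int_part x))
  - 1 / 2 * x ^ 2 + 1 / 2 * x * ln x
  - 1 / 2 * (1 - euler_gamma - ln (2 * PI)) * x.

(* Infimum over [n] of the supremum over [x >= n], in [Rbar]. *)
Definition LimSup_infty (f : R -> R) : Rbar :=
  Inf_seq (fun n => Lub_Rbar (fun y => exists x, INR n <= x /\ y = f x)).

Definition LimInf_infty (f : R -> R) : Rbar :=
  Sup_seq (fun n => Glb_Rbar (fun y => exists x, INR n <= x /\ y = f x)).

Definition Cexp (z : C) : C :=
  Cmult (RtoC (exp (Re z))) (cos (Im z), sin (Im z)).

(* [a ^ s] for a real base [a > 0]. *)
Definition cpow (a : R) (s : C) : C := Cexp (Cmult s (RtoC (ln a))).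

Definition analytic_at (f : C -> C) (z0 : C) : Prop :=
  exists (a : nat -> C) (r : R), 0 < r /\
    forall z : C, Cmod (Cminus z z0) < r ->
      is_pseries (K := C_AbsRing) (V := C_NormedModule) a (Cminus z z0) (f z).

(* The analytic continuation to [C \ {1}] of the Dirichlet series.  The value
   at the pole [1] is unconstrained; away from it there is exactly one such
   function, by the identity theorem. *)
Definition is_riemann_zeta (zeta : C -> C) : Prop :=
  (forall s : C, s <> RtoC 1 -> analytic_at zeta s) /\
  (forall s : C, 1 < Re s ->
     is_series (K := C_AbsRing) (V := C_NormedModule)
       (fun n : nat => cpow (INR (S n)) (Copp s)) (zeta s)).

Definition nontrivial_zero (zeta : C -> C) (rho : C) : Prop :=
  zeta rho = RtoC 0 /\ 0 < Re rho < 1.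

(* [C_derive] is defined by a limit along a horizontal line; it is the complex
   derivative here since [zeta] is analytic at [1/2 + i g] ([C_derive_correct]).
   The last clause reads [g = 14.134725...] as a truncated decimal expansion. *)
Definition is_first_zero_ordinate (zeta : C -> C) (g : R) : Prop :=
  nontrivial_zero zeta (1 / 2, g) /\
  0 < g /\
  (forall rho : C, nontrivial_zero zeta rho -> 0 < Im rho -> g <= Im rho) /\
  C_derive zeta (1 / 2, g) <> RtoC 0 /\
  14.134725 <= g < 14.134726.

Definition Cseq_lim (u : nat -> C) : C :=
  (real (Lim_seq (fun n => Re (u n))), real (Lim_seq (fun n => Im (u n)))).

Definition calG (s : C) : C :=
  Cseq_lim (fun n => Cprod (fun p =>
    (1 + 2 / (RtoC (INR p - 2) * (cpow (INR p) (s + 1) + 1)))%C) (odd_primes n)).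

Definition coeff_c1 (zeta : C -> C) (g : R) : C :=
  let rho1 : C := (1 / 2, g) in
  let s1 : C := (rho1 / 2 - 1)%C in
  ((4 * RtoC twin_C2 / (cpow 2 (s1 + 1) + 1)) *
   (zeta s1 * zeta (s1 + 1) / (2 * C_derive zeta rho1 * s1 * (s1 + 1))) *
   calG s1)%C.

(* Main.v *)
(** The Mellin transform of [E] is, up to explicit rational terms,
    [4 C_2 zeta(s) zeta(s+1) G(s) / ((2^(s+1)+1) zeta(2s+2) s (s+1))], which has a pole of
    residue [c_1] at [s_1], while on the real axis it is analytic for [s > -1]: the
    terms subtracted in [E] cancel its poles at [1] and [0].  Suppose [e E(x) <= C x^(1/4)]
    for all large [x], where [e] is a sign.  The transform of the eventually nonnegative function
    [C x^(1/4) - e E(x)] has no real singularity to the right of [-3/4], so by Landau's theorem it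
    converges absolutely for [Re s > -3/4] and is bounded there by its value at [Re s].
    Comparing the residue at [s_1 = -3/4 + i gamma_1/2] with the one at [-3/4] gives
    [|c_1| <= C].

    No complex function theory is needed beyond power series in a real variable: analyticity
    is only used along the lines [Im s = 0] and [Im s = gamma_1/2].  On the real line,
    [zeta] is replaced by its first-order Euler-Maclaurin formula; on the other line the
    zeros of [zeta(2s+2)] are never divided out, so that nothing about their location is used. *)

Require Import Defs.
From Stdlib Require Import Reals Lra Lia ZArith Znumtheory List Classical IndefiniteDescription.
From Coquelicot Require Import Coquelicot.
Open Scope R_scope.

(** * Complex sequences and series *)

(** The cancellation at 1 and 0 is not read off from Laurent expansions. Dividing the Dirichlet
    series of the singular series by [zeta(s) zeta(s+1)] leaves [K(s)], for real [s >= 0] the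
    product over all primes of [1 - (1 - p^(-s))^2 / (p-1)^2]. At [s = 1] it is [1/zeta(2)], so the
    residue is 1, which accounts for [x^2/2]. At [s = 0] it is [1 + O(s^2)], so both coefficients of
    the double pole there come from [zeta(s) zeta(s+1) / (s (s+1))]; they reduce to
    [zeta(0) = -1/2], Stirling's constant and Euler's constant. Analyticity is carried by weighted
    l^1 bounds on Taylor coefficients. One lemma on series of functions, [AN_series], then covers
    products, reciprocals, Euler products and integrals, and it yields explicit radii, on which the
    proof of Landau's theorem rests. All transforms use the kernel [x^(-s-2)], which turns a sum of
    [(x - k) c_k] into [D(s) / (s (s+1))], where [D] is the Dirichlet series of [c]. Improper
    integrals are limits along the endpoints [a + n]. *)

Fixpoint rsum (a : nat -> R) (n : nat) : R :=
  match n with O => 0 | S k => rsum a k + a k end.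

Fixpoint csum (a : nat -> C) (n : nat) : C :=
  match n with O => RtoC 0 | S k => (csum a k + a k)%C end.

(** Stated through the real sequence of distances, so that squeezing of real sequences gives the
    limit rules below. *)
Definition Clim (u : nat -> C) (l : C) : Prop :=
  is_lim_seq (fun n => Cmod (u n - l)%C) 0.

Lemma rsum_ext (a b : nat -> R) n :
  (forall k, (k < n)%nat -> a k = b k) -> rsum a n = rsum b n.
Proof.
  induction n as [|n IH]; intros H; simpl; auto.
  rewrite IH; [rewrite H; auto|]. intros; apply H; lia.
Qed.

Lemma rsum_le (a b : nat -> R) n :
  (forall k, (k < n)%nat -> a k <= b k) -> rsum a n <= rsum b n.
Proof.
  induction n as [|n IH]; intros H; simpl; [lra|].
  assert (rsum a n <= rsum b n) by (apply IH; intros; apply H; lia).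
  assert (a n <= b n) by (apply H; lia). lra.
Qed.

Lemma rsum_zero n : rsum (fun _ => 0) n = 0.
Proof. induction n as [|n IH]; simpl; lra. Qed.

Lemma rsum_nonneg (a : nat -> R) n : (forall k, 0 <= a k) -> 0 <= rsum a n.
Proof.
  intros H. rewrite <- (rsum_zero n). apply rsum_le. auto.
Qed.

Lemma rsum_mono (a : nat -> R) n m :
  (forall k, 0 <= a k) -> (n <= m)%nat -> rsum a n <= rsum a m.
Proof.
  intros H L. induction L; simpl; [lra|]. specialize (H m). lra.
Qed.

Lemma rsum_plus (a b : nat -> R) n :
  rsum (fun k => a k + b k) n = rsum a n + rsum b n.
Proof. induction n as [|n IH]; simpl; [lra|]. rewrite IH. lra. Qed.

Lemma rsum_scal (c : R) (a : nat -> R) n :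
  rsum (fun k => c * a k) n = c * rsum a n.
Proof. induction n as [|n IH]; simpl; [lra|]. rewrite IH. lra. Qed.

Lemma rsum_exchange (a : nat -> nat -> R) n m :
  rsum (fun j => rsum (a j) m) n = rsum (fun k => rsum (fun j => a j k) n) m.
Proof.
  induction n as [|n IH]; simpl.
  - now rewrite rsum_zero.
  - rewrite IH. now rewrite rsum_plus.
Qed.

Lemma rsum_bounded_cv (a : nat -> R) M :
  (forall k, 0 <= a k) -> (forall n, rsum a n <= M) ->
  exists L : R, is_lim_seq (rsum a) L /\ (forall n, rsum a n <= L) /\ L <= M.
Proof.
  intros H0 HM.
  assert (E : ex_finite_lim_seq (rsum a)).
  { apply ex_finite_lim_seq_incr with M; auto.
    intros n; apply rsum_mono; auto. }
  destruct E as [L HL]. exists L. split; auto. split.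
  - intros n. apply (is_lim_seq_incr_compare _ _ HL).
    intros k; apply rsum_mono; auto.
  - apply (is_lim_seq_le (rsum a) (fun _ => M) L M); auto.
    apply is_lim_seq_const.
Qed.

Lemma rsum_tail_small (a : nat -> R) M eps :
  (forall k, 0 <= a k) -> (forall n, rsum a n <= M) -> 0 < eps ->
  exists N, forall n, rsum a n - rsum a N <= eps.
Proof.
  intros H0 HM He. destruct (rsum_bounded_cv a M H0 HM) as (L & HL & HLe & _).
  apply is_lim_seq_spec in HL. destruct (HL (mkposreal eps He)) as [N HN].
  exists N. intros n. specialize (HN N (le_n _)). simpl in HN.
  apply Rabs_def2 in HN. specialize (HLe n). lra.
Qed.

Lemma csum_ext (a b : nat -> C) n :
  (forall k, (k < n)%nat -> a k = b k) -> csum a n = csum b n.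
Proof.
  induction n as [|n IH]; intros H; simpl; auto.
  rewrite IH; [rewrite H; auto|]. intros; apply H; lia.
Qed.

Lemma csum_plus (a b : nat -> C) n :
  csum (fun k => a k + b k)%C n = (csum a n + csum b n)%C.
Proof. induction n as [|n IH]; simpl; [ring|]. rewrite IH. ring. Qed.

Lemma csum_minus (a b : nat -> C) n :
  csum (fun k => a k - b k)%C n = (csum a n - csum b n)%C.
Proof. induction n as [|n IH]; simpl; [ring|]. rewrite IH. ring. Qed.

Lemma csum_scal (c : C) (a : nat -> C) n :
  csum (fun k => c * a k)%C n = (c * csum a n)%C.
Proof. induction n as [|n IH]; simpl; [ring|]. rewrite IH. ring. Qed.

Lemma csum_zero n : csum (fun _ => RtoC 0) n = RtoC 0.
Proof. induction n as [|n IH]; simpl; auto. rewrite IH. ring. Qed.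

Lemma csum_exchange (a : nat -> nat -> C) n m :
  csum (fun j => csum (a j) m) n = csum (fun k => csum (fun j => a j k) n) m.
Proof.
  induction n as [|n IH]; simpl.
  - now rewrite csum_zero.
  - rewrite IH. now rewrite csum_plus.
Qed.

Lemma Cmod_csum (a : nat -> C) n : Cmod (csum a n) <= rsum (fun k => Cmod (a k)) n.
Proof.
  induction n as [|n IH]; simpl; [rewrite Cmod_0; lra|].
  eapply Rle_trans; [apply Cmod_triangle|]. lra.
Qed.

Lemma Cmod_minus_sym (x y : C) : Cmod (x - y)%C = Cmod (y - x)%C.
Proof. rewrite <- Cmod_opp. f_equal. ring. Qed.

Lemma Cmod_csum_diff (a : nat -> C) n m : (n <= m)%nat ->
  Cmod (csum a m - csum a n)%C <=
  rsum (fun k => Cmod (a k)) m - rsum (fun k => Cmod (a k)) n.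
Proof.
  intros L. induction L; simpl.
  - replace (csum a n - csum a n)%C with (RtoC 0) by ring. rewrite Cmod_0; lra.
  - replace (csum a m + a m - csum a n)%C with ((csum a m - csum a n) + a m)%C by ring.
    eapply Rle_trans; [apply Cmod_triangle|]. lra.
Qed.

Lemma Rabs_Re_le (z : C) : Rabs (Re z) <= Cmod z.
Proof. apply re_le_Cmod. Qed.

Lemma Rabs_Im_le (z : C) : Rabs (Im z) <= Cmod z.
Proof. eapply Rle_trans; [apply Rmax_r|apply Rmax_Cmod]. Qed.

Lemma Cmod_le_ReIm (z : C) : Cmod z <= Rabs (Re z) + Rabs (Im z).
Proof.
  replace z with (RtoC (Re z) + Ci * RtoC (Im z))%C at 1
    by (apply injective_projections; simpl; unfold Re, Im; ring).
  eapply Rle_trans; [apply Cmod_triangle|].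
  rewrite Cmod_mult, !Cmod_R, Cmod_Ci. lra.
Qed.

Lemma csum_RtoC (a : nat -> R) n : csum (fun k => RtoC (a k)) n = RtoC (rsum a n).
Proof. induction n as [|n IH]; simpl; auto. rewrite IH, RtoC_plus; auto. Qed.

Lemma Cminus_eq0 (x y : C) : Cmod (x - y)%C = 0 -> x = y.
Proof.
  intros H. apply Cmod_eq_0 in H. replace x with (x - y + y)%C by ring. rewrite H. ring.
Qed.

Lemma is_lim_seq_0_le (u v : nat -> R) :
  (forall n, 0 <= u n <= v n) -> is_lim_seq v 0 -> is_lim_seq u 0.
Proof.
  intros H Hv. apply (is_lim_seq_le_le (fun _ => 0) u v 0); auto.
  apply is_lim_seq_const.
Qed.

Lemma Clim_unique u l1 l2 : Clim u l1 -> Clim u l2 -> l1 = l2.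
Proof.
  intros H1 H2. apply Cminus_eq0.
  assert (H : is_lim_seq (fun n => Cmod (l1 - l2)%C) 0).
  { apply is_lim_seq_0_le with (fun n => Cmod (u n - l1)%C + Cmod (u n - l2)%C).
    - intros n. split; [apply Cmod_ge_0|].
      rewrite (Cmod_minus_sym (u n) l1).
      replace (l1 - l2)%C with ((l1 - u n) + (u n - l2))%C by ring. apply Cmod_triangle.
    - replace (Finite 0) with (Finite (0 + 0)) by (f_equal; ring).
      apply is_lim_seq_plus'; auto. }
  apply is_lim_seq_unique in H. rewrite Lim_seq_const in H. now injection H.
Qed.

Lemma Clim_ext u v l : (forall n, u n = v n) -> Clim u l -> Clim v l.
Proof. intros H. apply is_lim_seq_ext. intros n. now rewrite H. Qed.

Lemma Clim_ext_loc u v l N :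
  (forall n, (N <= n)%nat -> u n = v n) -> Clim u l -> Clim v l.
Proof.
  intros H. apply is_lim_seq_ext_loc. exists N. intros n Hn. now rewrite H.
Qed.

Lemma Clim_const c : Clim (fun _ => c) c.
Proof.
  unfold Clim. apply is_lim_seq_ext with (fun _ => 0); [|apply is_lim_seq_const].
  intros _. replace (c - c)%C with (RtoC 0) by ring. now rewrite Cmod_0.
Qed.

Lemma Clim_plus u v a b :
  Clim u a -> Clim v b -> Clim (fun n => u n + v n)%C (a + b)%C.
Proof.
  intros H1 H2.
  apply is_lim_seq_0_le with (fun n => Cmod (u n - a)%C + Cmod (v n - b)%C).
  - intros n. split; [apply Cmod_ge_0|].
    replace (u n + v n - (a + b))%C with ((u n - a) + (v n - b))%C by ring.
    apply Cmod_triangle.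
  - replace (Finite 0) with (Finite (0 + 0)) by (f_equal; ring).
    apply is_lim_seq_plus'; auto.
Qed.

Lemma Clim_scal c u a : Clim u a -> Clim (fun n => c * u n)%C (c * a)%C.
Proof.
  intros H.
  apply is_lim_seq_ext with (fun n => Cmod c * Cmod (u n - a)%C).
  - intros n. rewrite <- Cmod_mult. f_equal. ring.
  - replace (Finite 0) with (Rbar_mult (Cmod c) 0) by (simpl; f_equal; ring).
    apply is_lim_seq_scal_l; auto.
Qed.

Lemma Clim_opp u a : Clim u a -> Clim (fun n => - u n)%C (- a)%C.
Proof.
  intros H. apply Clim_ext with (fun n => (- (1)) * u n)%C; [intros; ring|].
  replace (- a)%C with ((- (1)) * a)%C by ring. now apply Clim_scal.
Qed.

Lemma Clim_minus u v a b :
  Clim u a -> Clim v b -> Clim (fun n => u n - v n)%C (a - b)%C.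
Proof. intros. apply Clim_plus; auto. now apply Clim_opp. Qed.

Lemma Clim_Cmod u a : Clim u a -> is_lim_seq (fun n => Cmod (u n)) (Cmod a).
Proof.
  intros H.
  apply is_lim_seq_le_le with (fun n => Cmod a - Cmod (u n - a)%C)
      (fun n => Cmod a + Cmod (u n - a)%C).
  - intros n. split.
    + rewrite Cmod_minus_sym. assert (E : a = (a - u n + u n)%C) by ring.
      rewrite E at 1. generalize (Cmod_triangle (a - u n)%C (u n)). lra.
    + assert (E : u n = (u n - a + a)%C) by ring.
      rewrite E at 1. generalize (Cmod_triangle (u n - a)%C a). lra.
  - replace (Finite (Cmod a)) with (Finite (Cmod a - 0)) by (f_equal; ring).
    apply is_lim_seq_minus'; auto. apply is_lim_seq_const.
  - replace (Finite (Cmod a)) with (Finite (Cmod a + 0)) by (f_equal; ring).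
    apply is_lim_seq_plus'; auto. apply is_lim_seq_const.
Qed.

Lemma Clim_mult u v a b :
  Clim u a -> Clim v b -> Clim (fun n => u n * v n)%C (a * b)%C.
Proof.
  intros H1 H2.
  apply is_lim_seq_0_le with
    (fun n => Cmod (u n - a)%C * Cmod (v n) + Cmod a * Cmod (v n - b)%C).
  - intros n. split; [apply Cmod_ge_0|]. rewrite <- !Cmod_mult.
    replace (u n * v n - a * b)%C with ((u n - a) * v n + a * (v n - b))%C by ring.
    apply Cmod_triangle.
  - replace (Finite 0) with (Finite (0 * Cmod b + Cmod a * 0)) by (f_equal; ring).
    apply is_lim_seq_plus'.
    + apply is_lim_seq_mult'; auto. now apply Clim_Cmod.
    + apply is_lim_seq_mult'; auto. apply is_lim_seq_const.
Qed.

Lemma Clim_inv u a : Clim u a -> a <> RtoC 0 -> Clim (fun n => / u n)%C (/ a)%C.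
Proof.
  intros H Ha. assert (Hm := Clim_Cmod _ _ H).
  assert (Pa : 0 < Cmod a) by now apply Cmod_gt_0.
  assert (Ev : eventually (fun n => Cmod a / 2 < Cmod (u n))).
  { apply is_lim_seq_spec in Hm. assert (P2 : 0 < Cmod a / 2) by lra.
    destruct (Hm (mkposreal _ P2)) as [N HN]. exists N. intros n Hn.
    specialize (HN n Hn). simpl in HN. apply Rabs_def2 in HN. lra. }
  apply is_lim_seq_ext_loc with (fun n => Cmod (u n - a)%C * (/ Cmod (u n) * / Cmod a)).
  - destruct Ev as [N HN]. exists N. intros n Hn. specialize (HN n Hn).
    assert (Hu : u n <> RtoC 0) by (apply Cmod_gt_0; lra).
    rewrite <- !Cmod_inv, <- !Cmod_mult; auto. rewrite Cmod_minus_sym.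
    f_equal. field. auto.
  - replace (Finite 0) with (Finite (0 * (/ Cmod a * / Cmod a))) by (f_equal; ring).
    apply is_lim_seq_mult'; auto. apply is_lim_seq_mult'; [|apply is_lim_seq_const].
    assert (E : Finite (/ Cmod a) = Rbar_inv (Cmod a)) by reflexivity.
    rewrite E. apply is_lim_seq_inv; auto. simpl. intros X. injection X. lra.
Qed.

Lemma Clim_Re u a : Clim u a -> is_lim_seq (fun n => Re (u n)) (Re a).
Proof.
  intros H. apply is_lim_seq_ext with (fun n => Re (u n - a)%C + Re a).
  { intros n. unfold Re, Im; simpl; ring. }
  replace (Finite (Re a)) with (Finite (0 + Re a)) by (f_equal; ring).
  apply is_lim_seq_plus'; [|apply is_lim_seq_const].
  apply is_lim_seq_abs_0. apply is_lim_seq_0_le with (fun n => Cmod (u n - a)%C); auto.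
  intros n; split; [apply Rabs_pos|apply Rabs_Re_le].
Qed.

Lemma Clim_Im u a : Clim u a -> is_lim_seq (fun n => Im (u n)) (Im a).
Proof.
  intros H. apply is_lim_seq_ext with (fun n => Im (u n - a)%C + Im a).
  { intros n. unfold Re, Im; simpl; ring. }
  replace (Finite (Im a)) with (Finite (0 + Im a)) by (f_equal; ring).
  apply is_lim_seq_plus'; [|apply is_lim_seq_const].
  apply is_lim_seq_abs_0. apply is_lim_seq_0_le with (fun n => Cmod (u n - a)%C); auto.
  intros n; split; [apply Rabs_pos|apply Rabs_Im_le].
Qed.

Lemma Clim_of_ReIm u (a : C) :
  is_lim_seq (fun n => Re (u n)) (Re a) -> is_lim_seq (fun n => Im (u n)) (Im a) ->
  Clim u a.
Proof.
  intros H1 H2. apply is_lim_seq_0_le with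
    (fun n => Rabs (Re (u n) - Re a) + Rabs (Im (u n) - Im a)).
  - intros n. split; [apply Cmod_ge_0|]. apply (Cmod_le_ReIm (u n - a)%C).
  - replace (Finite 0) with (Finite (Rabs (Re a - Re a) + Rabs (Im a - Im a))).
    2:{ rewrite !Rminus_diag, Rabs_R0. f_equal; ring. }
    apply is_lim_seq_plus'; apply (is_lim_seq_abs _ (Finite _));
      apply is_lim_seq_minus'; auto; apply is_lim_seq_const.
Qed.

Lemma Clim_RtoC (u : nat -> R) (l : R) :
  is_lim_seq u l -> Clim (fun n => RtoC (u n)) (RtoC l).
Proof. intros H. apply Clim_of_ReIm; simpl; auto. apply is_lim_seq_const. Qed.

Lemma Cseq_lim_correct u l : Clim u l -> Cseq_lim u = l.
Proof.
  intros H. unfold Cseq_lim.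
  rewrite (is_lim_seq_unique _ _ (Clim_Re _ _ H)), (is_lim_seq_unique _ _ (Clim_Im _ _ H)).
  destruct l; reflexivity.
Qed.

Lemma Clim_le u l M : Clim u l -> (forall n, Cmod (u n) <= M) -> Cmod l <= M.
Proof.
  intros H HM. apply (is_lim_seq_le (fun n => Cmod (u n)) (fun _ => M) (Cmod l) M); auto.
  - now apply Clim_Cmod.
  - apply is_lim_seq_const.
Qed.

(** A comparison criterion for sequences rather than series: [v] is nondecreasing and bounded, hence
    Cauchy, and its increments dominate those of [u]. It serves for partial sums and for truncated
    integrals alike. *)
Lemma Clim_cauchy (u : nat -> C) (v : nat -> R) :
  (forall n m, (n <= m)%nat -> Cmod (u m - u n)%C <= v m - v n) ->
  (exists M, forall n, v n <= M) -> exists l, Clim u l.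
Proof.
  intros H [M HM].
  assert (Ev : ex_finite_lim_seq v).
  { apply ex_finite_lim_seq_incr with M; auto. intros n.
    specialize (H n (S n)). assert (n <= S n)%nat by lia.
    generalize (H H0), (Cmod_ge_0 (u (S n) - u n)%C). lra. }
  assert (Hc : forall w : nat -> R,
    (forall n m, Rabs (w n - w m) <= Cmod (u n - u m)%C) -> ex_finite_lim_seq w).
  { intros w Hw. apply ex_lim_seq_cauchy_corr. intros eps.
    apply ex_lim_seq_cauchy_corr in Ev. destruct (Ev eps) as [N HN]. exists N.
    intros n m Hn Hm. eapply Rle_lt_trans; [apply Hw|].
    eapply Rle_lt_trans; [|apply (HN n m Hn Hm)].
    destruct (Nat.le_ge_cases n m) as [L|L].
    - rewrite Cmod_minus_sym, Rabs_minus_sym.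
      eapply Rle_trans; [apply H, L|apply Rle_abs].
    - eapply Rle_trans; [apply H, L|apply Rle_abs]. }
  destruct (Hc (fun n => Re (u n))) as [a Ha].
  { intros n m. apply (Rabs_Re_le (u n - u m)%C). }
  destruct (Hc (fun n => Im (u n))) as [b Hb].
  { intros n m. apply (Rabs_Im_le (u n - u m)%C). }
  exists (a, b). apply Clim_of_ReIm; simpl; auto.
Qed.

Lemma cser_abs_cv (a : nat -> C) M :
  (forall n, rsum (fun k => Cmod (a k)) n <= M) -> exists l, Clim (csum a) l.
Proof.
  intros H. apply Clim_cauchy with (rsum (fun k => Cmod (a k))).
  - intros; now apply Cmod_csum_diff.
  - now exists M.
Qed.

Lemma cser_tail_le (a : nat -> C) l N e :
  Clim (csum a) l ->
  (forall n, rsum (fun k => Cmod (a k)) n - rsum (fun k => Cmod (a k)) N <= e) ->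
  Cmod (l - csum a N)%C <= e.
Proof.
  intros Hl He.
  assert (H : Clim (fun n => csum a (n + N) - csum a N)%C (l - csum a N)%C).
  { apply Clim_minus; [|apply Clim_const].
    apply (is_lim_seq_incr_n (fun n => Cmod (csum a n - l)%C) N). exact Hl. }
  apply (Clim_le _ _ _ H). intros n.
  eapply Rle_trans; [apply Cmod_csum_diff; lia|apply He].
Qed.

(** * Absolutely convergent power series *)

Lemma rsum_diff_le (a b : nat -> R) n m : (n <= m)%nat ->
  (forall k, a k <= b k) -> rsum a m - rsum a n <= rsum b m - rsum b n.
Proof.
  intros L H. induction L; simpl; [lra|]. specialize (H m). lra.
Qed.

Lemma cser_tail_dom (a : nat -> C) (v : nat -> R) l N e :
  Clim (csum a) l -> (forall k, Cmod (a k) <= v k) ->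
  (forall n, rsum v n - rsum v N <= e) -> Cmod (l - csum a N)%C <= e.
Proof.
  intros Hl Hv He. apply cser_tail_le; auto. intros n.
  destruct (Nat.le_ge_cases N n) as [L|L].
  - eapply Rle_trans; [|apply (He n)]. now apply rsum_diff_le.
  - assert (rsum (fun k => Cmod (a k)) n <= rsum (fun k => Cmod (a k)) N)
      by (apply rsum_mono; auto; intros; apply Cmod_ge_0).
    specialize (He N). lra.
Qed.

Lemma is_lim_seq_rsum (u : nat -> nat -> R) (l : nat -> R) n :
  (forall k, is_lim_seq (u k) (l k)) ->
  is_lim_seq (fun J => rsum (fun k => u k J) n) (rsum l n).
Proof.
  intros H. induction n as [|n IH]; simpl; [apply is_lim_seq_const|].
  apply is_lim_seq_plus'; auto.
Qed.

Lemma Clim_csum (u : nat -> nat -> C) (l : nat -> C) n :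
  (forall k, (k < n)%nat -> Clim (u k) (l k)) ->
  Clim (fun J => csum (fun k => u k J) n) (csum l n).
Proof.
  intros H. induction n as [|n IH]; simpl; [apply Clim_const|].
  apply Clim_plus; [apply IH; intros; apply H; lia|apply H; lia].
Qed.

(* [M] bounds the weighted [l^1] norm [sum |a_k| r^k] of the Taylor coefficients of [f]. *)
Definition AN (r M : R) (f : R -> C) : Prop :=
  exists a : nat -> C,
    (forall n, rsum (fun k => Cmod (a k) * r ^ k) n <= M) /\
    (forall u, Rabs u <= r -> Clim (csum (fun k => a k * RtoC (u ^ k))%C) (f u)).

Lemma Cmod_term_le (a : C) r u k : Rabs u <= r ->
  Cmod (a * RtoC (u ^ k))%C <= Cmod a * r ^ k.
Proof.
  intros H. rewrite Cmod_mult, Cmod_R, <- RPow_abs.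
  apply Rmult_le_compat_l; [apply Cmod_ge_0|].
  apply pow_incr; split; auto. apply Rabs_pos.
Qed.

Lemma AN_pos r M f : AN r M f -> 0 <= M.
Proof. intros (a & Ha & _). apply (Ha 0%nat). Qed.

Lemma AN_bound r M f u : AN r M f -> Rabs u <= r -> Cmod (f u) <= M.
Proof.
  intros (a & Ha & Hf) Hu. apply (Clim_le _ _ _ (Hf u Hu)). intros n.
  eapply Rle_trans; [apply Cmod_csum|]. eapply Rle_trans; [|apply (Ha n)].
  apply rsum_le. intros; now apply Cmod_term_le.
Qed.

Lemma AN_ext r M f g : (forall u, Rabs u <= r -> f u = g u) -> AN r M f -> AN r M g.
Proof.
  intros H (a & Ha & Hf). exists a. split; auto. intros u Hu. rewrite <- H; auto.
Qed.

Lemma AN_weaken r M M' f : M <= M' -> AN r M f -> AN r M' f.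
Proof.
  intros H (a & Ha & Hf). exists a. split; auto. intros n.
  eapply Rle_trans; [apply Ha|auto].
Qed.

Lemma AN_shrink r r' M f : 0 <= r' <= r -> AN r M f -> AN r' M f.
Proof.
  intros H (a & Ha & Hf). exists a. split.
  - intros n. eapply Rle_trans; [|apply (Ha n)]. apply rsum_le. intros k _.
    apply Rmult_le_compat_l; [apply Cmod_ge_0|]. now apply pow_incr.
  - intros u Hu. apply Hf. lra.
Qed.

(* Summing a series of functions amounts to Fubini for the double series of their
   coefficients; products, inverses, infinite products and integral transforms all reduce
   to this. *)
Lemma AN_series r M (eps : nat -> R) (d : nat -> R -> C) (f : R -> C) :
  0 < r -> (forall j, AN r (eps j) (d j)) -> (forall J, rsum eps J <= M) ->
  (forall u, Rabs u <= r -> Clim (csum (fun j => d j u)) (f u)) -> AN r M f.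
Proof.
  intros Hr Hd HM Hf.
  destruct (functional_choice _ Hd) as [a Ha]. clear Hd.
  assert (E0 : forall j, 0 <= eps j).
  { intros j. apply (proj1 (Ha j) 0%nat). }
  assert (T : forall j n, Cmod (a j n) * r ^ n <= eps j).
  { intros j n. eapply Rle_trans; [|apply (proj1 (Ha j) (S n))]. simpl.
    assert (0 <= rsum (fun k => Cmod (a j k) * r ^ k) n).
    { apply rsum_nonneg. intros; apply Rmult_le_pos; [apply Cmod_ge_0|apply pow_le; lra]. }
    lra. }
  assert (Hb : forall n, exists b, Clim (csum (fun j => a j n)) b).
  { intros n. apply cser_abs_cv with (M / r ^ n). intros J.
    assert (0 < r ^ n) by now apply pow_lt.
    apply Rmult_le_reg_r with (r ^ n); auto.
    unfold Rdiv. rewrite Rmult_assoc, Rinv_l, Rmult_1_r by lra.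
    rewrite Rmult_comm, <- rsum_scal. eapply Rle_trans; [|apply (HM J)].
    apply rsum_le. intros k _. rewrite Rmult_comm. apply T. }
  destruct (functional_choice _ Hb) as [b Hb']. clear Hb. exists b. split.
  - intros n.
    apply (is_lim_seq_le (fun J => rsum (fun k => Cmod (csum (fun j => a j k) J) * r ^ k) n)
      (fun _ => M) (rsum (fun k => Cmod (b k) * r ^ k) n) M).
    + intros J. eapply Rle_trans; [|apply (HM J)].
      apply Rle_trans with (rsum (fun k => rsum (fun j => Cmod (a j k) * r ^ k) J) n).
      * apply rsum_le. intros k _.
        rewrite (rsum_ext _ (fun j => r ^ k * Cmod (a j k))) by (intros; ring).
        rewrite rsum_scal, Rmult_comm. apply Rmult_le_compat_l; [apply pow_le; lra|].
        apply Cmod_csum.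
      * rewrite <- (rsum_exchange (fun j k => Cmod (a j k) * r ^ k)).
        apply rsum_le. intros j _. apply (proj1 (Ha j)).
    + apply (is_lim_seq_rsum (fun k J => Cmod (csum (fun j => a j k) J) * r ^ k)).
      intros k. apply is_lim_seq_mult'; [|apply is_lim_seq_const].
      apply Clim_Cmod, Hb'.
    + apply is_lim_seq_const.
  - intros u Hu. apply is_lim_seq_spec. intros [e0 He0]. simpl.
    assert (He : 0 < e0 / 4) by lra.
    (* Beyond [J] the functions [d j] contribute at most [e0 / 4] to [f u], and also to each partial
       sum of its power series, uniformly in the length [K]. Convergence is thereby reduced to the
       finitely many [d j] with [j < J]. *)
    destruct (rsum_tail_small eps M _ E0 HM He) as [J HJ].
    set (g := fun K j => csum (fun k => a j k * RtoC (u ^ k))%C K).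
    assert (G : forall K j, Cmod (g K j) <= eps j).
    { intros K j. eapply Rle_trans; [apply Cmod_csum|].
      eapply Rle_trans; [|apply (proj1 (Ha j) K)]. apply rsum_le.
      intros; now apply Cmod_term_le. }
    assert (A1 : forall K, Cmod (csum (fun k => b k * RtoC (u ^ k)) K - csum (g K) J)%C <= e0 / 4).
    { intros K. apply (cser_tail_dom _ eps); auto.
      apply Clim_ext with (fun J' => csum (fun k => csum (fun j => a j k * RtoC (u ^ k))%C J') K).
      { intros J'. unfold g. symmetry. apply csum_exchange. }
      apply Clim_csum. intros k _.
      apply Clim_ext with (fun J' => RtoC (u ^ k) * csum (fun j => a j k) J')%C.
      { intros J'. rewrite <- csum_scal. apply csum_ext. intros; ring. }
      rewrite Cmult_comm. apply Clim_scal, Hb'. }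
    assert (A2 : Cmod (f u - csum (fun j => d j u) J)%C <= e0 / 4).
    { apply (cser_tail_dom _ eps); auto. intros j. apply AN_bound with r; auto.
      exists (a j); apply Ha. }
    assert (A3 : Clim (fun K => csum (g K) J) (csum (fun j => d j u) J)).
    { apply (Clim_csum (fun j K => g K j)). intros j _. apply (proj2 (Ha j)); auto. }
    apply is_lim_seq_spec in A3. destruct (A3 (mkposreal _ He)) as [N HN].
    exists N. intros K HK. specialize (HN K HK). simpl in HN.
    rewrite Rminus_0_r in *. rewrite Rabs_pos_eq in * by apply Cmod_ge_0.
    specialize (A1 K). rewrite Cmod_minus_sym in A2.
    replace (csum (fun k => b k * RtoC (u ^ k)) K - f u)%C with
      ((csum (fun k => b k * RtoC (u ^ k)) K - csum (g K) J) +
       ((csum (g K) J - csum (fun j => d j u) J) + (csum (fun j => d j u) J - f u)))%C by ring.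
    eapply Rle_lt_trans; [apply Cmod_triangle|].
    assert (X := Cmod_triangle (csum (g K) J - csum (fun j => d j u) J)%C
                   (csum (fun j => d j u) J - f u)%C).
    lra.
Qed.

Lemma rsum_single_le (a : nat -> R) m (c : R) n : 0 <= c ->
  (forall k, a k = if Nat.eqb k m then c else 0) -> rsum a n <= c.
Proof.
  intros Hc H.
  assert (rsum a n = if Nat.ltb m n then c else 0); [|destruct (Nat.ltb m n); lra].
  induction n as [|n IH]; simpl; auto. rewrite IH, H.
  destruct (Nat.ltb_spec m n), (Nat.ltb_spec m (S n)), (Nat.eqb_spec n m); try lia; lra.
Qed.

Lemma csum_single (a : nat -> C) m (c : C) n :
  (forall k, a k = if Nat.eqb k m then c else RtoC 0) -> (m < n)%nat -> csum a n = c.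
Proof.
  intros H L.
  assert (csum a n = if Nat.ltb m n then c else RtoC 0).
  { clear L. induction n as [|n IH]; simpl; auto. rewrite IH, H.
    destruct (Nat.ltb_spec m n), (Nat.ltb_spec m (S n)), (Nat.eqb_spec n m); try lia; ring. }
  rewrite H0. destruct (Nat.ltb_spec m n); auto; lia.
Qed.

Lemma AN_monomial r c m : 0 <= r -> AN r (Cmod c * r ^ m) (fun u => c * RtoC (u ^ m))%C.
Proof.
  intros Hr. exists (fun k => if Nat.eqb k m then c else RtoC 0). split.
  - intros n. apply rsum_single_le with m.
    + apply Rmult_le_pos; [apply Cmod_ge_0|now apply pow_le].
    + intros k. destruct (Nat.eqb_spec k m); [now subst|]. rewrite Cmod_0; ring.
  - intros u _. apply Clim_ext_loc with (fun _ => c * RtoC (u ^ m))%C (S m).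
    + intros n Hn. symmetry. apply csum_single with m; [|lia]. intros k.
      destruct (Nat.eqb_spec k m); [now subst|ring].
    + apply Clim_const.
Qed.

Lemma AN_const r c : 0 <= r -> AN r (Cmod c) (fun _ => c).
Proof.
  intros Hr. replace (Cmod c) with (Cmod c * r ^ 0) by (simpl; ring).
  apply AN_ext with (fun u => c * RtoC (u ^ 0))%C; [|now apply AN_monomial].
  intros u _. simpl. ring.
Qed.

Lemma AN_plus r M1 M2 f g :
  AN r M1 f -> AN r M2 g -> 0 <= r -> AN r (M1 + M2) (fun u => f u + g u)%C.
Proof.
  intros (a & Ha & Hf) (b & Hb & Hg) Hr. exists (fun k => a k + b k)%C. split.
  - intros n. specialize (Ha n). specialize (Hb n).
    apply Rle_trans with (rsum (fun k => Cmod (a k) * r ^ k + Cmod (b k) * r ^ k) n).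
    + apply rsum_le. intros k _. rewrite <- Rmult_plus_distr_r.
      apply Rmult_le_compat_r; [now apply pow_le|apply Cmod_triangle].
    + rewrite rsum_plus. lra.
  - intros u Hu. eapply Clim_ext; [|apply Clim_plus; [apply Hf, Hu|apply Hg, Hu]].
    intros n. cbv beta. rewrite <- csum_plus. apply csum_ext. intros; ring.
Qed.

Lemma AN_scal r M c f : AN r M f -> AN r (Cmod c * M) (fun u => c * f u)%C.
Proof.
  intros (a & Ha & Hf). exists (fun k => c * a k)%C. split.
  - intros n. rewrite (rsum_ext _ (fun k => Cmod c * (Cmod (a k) * r ^ k))).
    + rewrite rsum_scal. apply Rmult_le_compat_l; [apply Cmod_ge_0|auto].
    + intros. rewrite Cmod_mult; ring.
  - intros u Hu. eapply Clim_ext; [|apply Clim_scal, Hf, Hu].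
    intros n. cbv beta. rewrite <- csum_scal. apply csum_ext. intros; ring.
Qed.

Lemma AN_mulX r M f : 0 <= r -> AN r M f -> AN r (r * M) (fun u => RtoC u * f u)%C.
Proof.
  intros Hr (a & Ha & Hf).
  exists (fun k => match k with O => RtoC 0 | S j => a j end). split.
  - intros n.
    assert (E : rsum (fun k => Cmod (match k with O => RtoC 0 | S j => a j end) * r ^ k) (S n)
      = r * rsum (fun k => Cmod (a k) * r ^ k) n).
    { induction n as [|n IH]; [simpl; rewrite Cmod_0; ring|].
      change (rsum ?f (S (S n))) with (rsum f (S n) + f (S n)). rewrite IH. simpl. ring. }
    apply Rle_trans with (r * rsum (fun k => Cmod (a k) * r ^ k) n).
    + rewrite <- E. apply rsum_mono; [|lia]. intros k.
      apply Rmult_le_pos; [apply Cmod_ge_0|now apply pow_le].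
    + apply Rmult_le_compat_l; auto.
  - intros u Hu. assert (H := Clim_scal (RtoC u) _ _ (Hf u Hu)).
    set (F := csum _).
    assert (E : forall n, F (S n) = (RtoC u * csum (fun k => a k * RtoC (u ^ k)) n)%C).
    { induction n as [|n IH]; [unfold F; simpl; ring|].
      change (F (S (S n))) with (F (S n) + a n * RtoC (u ^ S n))%C.
      rewrite IH. simpl. rewrite RtoC_mult. ring. }
    apply (is_lim_seq_incr_1 (fun n => Cmod (F n - RtoC u * f u)%C)).
    eapply is_lim_seq_ext; [|apply H]. intros n. cbv beta. now rewrite E.
Qed.

Lemma AN_mulXn r M f m : 0 <= r -> AN r M f -> AN r (r ^ m * M) (fun u => RtoC (u ^ m) * f u)%C.
Proof.
  intros Hr H. induction m as [|m IH].
  - apply AN_ext with f; [intros; simpl; ring|]. simpl. now rewrite Rmult_1_l.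
  - apply AN_ext with (fun u => RtoC u * (RtoC (u ^ m) * f u))%C.
    + intros u _. simpl. rewrite RtoC_mult. ring.
    + simpl. rewrite Rmult_assoc. now apply AN_mulX.
Qed.

(** Only [f] is expanded: the product is the series of the functions [a k * u^k * g u], whose norms
    sum to at most [M1 * M2], so [AN_series] takes the place of the Cauchy product. *)
Lemma AN_mult r M1 M2 f g : 0 < r ->
  AN r M1 f -> AN r M2 g -> AN r (M1 * M2) (fun u => f u * g u)%C.
Proof.
  intros Hr Hf Hg. assert (P2 := AN_pos _ _ _ Hg). destruct Hf as (a & Ha & Hf).
  apply AN_series with (fun k => Cmod (a k) * (r ^ k * M2))
    (fun k u => a k * (RtoC (u ^ k) * g u))%C; auto.
  - intros k. apply AN_scal, AN_mulXn; auto; lra.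
  - intros n. rewrite (rsum_ext _ (fun k => M2 * (Cmod (a k) * r ^ k))) by (intros; ring).
    rewrite rsum_scal, Rmult_comm. apply Rmult_le_compat_r; auto.
  - intros u Hu. rewrite Cmult_comm. eapply Clim_ext; [|apply Clim_scal, Hf, Hu].
    intros n. cbv beta. rewrite <- csum_scal. apply csum_ext. intros; ring.
Qed.

Lemma AN_pow r M f m : 0 < r -> AN r M f -> AN r (M ^ m) (fun u => Cpow (f u) m)%C.
Proof.
  intros Hr H. induction m as [|m IH]; simpl.
  - apply AN_weaken with (Cmod (RtoC 1)); [rewrite Cmod_1; lra|]. apply AN_const; lra.
  - now apply AN_mult.
Qed.

Lemma AN_opp r M f : AN r M f -> AN r M (fun u => - f u)%C.
Proof.
  intros H. apply AN_ext with (fun u => RtoC (-1) * f u)%C.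
  - intros u _. replace (RtoC (-1)) with (- RtoC 1)%C
      by (apply injective_projections; simpl; ring). ring.
  - replace M with (Cmod (RtoC (-1)) * M); [now apply AN_scal|].
    rewrite Cmod_R, Rabs_left; lra.
Qed.

Lemma rsum_geom_le q n : 0 <= q < 1 -> rsum (fun k => q ^ k) n <= / (1 - q).
Proof.
  intros Hq.
  assert (E : rsum (fun k => q ^ k) n * (1 - q) = 1 - q ^ n).
  { induction n as [|n IH]; simpl; [ring|]. rewrite Rmult_plus_distr_r, IH. ring. }
  apply Rmult_le_reg_r with (1 - q); [lra|]. rewrite E, Rinv_l by lra.
  assert (0 <= q ^ n) by (apply pow_le; lra). lra.
Qed.

Lemma Clim_geom (w : C) : Cmod w < 1 -> Clim (csum (fun k => Cpow w k)) (/ (1 - w))%C.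
Proof.
  intros Hw.
  assert (W : (1 - w)%C <> RtoC 0).
  { intros E. assert (w = RtoC 1) by (rewrite <- (Cplus_0_l w), <- E; ring).
    subst w. rewrite Cmod_1 in Hw. lra. }
  assert (E : forall n, csum (fun k => Cpow w k) n = ((1 - Cpow w n) * / (1 - w))%C).
  { induction n as [|n IH]; simpl; [ring|]. rewrite IH. field. auto. }
  apply is_lim_seq_ext with (fun n => Cmod w ^ n * Cmod (/ (1 - w))%C).
  - intros n. rewrite E, <- Cmod_pow, <- Cmod_mult, <- Cmod_opp. f_equal. ring.
  - replace (Finite 0) with (Finite (0 * Cmod (/ (1 - w))%C)) by (f_equal; ring).
    apply is_lim_seq_mult'; [|apply is_lim_seq_const]. apply is_lim_seq_geom.
    rewrite Rabs_pos_eq; auto. apply Cmod_ge_0.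
Qed.

Lemma AN_neumann r q w : 0 < r -> q < 1 -> AN r q w -> AN r (/ (1 - q)) (fun u => / (1 - w u))%C.
Proof.
  intros Hr Hq Hw. assert (P := AN_pos _ _ _ Hw).
  apply AN_series with (fun k => q ^ k) (fun k u => Cpow (w u) k); auto.
  - intros k. now apply AN_pow.
  - intros n. now apply rsum_geom_le.
  - intros u Hu. apply Clim_geom. eapply Rle_lt_trans; [|apply Hq].
    now apply AN_bound with r.
Qed.

Lemma AN_id r : 0 <= r -> AN r r (fun u => RtoC u).
Proof.
  intros Hr. apply AN_ext with (fun u => RtoC u * 1)%C; [intros; ring|].
  replace r with (r * 1) at 2 by ring. apply AN_mulX; auto.
  apply AN_weaken with (Cmod (RtoC 1)); [rewrite Cmod_1; lra|]. now apply AN_const.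
Qed.

(** Each [(v + u)^k] has norm at most [(|v| + r')^k <= r^k], so the bound [M] survives the change of
    centre. *)
Lemma AN_recentre r r' M f v : 0 < r' -> Rabs v + r' <= r -> AN r M f ->
  AN r' M (fun u => f (v + u)).
Proof.
  intros Hr' Hv (a & Ha & Hf). assert (V := Rabs_pos v).
  apply AN_series with (fun k => Cmod (a k) * (Rabs v + r') ^ k)
    (fun k u => a k * Cpow (RtoC v + RtoC u) k)%C; auto.
  - intros k. apply AN_scal, AN_pow; auto.
    apply AN_plus; [|apply AN_id; lra|lra]. rewrite <- Cmod_R. apply AN_const; lra.
  - intros n. eapply Rle_trans; [|apply (Ha n)]. apply rsum_le. intros k _.
    apply Rmult_le_compat_l; [apply Cmod_ge_0|]. apply pow_incr. lra.
  - intros u Hu. eapply Clim_ext; [|apply (Hf (v + u))].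
    + intros n. apply csum_ext. intros k _. now rewrite RtoC_pow, RtoC_plus.
    + eapply Rle_trans; [apply Rabs_triang|]. lra.
Qed.

(** If [a k] is the first nonzero coefficient, vanishing at [u] makes [|a k| u^k] at most the tail,
    which is [O(u^(k+1))]; a small [u] gives a contradiction. Vanishing on one side of 0 is assumed
    because continuation proceeds from a half-line to the left. *)
Lemma AN_coef_zero r M (a : nat -> C) delta : 0 < r -> 0 < delta <= r ->
  (forall n, rsum (fun k => Cmod (a k) * r ^ k) n <= M) ->
  (forall u, 0 < u < delta -> Clim (csum (fun k => a k * RtoC (u ^ k))%C) 0) ->
  forall k, a k = RtoC 0.
Proof.
  intros Hr Hd Ha H0.
  assert (M0 : 0 <= M) by apply (Ha 0%nat).
  intros k. induction k as [k IH] using (well_founded_induction lt_wf).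
  apply Cmod_eq_0. apply Rle_antisym; [|apply Cmod_ge_0].
  apply Rnot_lt_le. intros Hk.
  assert (B : forall u, 0 < u < delta -> Cmod (a k) <= u * (M / r ^ (S k))).
  { intros u Hu. assert (Pr : 0 < r ^ S k) by now apply pow_lt.
    assert (Pu : 0 < u ^ k) by (apply pow_lt; lra).
    assert (E : csum (fun j => a j * RtoC (u ^ j))%C (S k) = (a k * RtoC (u ^ k))%C).
    { simpl. rewrite (csum_ext _ (fun _ => RtoC 0)); [rewrite csum_zero; ring|].
      intros j Hj. rewrite IH by auto. ring. }
    assert (T := cser_tail_dom _ (fun j => Cmod (a j * RtoC (u ^ j))%C) 0 (S k)
      (u ^ S k * (M / r ^ S k)) (H0 u Hu) (fun j => Rle_refl _)).
    rewrite E in T. rewrite Cmod_minus_sym in T.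
    replace (a k * RtoC (u ^ k) - 0)%C with (a k * RtoC (u ^ k))%C in T by ring.
    rewrite Cmod_mult, Cmod_R, Rabs_pos_eq in T by lra.
    apply Rmult_le_reg_r with (u ^ k); auto.
    replace (u * (M / r ^ S k) * u ^ k) with (u ^ S k * (M / r ^ S k)) by (simpl; field; split; [apply Rgt_not_eq, pow_lt|]; lra).
    apply T. intros n.
    assert (U : forall j, (S k <= j)%nat -> u ^ j <= (u ^ S k / r ^ S k) * r ^ j).
    { intros j Hj. replace j with (S k + (j - S k))%nat by lia.
      rewrite !pow_add. unfold Rdiv.
      replace (u ^ S k * / r ^ S k * (r ^ S k * r ^ (j - S k))) with
        (u ^ S k * r ^ (j - S k)) by (field; lra).
      apply Rmult_le_compat_l; [apply pow_le; lra|]. apply pow_incr; lra. }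
    destruct (Nat.le_ge_cases (S k) n) as [L|L].
    - apply Rle_trans with ((u ^ S k / r ^ S k) * rsum (fun j => Cmod (a j) * r ^ j) n).
      + assert (0 <= u ^ S k / r ^ S k).
        { apply Rmult_le_pos; [apply pow_le; lra|]. left; now apply Rinv_0_lt_compat. }
        assert (0 <= rsum (fun j => Cmod (a j) * r ^ j) (S k)).
        { apply rsum_nonneg; intros; apply Rmult_le_pos; [apply Cmod_ge_0|apply pow_le; lra]. }
        assert (rsum (fun j => Cmod (a j * RtoC (u ^ j))%C) n -
          rsum (fun j => Cmod (a j * RtoC (u ^ j))%C) (S k) <=
          u ^ S k / r ^ S k * (rsum (fun j => Cmod (a j) * r ^ j) n -
             rsum (fun j => Cmod (a j) * r ^ j) (S k))); [|nra].
        clear T E. induction L; [simpl; lra|].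
        change (rsum ?f (S m)) with (rsum f m + f m). cbv beta.
        rewrite Cmod_mult, Cmod_R, (Rabs_pos_eq (u ^ m)) by (apply pow_le; lra).
        assert (Cmod (a m) * u ^ m <= u ^ S k / r ^ S k * (Cmod (a m) * r ^ m)).
        { specialize (U m L). assert (X := Cmod_ge_0 (a m)). nra. }
        lra.
      + replace (u ^ S k * (M / r ^ S k)) with (u ^ S k / r ^ S k * M) by (field; lra).
        apply Rmult_le_compat_l; [|apply Ha].
        apply Rmult_le_pos; [apply pow_le; lra|]. left; now apply Rinv_0_lt_compat.
    - assert (rsum (fun j => Cmod (a j * RtoC (u ^ j))%C) n <=
              rsum (fun j => Cmod (a j * RtoC (u ^ j))%C) (S k))
        by (apply rsum_mono; auto; intros; apply Cmod_ge_0).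
      assert (0 <= u ^ S k * (M / r ^ S k)); [|lra].
      apply Rmult_le_pos; [apply pow_le; lra|]. apply Rmult_le_pos; auto.
      left; now apply Rinv_0_lt_compat. }
  set (D := M / r ^ S k) in *.
  assert (D0 : 0 <= D).
  { apply Rmult_le_pos; auto. left; apply Rinv_0_lt_compat, pow_lt; auto. }
  (* Chosen so that [u * D] is at most half of [|a k|]; [D + 1] guards against [D = 0]. *)
  set (u := Rmin (delta / 2) (Cmod (a k) / (2 * (D + 1)))).
  assert (Hu : 0 < u).
  { apply Rmin_glb_lt; [lra|]. apply Rdiv_lt_0_compat; lra. }
  assert (u <= delta / 2) by apply Rmin_l.
  assert (u <= Cmod (a k) / (2 * (D + 1))) by apply Rmin_r.
  specialize (B u). assert (Cmod (a k) <= u * D) by (apply B; lra).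
  assert (u * D <= Cmod (a k) / (2 * (D + 1)) * (D + 1)) by nra.
  replace (Cmod (a k) / (2 * (D + 1)) * (D + 1)) with (Cmod (a k) / 2) in H3 by (field; lra).
  lra.
Qed.

Lemma AN_coef_unique r r' M M' (a b : nat -> C) delta f : 0 < r -> 0 < r' -> 0 < delta ->
  (forall n, rsum (fun k => Cmod (a k) * r ^ k) n <= M) ->
  (forall n, rsum (fun k => Cmod (b k) * r' ^ k) n <= M') ->
  (forall u, 0 < u < delta -> Clim (csum (fun k => a k * RtoC (u ^ k))%C) (f u)) ->
  (forall u, 0 < u < delta -> Clim (csum (fun k => b k * RtoC (u ^ k))%C) (f u)) ->
  forall k, a k = b k.
Proof.
  intros Hr Hr' Hd Ha Hb Hfa Hfb k.
  set (s := Rmin r r'). assert (Hs : 0 < s) by now apply Rmin_glb_lt.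
  assert (s <= r) by apply Rmin_l. assert (s <= r') by apply Rmin_r.
  replace (a k) with ((a k - b k) + b k)%C by ring.
  rewrite (AN_coef_zero s (M + M') (fun j => a j - b j)%C (Rmin delta s)); try ring; auto.
  - split; [now apply Rmin_glb_lt|apply Rmin_r].
  - intros n. specialize (Ha n). specialize (Hb n).
    apply Rle_trans with
      (rsum (fun k => Cmod (a k) * r ^ k) n + rsum (fun k => Cmod (b k) * r' ^ k) n); [|lra].
    rewrite <- rsum_plus. apply rsum_le. intros j _.
    assert (s ^ j <= r ^ j) by (apply pow_incr; lra).
    assert (s ^ j <= r' ^ j) by (apply pow_incr; lra).
    assert (0 <= s ^ j) by (apply pow_le; lra).
    assert (Cmod (a j - b j)%C <= Cmod (a j) + Cmod (b j)).
    { rewrite <- (Cmod_opp (b j)). apply Cmod_triangle. }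
    assert (A := Cmod_ge_0 (a j)). assert (B := Cmod_ge_0 (b j)). nra.
  - intros u Hu. assert (u < delta).
    { eapply Rlt_le_trans; [apply Hu|apply Rmin_l]. }
    replace (RtoC 0) with (f u - f u)%C by ring.
    eapply Clim_ext; [|apply Clim_minus; [apply Hfa|apply Hfb]; lra].
    intros n. cbv beta. rewrite <- csum_minus. apply csum_ext. intros; ring.
Qed.

(** * Analyticity along a horizontal line *)

(** Dropping the constant coefficient and shifting the others costs a factor [1 / r]. This divided
    difference replaces differentiation: it gives reciprocals, first-order expansions and the
    removal of zeros. *)
Lemma AN_slope r M f : 0 < r -> AN r M f ->
  exists g, AN r (M / r) g /\ (forall u, Rabs u <= r -> f u = f 0 + RtoC u * g u)%C.
Proof.
  intros Hr (a & Ha & Hf).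
  assert (E : forall u n, csum (fun k => a k * RtoC (u ^ k))%C (S n) =
     (a 0%nat + RtoC u * csum (fun k => a (S k) * RtoC (u ^ k)) n)%C).
  { intros u n. induction n as [|n IH]; [simpl; ring|].
    change (csum ?F (S (S n))) with (csum F (S n) + F (S n))%C. rewrite IH. simpl.
    rewrite RtoC_mult. ring. }
  assert (F0 : f 0 = a 0%nat).
  { apply Clim_unique with (csum (fun k => a k * RtoC (0 ^ k))%C).
    - apply Hf. rewrite Rabs_R0; lra.
    - apply Clim_ext_loc with (fun _ => a 0%nat) 1%nat; [|apply Clim_const].
      intros n Hn. destruct n; [lia|]. rewrite E. ring. }
  assert (Hg : forall n, rsum (fun k => Cmod (a (S k)) * r ^ k) n <= M / r).
  { intros n. apply Rmult_le_reg_r with r; auto.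
    replace (M / r * r) with M by (field; lra).
    eapply Rle_trans; [|apply (Ha (S n))]. rewrite Rmult_comm, <- rsum_scal.
    clear. assert (X : forall (b : nat -> R) n, rsum b (S n) = b 0%nat + rsum (fun k => b (S k)) n).
    { intros b m. induction m as [|m IH]; [simpl; ring|].
      change (rsum b (S (S m))) with (rsum b (S m) + b (S m)). rewrite IH. simpl. ring. }
    rewrite X. assert (A := Cmod_ge_0 (a 0%nat)). simpl.
    assert (rsum (fun k => r * (Cmod (a (S k)) * r ^ k)) n =
            rsum (fun k => Cmod (a (S k)) * (r * r ^ k)) n) by (apply rsum_ext; intros; ring).
    lra. }
  assert (Cv : forall u, exists l, Rabs u <= r -> Clim (csum (fun k => a (S k) * RtoC (u ^ k))%C) l).
  { intros u. destruct (Rle_dec (Rabs u) r) as [Hu|Hu]; [|exists 0; tauto].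
    destruct (cser_abs_cv (fun k => a (S k) * RtoC (u ^ k))%C (M / r)) as [l Hl].
    - intros n. eapply Rle_trans; [|apply (Hg n)]. apply rsum_le.
      intros; now apply Cmod_term_le.
    - now exists l. }
  destruct (functional_choice _ Cv) as [g Hg'].
  exists g. split; [exists (fun k => a (S k)); split; auto|].
  intros u Hu. rewrite F0.
  apply Clim_unique with (fun n => csum (fun k => a k * RtoC (u ^ k))%C (S n)).
  - apply (is_lim_seq_incr_1 (fun n => Cmod (csum (fun k => a k * RtoC (u ^ k)) n - f u)%C)).
    now apply Hf.
  - apply Clim_ext with (fun n => a 0%nat + RtoC u * csum (fun k => a (S k) * RtoC (u ^ k)) n)%C.
    + intros n. now rewrite E.
    + apply Clim_plus; [apply Clim_const|]. apply Clim_scal. now apply Hg'.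
Qed.

(** Real analyticity at [x0] of a complex-valued function. A function on a horizontal line of the
    complex plane is regarded as a function of the real part. *)
Definition ran (f : R -> C) (x0 : R) : Prop :=
  exists r M, 0 < r /\ AN r M (fun u => f (x0 + u)).

Lemma ran_ext_loc f g x0 d : 0 < d ->
  (forall x, Rabs (x - x0) <= d -> f x = g x) -> ran f x0 -> ran g x0.
Proof.
  intros Hd H (r & M & Hr & HA). exists (Rmin r d), M.
  assert (0 < Rmin r d) by now apply Rmin_glb_lt. split; auto.
  apply AN_ext with (fun u => f (x0 + u)).
  - intros u Hu. apply H. replace (x0 + u - x0) with u by ring.
    eapply Rle_trans; [apply Hu|apply Rmin_r].
  - apply AN_shrink with r; auto. split; [lra|apply Rmin_l].
Qed.

Lemma ran_ext f g x0 : (forall x, f x = g x) -> ran f x0 -> ran g x0.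
Proof. intros H. apply ran_ext_loc with 1; auto. lra. Qed.

Lemma ran_const c x0 : ran (fun _ => c) x0.
Proof. exists 1, (Cmod c). split; [lra|]. apply AN_const; lra. Qed.

Lemma AN_common f g x0 : ran f x0 -> ran g x0 ->
  exists r M1 M2, 0 < r /\ AN r M1 (fun u => f (x0 + u)) /\ AN r M2 (fun u => g (x0 + u)).
Proof.
  intros (r & M & Hr & Hf) (r' & M' & Hr' & Hg).
  exists (Rmin r r'), M, M'. assert (0 < Rmin r r') by now apply Rmin_glb_lt.
  split; auto. split.
  - apply AN_shrink with r; auto. split; [lra|apply Rmin_l].
  - apply AN_shrink with r'; auto. split; [lra|apply Rmin_r].
Qed.

Lemma ran_plus f g x0 : ran f x0 -> ran g x0 -> ran (fun x => f x + g x)%C x0.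
Proof.
  intros Hf Hg. destruct (AN_common _ _ _ Hf Hg) as (r & M & M' & Hr & A & B).
  exists r, (M + M'). split; auto. apply AN_plus; auto; lra.
Qed.

Lemma ran_mult f g x0 : ran f x0 -> ran g x0 -> ran (fun x => f x * g x)%C x0.
Proof.
  intros Hf Hg. destruct (AN_common _ _ _ Hf Hg) as (r & M & M' & Hr & A & B).
  exists r, (M * M'). split; auto. now apply AN_mult.
Qed.

Lemma ran_opp f x0 : ran f x0 -> ran (fun x => - f x)%C x0.
Proof. intros (r & M & Hr & A). exists r, M. split; auto. now apply AN_opp. Qed.

Lemma ran_minus f g x0 : ran f x0 -> ran g x0 -> ran (fun x => f x - g x)%C x0.
Proof. intros Hf Hg. apply ran_plus; auto. now apply ran_opp. Qed.

Lemma ran_id x0 : ran (fun x => RtoC x) x0.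
Proof.
  exists 1, (Cmod (RtoC x0) + 1). split; [lra|].
  apply AN_ext with (fun u => RtoC x0 + RtoC u)%C.
  - intros. now rewrite RtoC_plus.
  - apply AN_plus; [apply AN_const|apply AN_id|]; lra.
Qed.

(** With [c = f x0] one has [f (x0 + u) = c (1 - w u)], where [w u = - u g u / c] vanishes at 0, so
    a Neumann series applies on a smaller disc. *)
Lemma ran_inv f x0 : ran f x0 -> f x0 <> RtoC 0 -> ran (fun x => / f x)%C x0.
Proof.
  intros (r & M & Hr & A) H0.
  destruct (AN_slope _ _ _ Hr A) as (g & Hg & E).
  rewrite Rplus_0_r in E. set (c := f x0) in *.
  assert (Hc : 0 < Cmod c) by now apply Cmod_gt_0.
  assert (G0 := AN_pos _ _ _ Hg). set (D := M / r) in *.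
  (* On this radius [u * g u] has norm at most [|c| / 2], so the geometric ratio is at most 1/2;
     [D + 1] guards against [D = 0]. *)
  set (r' := Rmin r (Cmod c / (2 * (D + 1)))).
  assert (Hr' : 0 < r').
  { apply Rmin_glb_lt; auto. apply Rdiv_lt_0_compat; lra. }
  assert (r' <= r) by apply Rmin_l.
  assert (R2 : r' <= Cmod c / (2 * (D + 1))) by apply Rmin_r.
  assert (AW : AN r' (/ 2) (fun u => (- / c) * (RtoC u * g u))%C).
  { apply AN_weaken with (Cmod (- / c)%C * (r' * D)).
    - rewrite Cmod_opp, Cmod_inv by auto.
      apply Rmult_le_reg_l with (Cmod c); auto. rewrite <- Rmult_assoc, Rinv_r by lra.
      assert (r' * (D + 1) <= Cmod c / (2 * (D + 1)) * (D + 1)).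
      { apply Rmult_le_compat_r; lra. }
      replace (Cmod c / (2 * (D + 1)) * (D + 1)) with (Cmod c / 2) in H1 by (field; lra). lra.
    - apply AN_scal, AN_mulX; [lra|]. apply AN_shrink with r; auto; lra. }
  exists r', (Cmod (/ c) * (/ (1 - / 2))). split; auto.
  apply AN_ext with (fun u => / c * / (1 - (- / c) * (RtoC u * g u)))%C.
  - intros u Hu. rewrite E by lra.
    assert (W := AN_bound _ _ _ u AW Hu). cbv beta in W.
    assert (N : (c + RtoC u * g u)%C <> RtoC 0).
    { intros Z. assert (Z2 : (RtoC u * g u)%C = (- c)%C).
      { replace (RtoC u * g u)%C with ((c + RtoC u * g u) - c)%C by ring. rewrite Z. ring. }
      rewrite Z2 in W. replace (- / c * - c)%C with (RtoC 1) in W by (field; auto).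
      rewrite Cmod_1 in W. lra. }
    replace (1 - - / c * (RtoC u * g u))%C with (/ c * (c + RtoC u * g u))%C by (field; auto).
    field. split; auto.
  - apply AN_scal. apply AN_neumann; [auto|lra|auto].
Qed.

Lemma ran_div f g x0 : ran f x0 -> ran g x0 -> g x0 <> RtoC 0 -> ran (fun x => f x / g x)%C x0.
Proof. intros Hf Hg H0. apply ran_mult; auto. now apply ran_inv. Qed.

Lemma ran_affine f (alpha beta : R) x0 : alpha <> 0 ->
  ran f (alpha * x0 + beta) -> ran (fun x => f (alpha * x + beta)) x0.
Proof.
  intros Ha (r & M & Hr & a & A & B). exists (r / Rabs alpha), M.
  assert (P : 0 < Rabs alpha) by now apply Rabs_pos_lt.
  split; [now apply Rdiv_lt_0_compat|].
  exists (fun k => a k * RtoC (alpha ^ k))%C. split.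
  - intros n. eapply Rle_trans; [|apply (A n)]. apply Req_le, rsum_ext. intros k _.
    rewrite Cmod_mult, Cmod_R, <- RPow_abs, Rmult_assoc, <- Rpow_mult_distr.
    do 2 f_equal. field. lra.
  - intros u Hu. eapply Clim_ext; [|replace (alpha * (x0 + u) + beta) with
      (alpha * x0 + beta + alpha * u) by ring; apply B].
    + intros n. apply csum_ext. intros k _. rewrite Rpow_mult_distr, RtoC_mult. ring.
    + rewrite Rabs_mult. apply Rmult_le_compat_l with (r := Rabs alpha) in Hu; [|lra].
      replace r with (Rabs alpha * (r / Rabs alpha)) by (field; lra). auto.
Qed.

Lemma ran_shift f (beta : R) x0 : ran f (x0 + beta) -> ran (fun x => f (x + beta)) x0.
Proof.
  intros H. apply ran_ext with (fun x => f (1 * x + beta)).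
  - intros. now rewrite Rmult_1_l.
  - apply ran_affine; [lra|]. now rewrite Rmult_1_l.
Qed.

(** * The exponential series and first-order expansions *)

Lemma rsum_sum_n (a : nat -> R) n : rsum a (S n) = sum_n a n.
Proof.
  induction n as [|n IH]; [simpl; rewrite sum_O; ring|].
  rewrite sum_Sn, <- IH. reflexivity.
Qed.

Lemma is_series_rsum (a : nat -> R) (l : R) : is_series a l -> is_lim_seq (rsum a) l.
Proof.
  intros H. apply is_lim_seq_incr_1.
  apply is_lim_seq_ext with (sum_n a); auto.
  intros n. symmetry. apply rsum_sum_n.
Qed.

Lemma exp_series x : is_lim_seq (rsum (fun k => x ^ k / INR (fact k))) (exp x).
Proof.
  apply is_series_rsum.
  apply is_series_ext with (fun k => scal (pow_n x k) (/ INR (fact k))).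
  - intros n. rewrite pow_n_pow. reflexivity.
  - apply is_exp_Reals.
Qed.

Lemma exp_partial_le x n : 0 <= x -> rsum (fun k => x ^ k / INR (fact k)) n <= exp x.
Proof.
  intros Hx. apply (is_lim_seq_incr_compare _ _ (exp_series x)).
  intros k. simpl. assert (0 < / INR (fact k)) by apply Rinv_0_lt_compat, INR_fact_lt_0.
  assert (0 <= x ^ k) by now apply pow_le.
  assert (0 <= x ^ k * / INR (fact k)) by (apply Rmult_le_pos; lra). unfold Rdiv. lra.
Qed.

Lemma AN_exp r lam : 0 < r -> AN r (exp (Rabs lam * r)) (fun u => RtoC (exp (lam * u))).
Proof.
  intros Hr. exists (fun k => RtoC (lam ^ k / INR (fact k))). split.
  - intros n. eapply Rle_trans; [|apply (exp_partial_le (Rabs lam * r) n)].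
    + apply Req_le, rsum_ext. intros k _. rewrite Cmod_R. unfold Rdiv.
      rewrite Rabs_mult, <- RPow_abs, Rpow_mult_distr, (Rabs_pos_eq (/ _)).
      * ring.
      * left. apply Rinv_0_lt_compat, INR_fact_lt_0.
    + apply Rmult_le_pos; [apply Rabs_pos|lra].
  - intros u _. eapply Clim_ext; [|apply Clim_RtoC, exp_series].
    intros n. cbv beta. rewrite <- csum_RtoC. apply csum_ext. intros k _.
    rewrite <- RtoC_mult. f_equal. rewrite Rpow_mult_distr. unfold Rdiv. ring.
Qed.

Lemma ran_exp lam x0 : ran (fun x => RtoC (exp (lam * x))) x0.
Proof.
  exists 1, (Cmod (RtoC (exp (lam * x0))) * exp (Rabs lam * 1)). split; [lra|].
  apply AN_ext with (fun u => RtoC (exp (lam * x0)) * RtoC (exp (lam * u)))%C.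
  - intros u _. rewrite <- RtoC_mult, <- exp_plus. do 2 f_equal. ring.
  - apply AN_scal, AN_exp. lra.
Qed.

(** [AN_slope] applied twice. The quadratic remainder yields continuity and later identifies [c]
    with [C_derive]. *)
Lemma ran_first_order f x0 : ran f x0 -> exists c L d, 0 < d /\ 0 <= L /\
  forall u, Rabs u <= d -> Cmod (f (x0 + u)%R - f x0 - RtoC u * c)%C <= L * u ^ 2.
Proof.
  intros (r & M & Hr & A).
  destruct (AN_slope _ _ _ Hr A) as (g & Hg & E).
  destruct (AN_slope _ _ _ Hr Hg) as (g2 & Hg2 & E2).
  exists (g 0), (M / r / r), r. split; auto. split; [eapply AN_pos; eauto|].
  intros u Hu. rewrite E by auto. rewrite E2 by auto. rewrite Rplus_0_r.
  replace (f x0 + RtoC u * (g 0 + RtoC u * g2 u) - f x0 - RtoC u * g 0)%C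
    with (RtoC u * RtoC u * g2 u)%C by ring.
  rewrite !Cmod_mult, Cmod_R. rewrite <- Rabs_mult, Rabs_pos_eq by nra.
  rewrite Rmult_comm. replace (u ^ 2) with (u * u) by ring.
  apply Rmult_le_compat_r; [nra|]. now apply AN_bound with r.
Qed.

Lemma ran_cont f x0 (u : nat -> R) : ran f x0 -> is_lim_seq u 0 -> Clim (fun n => f (x0 + u n)) (f x0).
Proof.
  intros Hf Hu. destruct (ran_first_order _ _ Hf) as (c & L & d & Hd & HL & H).
  apply is_lim_seq_le_le_loc with (fun _ => 0) (fun n => L * (u n * u n) + Rabs (u n) * Cmod c).
  - apply is_lim_seq_spec in Hu. destruct (Hu (mkposreal d Hd)) as [N HN]. exists N.
    intros n Hn. specialize (HN n Hn). simpl in HN. rewrite Rminus_0_r in HN.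
    split; [apply Cmod_ge_0|].
    replace (f (x0 + u n)%R - f x0)%C with
      ((f (x0 + u n)%R - f x0 - RtoC (u n) * c) + RtoC (u n) * c)%C by ring.
    eapply Rle_trans; [apply Cmod_triangle|]. rewrite Cmod_mult, Cmod_R.
    specialize (H (u n) (Rlt_le _ _ HN)). replace (u n ^ 2) with (u n * u n) in H by ring. lra.
  - apply is_lim_seq_const.
  - replace (Finite 0) with (Finite (L * (0 * 0) + Rabs 0 * Cmod c)).
    2:{ rewrite Rabs_R0. f_equal. ring. }
    apply is_lim_seq_plus'.
    + apply is_lim_seq_mult'; [apply is_lim_seq_const|now apply is_lim_seq_mult'].
    + apply is_lim_seq_mult'; [|apply is_lim_seq_const]. now apply (is_lim_seq_abs _ (Finite 0)).
Qed.

(** At [a] the quotient takes the value of the slope series; elsewhere it is plain division,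
    analytic on a neighbourhood that avoids [a]. *)
Lemma ran_quot P alpha a : alpha < a -> (forall x, alpha < x -> ran P x) -> P a = RtoC 0 ->
  exists Q, (forall x, alpha < x -> ran Q x) /\ (forall x, alpha < x -> P x = (RtoC (x - a) * Q x)%C).
Proof.
  intros Ha HP P0. destruct (HP a Ha) as (r & M & Hr & A).
  destruct (AN_slope _ _ _ Hr A) as (g & Hg & E). rewrite Rplus_0_r, P0 in E.
  exists (fun x => if Req_EM_T x a then g 0 else (P x / RtoC (x - a))%C). split.
  - intros x Hx. destruct (Req_EM_T x a) as [->|N].
    + exists r, (M / r). split; auto. apply AN_ext with g; auto. intros u Hu.
      destruct (Req_EM_T (a + u) a) as [e|n].
      * f_equal. lra.
      * rewrite E by auto. replace (a + u - a) with u by ring.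
        assert (RtoC u <> RtoC 0) by (intros X; apply RtoC_inj in X; lra).
        field. auto.
    + apply ran_ext_loc with (fun x => P x / RtoC (x - a))%C (Rabs (x - a) / 2).
      * assert (0 < Rabs (x - a)) by (apply Rabs_pos_lt; lra). lra.
      * intros y Hy. destruct (Req_EM_T y a) as [->|]; auto.
        rewrite Rabs_minus_sym in Hy. assert (0 < Rabs (x - a)) by (apply Rabs_pos_lt; lra). lra.
      * apply ran_div; auto.
        -- apply ran_ext with (fun x => RtoC x - RtoC a)%C; [intros; now rewrite RtoC_minus|].
           apply ran_minus; [apply ran_id|apply ran_const].
        -- intros X. apply RtoC_inj in X. lra.
  - intros x Hx. destruct (Req_EM_T x a) as [->|N].
    + rewrite P0. replace (a - a) with 0 by ring. ring.
    + assert (RtoC (x - a) <> RtoC 0) by (intros X; apply RtoC_inj in X; lra).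
      field. auto.
Qed.

(** Real induction towards the left: the infimum of the [z] such that [S] holds on [(z, oo)] cannot
    exceed [alpha]. Coordinates are negated because [completeness] speaks of suprema. It drives both
    the identity theorem and Landau's theorem. *)
Lemma continuation_principle (alpha b : R) (S : R -> Prop) :
  (forall x, b < x -> S x) ->
  (forall z, alpha < z -> (forall x, z < x -> S x) -> exists d, 0 < d /\ forall x, z - d < x -> S x) ->
  forall x, alpha < x -> S x.
Proof.
  intros Hb Hext x Hx. apply NNPP. intros NS.
  set (E := fun y => forall t, - y < t -> S t).
  assert (bound E).
  { exists (- x). intros y Hy. apply Rnot_lt_le. intros L. apply NS, Hy. lra. }
  assert (exists y, E y) by (exists (- b); intros t Ht; apply Hb; lra).
  destruct (completeness E H H0) as [y [Hub Hlub]].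
  assert (- y > alpha).
  { apply Rlt_gt, Rlt_le_trans with x; auto. assert (y <= - x); [|lra]. apply Hlub.
    intros z Hz. apply Rnot_lt_le. intros L. apply NS, Hz. lra. }
  destruct (Hext (- y)) as (d & Hd & Hd'); auto.
  - intros t Ht. apply NNPP. intros Nt. assert (y <= - t); [|lra]. apply Hlub.
    intros z Hz. apply Rnot_lt_le. intros L. apply Nt, Hz. lra.
  - assert (y + d / 2 <= y); [|lra]. apply Hub. intros t Ht. apply Hd'. lra.
Qed.

(** If [f] vanishes to the right of [z], all Taylor coefficients at [z] vanish, hence so does [f] on
    a full neighbourhood of [z]. *)
Lemma ran_identity f (alpha b : R) :
  (forall x, alpha < x -> ran f x) -> (forall x, b < x -> f x = RtoC 0) ->
  forall x, alpha < x -> f x = RtoC 0.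
Proof.
  intros Hf Hb. apply (continuation_principle alpha b (fun x => f x = RtoC 0)); auto.
  intros z Hz Hzero.
  destruct (Hf z Hz) as (r & M & Hr & a & Ha & Hc).
  assert (A0 : forall k, a k = RtoC 0).
  { apply (AN_coef_zero r M a r); auto; [lra|]. intros u Hu.
    rewrite <- (Hzero (z + u)) by lra. apply Hc. rewrite Rabs_pos_eq; lra. }
  exists r. split; auto. intros x Hx. destruct (Rlt_dec z x) as [L|L]; auto.
  apply Clim_unique with (csum (fun k => a k * RtoC ((x - z) ^ k))%C).
  - replace (f x) with (f (z + (x - z))) by (f_equal; ring). apply Hc. apply Rabs_le. lra.
  - eapply Clim_ext; [|apply Clim_const]. intros n. symmetry.
    rewrite (csum_ext _ (fun _ => RtoC 0)); [apply csum_zero|].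
    intros k _. rewrite A0. ring.
Qed.

(** * Mellin transforms of real functions *)

Definition cont_pos (k : R -> R) : Prop := forall x, 0 < x -> continuous k x.

Lemma continuous_mult_R (f g : R -> R) x :
  continuous f x -> continuous g x -> continuous (fun t => f t * g t) x.
Proof. intros; now apply (continuous_mult f g). Qed.

Lemma cont_pos_mult f g : cont_pos f -> cont_pos g -> cont_pos (fun x => f x * g x).
Proof. intros Hf Hg x Hx. apply continuous_mult_R; auto. Qed.

Lemma cont_pos_plus f g : cont_pos f -> cont_pos g -> cont_pos (fun x => f x + g x).
Proof. intros Hf Hg x Hx. apply (continuous_plus f g); auto. Qed.

Lemma cont_pos_derivable (f : R -> R) : (forall x, 0 < x -> ex_derive f x) -> cont_pos f.
Proof. intros H x Hx. apply (ex_derive_continuous f x), H, Hx. Qed.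

Lemma cont_pos_const c : cont_pos (fun _ => c).
Proof. intros x _. apply continuous_const. Qed.

Lemma cont_pos_Rabs f : cont_pos f -> cont_pos (fun x => Rabs (f x)).
Proof. intros Hf x Hx. apply continuous_comp; auto. apply continuous_Rabs. Qed.

Lemma cont_pos_ker s : cont_pos (fun x => exp (- (s + 2) * ln x)).
Proof. apply cont_pos_derivable. intros x Hx. auto_derive. auto. Qed.

Lemma cont_pos_ln_pow n : cont_pos (fun x => ln x ^ n / INR (fact n)).
Proof. apply cont_pos_derivable. intros x Hx. auto_derive. auto. Qed.

Lemma cont_pos_ex_RInt f a b : cont_pos f -> 0 < a -> 0 < b -> ex_RInt f a b.
Proof.
  intros Hf Ha Hb. apply (ex_RInt_continuous f). intros z [Hz _]. apply Hf.
  eapply Rlt_le_trans; [|apply Hz]. now apply Rmin_glb_lt.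
Qed.

(** The Mellin transform with kernel [x^(-s-2)], truncated to [[a, b]]. With this shift the abscissa
    of a function of order [x^c] is [c - 1], so [x^(1/4)] corresponds to [-3/4]. *)
Definition LT (k : R -> R) (s a b : R) : R := RInt (fun x => k x * exp (- (s + 2) * ln x)) a b.

(** Up to the sign [(-1)^n], the [n]-th Taylor coefficient of [LT k] at [s]. *)
Definition mom (k : R -> R) (s : R) (n : nat) (a b : R) : R :=
  RInt (fun x => k x * exp (- (s + 2) * ln x) * (ln x ^ n / INR (fact n))) a b.

Lemma cont_pos_LT k s : cont_pos k -> cont_pos (fun x => k x * exp (- (s + 2) * ln x)).
Proof. intros Hk. apply cont_pos_mult; auto. apply cont_pos_ker. Qed.

Lemma cont_pos_mom k s n : cont_pos k ->
  cont_pos (fun x => k x * exp (- (s + 2) * ln x) * (ln x ^ n / INR (fact n))).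
Proof. intros Hk. apply cont_pos_mult; [now apply cont_pos_LT|apply cont_pos_ln_pow]. Qed.

Lemma ex_RInt_LT k s a b : cont_pos k -> 0 < a -> 0 < b ->
  ex_RInt (fun x => k x * exp (- (s + 2) * ln x)) a b.
Proof. intros; apply cont_pos_ex_RInt; auto. now apply cont_pos_LT. Qed.

Lemma ex_RInt_mom k s n a b : cont_pos k -> 0 < a -> 0 < b ->
  ex_RInt (fun x => k x * exp (- (s + 2) * ln x) * (ln x ^ n / INR (fact n))) a b.
Proof. intros; apply cont_pos_ex_RInt; auto. now apply cont_pos_mom. Qed.

Lemma LT_Chasles k s a b c : cont_pos k -> 0 < a -> 0 < b -> 0 < c ->
  LT k s a b + LT k s b c = LT k s a c.
Proof.
  intros Hk Ha Hb Hc. unfold LT.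
  apply (RInt_Chasles (fun x => k x * exp (- (s + 2) * ln x)) a b c); now apply ex_RInt_LT.
Qed.

Lemma LT_le h k s a b : cont_pos k -> cont_pos h -> 0 < a <= b ->
  (forall x, a <= x <= b -> k x <= h x) -> LT k s a b <= LT h s a b.
Proof.
  intros Hk Hh Hab H. apply RInt_le; try lra; try (apply ex_RInt_LT; auto; lra).
  intros x Hx. apply Rmult_le_compat_r; [left; apply exp_pos|]. apply H. lra.
Qed.

Lemma LT_ge0 h s a b : cont_pos h -> 0 < a <= b ->
  (forall x, a <= x <= b -> 0 <= h x) -> 0 <= LT h s a b.
Proof.
  intros Hh Hab H. apply RInt_ge_0; try lra; try (apply ex_RInt_LT; auto; lra).
  intros x Hx. apply Rmult_le_pos; [apply H; lra|left; apply exp_pos].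
Qed.

Lemma Rabs_LT_le h k s a b : cont_pos k -> cont_pos h -> 0 < a <= b ->
  (forall x, a <= x <= b -> Rabs (k x) <= h x) -> Rabs (LT k s a b) <= LT h s a b.
Proof.
  intros Hk Hh Hab H. unfold LT.
  eapply Rle_trans; [apply abs_RInt_le; [lra|apply ex_RInt_LT; auto; lra]|].
  apply RInt_le; try lra.
  - apply cont_pos_ex_RInt; try lra. apply cont_pos_Rabs. now apply cont_pos_LT.
  - apply ex_RInt_LT; auto; lra.
  - intros x Hx. rewrite Rabs_mult, (Rabs_pos_eq (exp _)) by (left; apply exp_pos).
    apply Rmult_le_compat_r; [left; apply exp_pos|]. apply H. lra.
Qed.

Lemma RInt_rsum (f : nat -> R -> R) a b n : (forall k, ex_RInt (f k) a b) ->
  ex_RInt (fun x => rsum (fun k => f k x) n) a b /\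
  RInt (fun x => rsum (fun k => f k x) n) a b = rsum (fun k => RInt (f k) a b) n.
Proof.
  intros H. induction n as [|n [IH1 IH2]]; simpl.
  - split; [apply ex_RInt_const|]. rewrite RInt_const. unfold scal; simpl; unfold mult; simpl; ring.
  - split; [now apply (ex_RInt_plus (fun x => rsum (fun k => f k x) n) (f n))|].
    rewrite <- IH2. now apply (RInt_plus (fun x => rsum (fun k => f k x) n) (f n)).
Qed.

Lemma exp_rest_le y Y N : Rabs y <= Y ->
  Rabs (exp y - rsum (fun k => y ^ k / INR (fact k)) N) <=
  exp Y - rsum (fun k => Y ^ k / INR (fact k)) N.
Proof.
  intros H. assert (HY : 0 <= Y) by (eapply Rle_trans; [apply Rabs_pos|apply H]).
  rewrite <- Cmod_R, RtoC_minus, <- csum_RtoC.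
  apply (cser_tail_dom _ (fun k => Y ^ k / INR (fact k))).
  - eapply Clim_ext; [|apply Clim_RtoC, exp_series]. intros n. symmetry. apply csum_RtoC.
  - intros k. rewrite Cmod_R. unfold Rdiv. rewrite Rabs_mult, <- RPow_abs.
    rewrite (Rabs_pos_eq (/ _)) by (left; apply Rinv_0_lt_compat, INR_fact_lt_0).
    apply Rmult_le_compat_r; [left; apply Rinv_0_lt_compat, INR_fact_lt_0|].
    apply pow_incr. split; auto. apply Rabs_pos.
  - intros n. assert (X := exp_partial_le Y n HY). lra.
Qed.

Lemma ln_ge0 x : 1 <= x -> 0 <= ln x.
Proof. intros H. rewrite <- ln_1. apply ln_le; lra. Qed.

(** For [x >= 1] the terms [(r ln x)^j / j!] are nonnegative and their partial sums are at most
    [x^r], which shifts [s] to [s - r]. *)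
Lemma mom_abs_le k s a b r n : cont_pos k -> 1 <= a <= b -> 0 <= r ->
  rsum (fun j => Rabs (mom k s j a b) * r ^ j) n <= LT (fun x => Rabs (k x)) (s - r) a b.
Proof.
  intros Hk Hab Hr. assert (Ka := cont_pos_Rabs _ Hk).
  set (g := fun j x => r ^ j * (Rabs (k x) * exp (- (s + 2) * ln x) * (ln x ^ j / INR (fact j)))).
  assert (Eg : forall j, ex_RInt (g j) a b).
  { intros j. apply (ex_RInt_scal (fun x => Rabs (k x) * exp (- (s + 2) * ln x) * (ln x ^ j / INR (fact j)))).
    apply ex_RInt_mom; auto; lra. }
  destruct (RInt_rsum g a b n Eg) as [E1 E2].
  apply Rle_trans with (rsum (fun j => RInt (g j) a b) n).
  - apply rsum_le. intros j _. unfold g.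
    rewrite (RInt_scal (fun x => Rabs (k x) * exp (- (s + 2) * ln x) * (ln x ^ j / INR (fact j))))
      by (apply ex_RInt_mom; auto; lra).
    unfold scal; simpl; unfold mult; simpl. rewrite Rmult_comm.
    apply Rmult_le_compat_l; [now apply pow_le|]. unfold mom.
    eapply Rle_trans; [apply abs_RInt_le; [lra|apply ex_RInt_mom; auto; lra]|].
    apply RInt_le; try lra.
    + apply cont_pos_ex_RInt; try lra. now apply cont_pos_Rabs, cont_pos_mom.
    + apply ex_RInt_mom; auto; lra.
    + intros x Hx. rewrite !Rabs_mult, (Rabs_pos_eq (exp _)) by (left; apply exp_pos).
      rewrite (Rabs_pos_eq (_ / _)); [lra|]. apply Rmult_le_pos.
      * apply pow_le, ln_ge0; lra.
      * left; apply Rinv_0_lt_compat, INR_fact_lt_0.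
  - rewrite <- E2. apply RInt_le; try lra; auto.
    + apply ex_RInt_LT; auto; lra.
    + intros x Hx. unfold g.
      rewrite (rsum_ext _ (fun j => (Rabs (k x) * exp (- (s + 2) * ln x)) *
         ((r * ln x) ^ j / INR (fact j)))).
      2:{ intros j _. rewrite Rpow_mult_distr. unfold Rdiv. ring. }
      rewrite rsum_scal, Rmult_assoc. apply Rmult_le_compat_l; [apply Rabs_pos|].
      replace (- (s - r + 2) * ln x) with (- (s + 2) * ln x + r * ln x) by ring.
      rewrite exp_plus. apply Rmult_le_compat_l; [left; apply exp_pos|].
      apply exp_partial_le. apply Rmult_le_pos; auto. apply ln_ge0; lra.
Qed.

(** Termwise integration: on [[a, b]] the exponent [u ln x] is at most [Y = |u| ln b] in modulus, so
    the remainder of the exponential series is uniformly small. *)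
Lemma LT_taylor k s a b u : cont_pos k -> 1 <= a <= b ->
  is_lim_seq (rsum (fun j => mom k s j a b * (- u) ^ j)) (LT k (s + u) a b).
Proof.
  intros Hk Hab. assert (Ka := cont_pos_Rabs _ Hk).
  set (Y := Rabs u * ln b). set (D := LT (fun x => Rabs (k x)) s a b).
  set (rest := fun n => exp Y - rsum (fun j => Y ^ j / INR (fact j)) n).
  assert (HB : forall n, Rabs (rsum (fun j => mom k s j a b * (- u) ^ j) n - LT k (s + u) a b)
     <= D * rest n).
  { intros n.
    set (g := fun j x => (- u) ^ j * (k x * exp (- (s + 2) * ln x) * (ln x ^ j / INR (fact j)))).
    assert (Eg : forall j, ex_RInt (g j) a b).
    { intros j. apply (ex_RInt_scal (fun x => k x * exp (- (s + 2) * ln x) * (ln x ^ j / INR (fact j)))).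
      apply ex_RInt_mom; auto; lra. }
    destruct (RInt_rsum g a b n Eg) as [E1 E2].
    assert (E3 : rsum (fun j => mom k s j a b * (- u) ^ j) n = RInt (fun x => rsum (fun j => g j x) n) a b).
    { rewrite E2. apply rsum_ext. intros j _. unfold g.
      rewrite (RInt_scal (fun x => k x * exp (- (s + 2) * ln x) * (ln x ^ j / INR (fact j))))
        by (apply ex_RInt_mom; auto; lra).
      unfold scal; simpl; unfold mult; simpl. apply Rmult_comm. }
    rewrite E3. unfold LT.
    assert (X := RInt_minus (fun x => rsum (fun j => g j x) n) (fun x => k x * exp (- (s + u + 2) * ln x)) a b E1).
    unfold minus, plus, opp in X; simpl in X. unfold Rminus. rewrite <- X by (apply ex_RInt_LT; auto; lra).
    assert (E4 : forall x, a < x < b -> rsum (fun j => g j x) n + - (k x * exp (- (s + u + 2) * ln x)) =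
        - (k x * exp (- (s + 2) * ln x) * (exp (- u * ln x) - rsum (fun j => (- u * ln x) ^ j / INR (fact j)) n))).
    { intros x Hx. unfold g.
      rewrite (rsum_ext _ (fun j => (k x * exp (- (s + 2) * ln x)) * ((- u * ln x) ^ j / INR (fact j)))).
      2:{ intros j _. rewrite Rpow_mult_distr. unfold Rdiv. ring. }
      rewrite rsum_scal. replace (- (s + u + 2) * ln x) with (- (s + 2) * ln x + - u * ln x) by ring.
      rewrite exp_plus. ring. }
    assert (Ex : ex_RInt (fun x => rsum (fun j => g j x) n + - (k x * exp (- (s + u + 2) * ln x))) a b).
    { apply (ex_RInt_plus (fun x => rsum (fun j => g j x) n) (fun x => - (k x * exp (- (s + u + 2) * ln x)))); auto.
      apply (ex_RInt_opp (fun x => k x * exp (- (s + u + 2) * ln x))). apply ex_RInt_LT; auto; lra. }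
    eapply Rle_trans; [apply abs_RInt_le; [lra|exact Ex]|].
    unfold D, LT. rewrite Rmult_comm.
    assert (X2 := RInt_scal (fun x => Rabs (k x) * exp (- (s + 2) * ln x)) a b (rest n)
       (ex_RInt_LT _ s a b Ka ltac:(lra) ltac:(lra))).
    unfold scal in X2; simpl in X2; unfold mult in X2; simpl in X2. rewrite <- X2.
    apply RInt_le; try lra.
    - apply (ex_RInt_norm (fun x => rsum (fun j => g j x) n + - (k x * exp (- (s + u + 2) * ln x)))). exact Ex.
    - apply (ex_RInt_scal (fun x => Rabs (k x) * exp (- (s + 2) * ln x))). apply ex_RInt_LT; auto; lra.
    - intros x Hx. rewrite E4 by auto. rewrite Rabs_Ropp, !Rabs_mult, (Rabs_pos_eq (exp _)) by (left; apply exp_pos).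
      rewrite Rmult_comm. apply Rmult_le_compat_r.
      + apply Rmult_le_pos; [apply Rabs_pos|left; apply exp_pos].
      + apply exp_rest_le. rewrite Rabs_mult, Rabs_Ropp. unfold Y.
        apply Rmult_le_compat_l; [apply Rabs_pos|]. rewrite Rabs_pos_eq by (apply ln_ge0; lra).
        apply ln_le; lra. }
  assert (L : is_lim_seq (fun n => D * rest n) 0).
  { replace (Finite 0) with (Finite (D * (exp Y - exp Y))) by (f_equal; ring).
    apply is_lim_seq_mult'; [apply is_lim_seq_const|].
    apply is_lim_seq_minus'; [apply is_lim_seq_const|apply exp_series]. }
  apply is_lim_seq_ext with (fun n => (rsum (fun j => mom k s j a b * (- u) ^ j) n - LT k (s + u) a b) + LT k (s + u) a b).
  { intros; ring. }
  replace (Finite (LT k (s + u) a b)) with (Finite (0 + LT k (s + u) a b)) by (f_equal; ring).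
  apply is_lim_seq_plus'; [|apply is_lim_seq_const].
  apply is_lim_seq_abs_0. apply is_lim_seq_0_le with (fun n => D * rest n); auto.
  intros n. split; [apply Rabs_pos|apply HB].
Qed.

Lemma AN_LT k s a b r : cont_pos k -> 1 <= a <= b -> 0 <= r ->
  AN r (LT (fun x => Rabs (k x)) (s - r) a b) (fun u => RtoC (LT k (s + u) a b)).
Proof.
  intros Hk Hab Hr. exists (fun j => RtoC ((-1) ^ j * mom k s j a b)). split.
  - intros n. eapply Rle_trans; [|apply (mom_abs_le k s a b r n); auto]. apply Req_le, rsum_ext.
    intros j _. rewrite Cmod_R, Rabs_mult, <- RPow_abs.
    replace (Rabs (-1)) with 1 by (rewrite Rabs_left; lra). rewrite pow1. ring.
  - intros u _. eapply Clim_ext; [|apply Clim_RtoC, (LT_taylor k s a b u); auto].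
    intros n. cbv beta. rewrite <- csum_RtoC. apply csum_ext. intros j _.
    rewrite <- RtoC_mult. f_equal. replace (- u) with (-1 * u) by ring.
    rewrite Rpow_mult_distr. ring.
Qed.

Lemma ran_LT_finite k s a b : cont_pos k -> 1 <= a <= b -> ran (fun s => RtoC (LT k s a b)) s.
Proof.
  intros Hk Hab. exists 1, (LT (fun x => Rabs (k x)) (s - 1) a b). split; [lra|].
  apply AN_LT; auto; lra.
Qed.

(** * Transforms over a half-line with a dominating function *)

Section HalfLine.
Variables (h k : R -> R) (a : R).
Hypotheses (Hk : cont_pos k) (Hh : cont_pos h) (Ha : 1 <= a).
Hypothesis (Hkh : forall x, a <= x -> Rabs (k x) <= h x).

Lemma LT_split s n : LT k s a (a + INR (S n)) = LT k s a (a + INR n) + LT k s (a + INR n) (a + INR (S n)).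
Proof.
  assert (X := pos_INR n). assert (Y := pos_INR (S n)).
  symmetry. apply LT_Chasles; auto; lra.
Qed.

Lemma LT_diff_le s n m : (n <= m)%nat ->
  Rabs (LT k s a (a + INR m) - LT k s a (a + INR n)) <= LT h s a (a + INR m) - LT h s a (a + INR n).
Proof.
  intros L. apply le_INR in L. assert (X := pos_INR n).
  rewrite <- (LT_Chasles k s a (a + INR n) (a + INR m)) by (auto; lra).
  rewrite <- (LT_Chasles h s a (a + INR n) (a + INR m)) by (auto; lra).
  replace (LT k s a (a + INR n) + LT k s (a + INR n) (a + INR m) - LT k s a (a + INR n))
    with (LT k s (a + INR n) (a + INR m)) by ring.
  replace (LT h s a (a + INR n) + LT h s (a + INR n) (a + INR m) - LT h s a (a + INR n))
    with (LT h s (a + INR n) (a + INR m)) by ring.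
  apply Rabs_LT_le; auto; [lra|]. intros x Hx. apply Hkh. lra.
Qed.

Lemma LT_cv s B : (forall n, LT h s a (a + INR n) <= B) ->
  exists l : R, is_lim_seq (fun n => LT k s a (a + INR n)) l.
Proof.
  intros HB. destruct (Clim_cauchy (fun n => RtoC (LT k s a (a + INR n))) (fun n => LT h s a (a + INR n))) as [l Hl].
  - intros n m L. rewrite <- RtoC_minus, Cmod_R. now apply LT_diff_le.
  - now exists B.
  - exists (Re l). exact (Clim_Re _ _ Hl).
Qed.

(** The half-line is cut into unit intervals. On the disc of radius [r] about [s], half the distance
    to [alpha], each piece has norm at most the integral of [h] over it at [s - r], and these
    integrals have bounded sums, so [AN_series] applies. *)
Lemma ran_LT (f : R -> R) alpha :
  (forall s, alpha < s -> exists B, forall n, LT h s a (a + INR n) <= B) ->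
  (forall s, alpha < s -> is_lim_seq (fun n => LT k s a (a + INR n)) (f s)) ->
  forall s, alpha < s -> ran (fun s => RtoC (f s)) s.
Proof.
  intros HB Hf s Hs. set (r := (s - alpha) / 2).
  destruct (HB (s - r)) as [B HB']; [unfold r; lra|].
  exists r, B. assert (Hr : 0 < r) by (unfold r; lra). split; auto.
  apply AN_series with (fun j => LT (fun x => Rabs (k x)) (s - r) (a + INR j) (a + INR (S j)))
    (fun j u => RtoC (LT k (s + u) (a + INR j) (a + INR (S j)))); auto.
  - intros j. assert (X := pos_INR j). apply AN_LT; auto; [|lra].
    rewrite S_INR. lra.
  - intros J. apply Rle_trans with (LT h (s - r) a (a + INR J)); auto.
    induction J as [|J IH]; simpl rsum.
    + simpl. rewrite Rplus_0_r. unfold LT. rewrite RInt_point. apply Rle_refl.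
    + assert (X := pos_INR J). assert (Y := S_INR J).
      rewrite <- (LT_Chasles h (s - r) a (a + INR J)) by (auto; lra).
      apply Rplus_le_compat; auto. apply LT_le; auto; try lra.
      * now apply cont_pos_Rabs.
      * intros x Hx. apply Hkh. lra.
  - intros u Hu. apply Clim_ext with (fun n => RtoC (LT k (s + u) a (a + INR n))).
    + intros n. induction n as [|n IH]; cbn [csum].
      * simpl. rewrite Rplus_0_r. unfold LT. now rewrite RInt_point.
      * rewrite LT_split, RtoC_plus, IH. reflexivity.
    + apply Clim_RtoC, Hf. apply Rabs_le_between in Hu. unfold r in Hu. lra.
Qed.
End HalfLine.

Lemma LT_incr h s a n m : cont_pos h -> 1 <= a -> (forall x, a <= x -> 0 <= h x) -> (n <= m)%nat ->
  LT h s a (a + INR n) <= LT h s a (a + INR m).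
Proof.
  intros Hh Ha H0 L. apply le_INR in L. assert (X := pos_INR n).
  rewrite <- (LT_Chasles h s a (a + INR n) (a + INR m)) by (auto; lra).
  assert (0 <= LT h s (a + INR n) (a + INR m)); [|lra].
  apply LT_ge0; auto; [lra|]. intros x Hx. apply H0. lra.
Qed.

(** * Landau's theorem *)

Lemma choice_above (alpha : R) (Q : R -> R -> Prop) :
  (forall s, alpha < s -> exists l, Q s l) -> exists f, forall s, alpha < s -> Q s (f s).
Proof.
  intros H. apply (functional_choice (fun s l => alpha < s -> Q s l)). intros s.
  destruct (Rlt_dec alpha s) as [L|L]; [|exists 0; tauto].
  destruct (H s L) as [l Hl]. now exists l.
Qed.

Section Landau.
Variables (h : R -> R) (a alpha b : R) (L : R -> C).
Hypotheses (Hh : cont_pos h) (Ha : 1 <= a) (H0 : forall x, a <= x -> 0 <= h x).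
Hypothesis (HL : forall s, alpha < s -> ran L s).
Hypothesis (Hb : forall s, b < s -> Clim (fun n => RtoC (LT h s a (a + INR n))) (L s)).

Let bounded s := exists B, forall n, LT h s a (a + INR n) <= B.

Lemma Rabs_h x : a <= x -> Rabs (h x) <= h x.
Proof. intros Hx. rewrite Rabs_pos_eq by auto. apply Rle_refl. Qed.

(** Where the truncated integrals stay bounded, their limit is analytic by [ran_LT]; it agrees with
    [L] far to the right, so the identity theorem extends the agreement. *)
Lemma landau_eq z : alpha <= z -> (forall s, z < s -> bounded s) ->
  forall s, z < s -> Clim (fun n => RtoC (LT h s a (a + INR n))) (L s).
Proof.
  intros Hz HB.
  destruct (choice_above z (fun s l => is_lim_seq (fun n => LT h s a (a + INR n)) l)) as [f Hf].
  { intros s Hs. destruct (HB s Hs) as [B HB']. apply (LT_cv h h a Hh Hh Ha Rabs_h s B HB'). }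
  assert (E : forall s, z < s -> (RtoC (f s) - L s)%C = RtoC 0).
  { apply (ran_identity (fun s => RtoC (f s) - L s)%C z (Rmax z b)).
    - intros s Hs. apply ran_minus; [|apply HL; lra].
      apply (ran_LT h h a Hh Hh Ha Rabs_h f z); auto.
    - intros s Hs. assert (z < s) by (eapply Rle_lt_trans; [apply Rmax_l|apply Hs]).
      assert (b < s) by (eapply Rle_lt_trans; [apply Rmax_r|apply Hs]).
      rewrite (Clim_unique _ _ _ (Clim_RtoC _ _ (Hf s H)) (Hb s H1)). ring. }
  intros s Hs. replace (L s) with (RtoC (f s)).
  - apply Clim_RtoC, Hf, Hs.
  - specialize (E s Hs). replace (L s) with (RtoC (f s) - (RtoC (f s) - L s))%C by ring.
    rewrite E. ring.
Qed.

Lemma mom_nonneg s j n : 0 <= mom h s j a (a + INR n).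
Proof.
  assert (X := pos_INR n). apply RInt_ge_0; [lra|apply ex_RInt_mom; auto; lra|].
  intros x Hx. apply Rmult_le_pos; [apply Rmult_le_pos; [apply H0; lra|left; apply exp_pos]|].
  apply Rmult_le_pos; [apply pow_le, ln_ge0; lra|left; apply Rinv_0_lt_compat, INR_fact_lt_0].
Qed.

Lemma mom_incr s j n : mom h s j a (a + INR n) <= mom h s j a (a + INR (S n)).
Proof.
  assert (X := pos_INR n). assert (Y := S_INR n). unfold mom.
  set (g := fun x => h x * exp (- (s + 2) * ln x) * (ln x ^ j / INR (fact j))).
  assert (Z := RInt_Chasles g a (a + INR n) (a + INR (S n))
    (ex_RInt_mom h s j a (a + INR n) Hh ltac:(lra) ltac:(lra))
    (ex_RInt_mom h s j (a + INR n) (a + INR (S n)) Hh ltac:(lra) ltac:(lra))).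
  rewrite <- Z. unfold plus; cbn [AbelianMonoid.plus].
  assert (0 <= RInt g (a + INR n) (a + INR (S n))).
  2:{ eapply Rle_trans; [|apply Rplus_le_compat_l, H]. rewrite Rplus_0_r. apply Rle_refl. }
  apply RInt_ge_0; [lra|apply ex_RInt_mom; auto; lra|].
  intros x Hx. apply Rmult_le_pos; [apply Rmult_le_pos; [apply H0; lra|left; apply exp_pos]|].
  apply Rmult_le_pos; [apply pow_le, ln_ge0; lra|left; apply Rinv_0_lt_compat, INR_fact_lt_0].
Qed.

Lemma LT_abs_h s n : LT (fun x => Rabs (h x)) s a (a + INR n) = LT h s a (a + INR n).
Proof.
  assert (X := pos_INR n). apply Rle_antisym.
  - apply LT_le; auto; [now apply cont_pos_Rabs|lra|]. intros; apply Rabs_h; lra.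
  - apply LT_le; auto; [now apply cont_pos_Rabs|lra|]. intros; apply Rle_abs.
Qed.

(* Expand at [s0 = z + r/4]: the moments of [h] are, up to sign, the Taylor coefficients of [L]
   there, so their series converges out to radius [r/2], that is beyond [z]. *)
Lemma landau_extend z : alpha < z -> (forall s, z < s -> bounded s) ->
  exists d, 0 < d /\ forall s, z - d < s -> bounded s.
Proof.
  intros Hz HB. destruct (HL z Hz) as (r & M & Hr & HA).
  set (s0 := z + r / 4). set (rho := r / 8).
  assert (HA' : AN (r / 2) M (fun u => L (s0 + u))).
  { apply AN_ext with (fun u => L (z + (r / 4 + u))); [intros; f_equal; unfold s0; ring|].
    apply (AN_recentre r (r / 2) M (fun u => L (z + u)) (r / 4)); auto; [lra|].
    rewrite Rabs_pos_eq; lra. }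
  destruct HA' as (l & Hl & Hl').
  destruct (HB (s0 - rho)) as [B HB']; [unfold s0, rho; lra|].
  assert (HM : forall n K, rsum (fun j => mom h s0 j a (a + INR n) * rho ^ j) K <= B).
  { intros n K. assert (X := pos_INR n). eapply Rle_trans; [|apply (HB' n)].
    rewrite <- LT_abs_h.
    eapply Rle_trans; [|apply (mom_abs_le h s0 a (a + INR n) rho K); auto; [lra|unfold rho; lra]].
    apply rsum_le. intros j _. apply Rmult_le_compat_r; [apply pow_le; unfold rho; lra|apply Rle_abs]. }
  assert (Hrho : 0 < rho) by (unfold rho; lra).
  assert (HMj : forall j, exists m : R, is_lim_seq (fun n => mom h s0 j a (a + INR n)) m).
  { intros j. apply ex_finite_lim_seq_incr with (B / rho ^ j).
    - intros n. apply mom_incr.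
    - intros n. assert (P : 0 < rho ^ j) by now apply pow_lt.
      apply Rmult_le_reg_r with (rho ^ j); auto.
      replace (B / rho ^ j * rho ^ j) with B by (field; lra).
      eapply Rle_trans; [|apply (HM n (S j))]. simpl.
      assert (0 <= rsum (fun i => mom h s0 i a (a + INR n) * rho ^ i) j); [|lra].
      apply rsum_nonneg. intros; apply Rmult_le_pos; [apply mom_nonneg|apply pow_le; lra]. }
  destruct (functional_choice _ HMj) as [m Hm].
  assert (Hm0 : forall j, 0 <= m j).
  { intros j. apply (is_lim_seq_le (fun _ => 0) (fun n => mom h s0 j a (a + INR n)) 0 (m j)); auto.
    - intros; apply mom_nonneg.
    - apply is_lim_seq_const. }
  assert (Hmle : forall j n, mom h s0 j a (a + INR n) <= m j).
  { intros j n. apply (is_lim_seq_incr_compare _ _ (Hm j)). intros; apply mom_incr. }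
  assert (HmB : forall y K B', 0 <= y -> (forall n, rsum (fun j => mom h s0 j a (a + INR n) * y ^ j) K <= B') ->
     rsum (fun j => m j * y ^ j) K <= B').
  { intros y K B' Hy HB2.
    apply (is_lim_seq_le (fun n => rsum (fun j => mom h s0 j a (a + INR n) * y ^ j) K) (fun _ => B')
      (rsum (fun j => m j * y ^ j) K) B'); auto; [|apply is_lim_seq_const].
    apply (is_lim_seq_rsum (fun j n => mom h s0 j a (a + INR n) * y ^ j)). intros j.
    apply is_lim_seq_mult'; [auto|apply is_lim_seq_const]. }
  assert (Tay : forall n y, is_lim_seq (rsum (fun j => mom h s0 j a (a + INR n) * y ^ j)) (LT h (s0 - y) a (a + INR n))).
  { intros n y. assert (X := pos_INR n).
    apply is_lim_seq_ext with (rsum (fun j => mom h s0 j a (a + INR n) * (- - y) ^ j)).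
    - intros. apply rsum_ext. intros. now rewrite Ropp_involutive.
    - apply (LT_taylor h s0 a (a + INR n) (- y)); auto; lra. }
  (* The moments are nonnegative, so the limit over the endpoint and the sum over [j] may be
     exchanged; [UpS] and [Htle] provide the two inequalities. *)
  assert (Cv : forall y, 0 < y < rho -> Clim (csum (fun j => RtoC (m j) * RtoC (y ^ j))%C) (L (s0 - y))).
  { intros y Hy.
    assert (Lim := landau_eq z ltac:(lra) HB (s0 - y) ltac:(unfold s0, rho in *; lra)).
    assert (LimR := Clim_Re _ _ Lim). simpl in LimR.
    assert (ELim : L (s0 - y) = RtoC (Re (L (s0 - y)))).
    { apply (Clim_unique _ _ _ Lim). apply Clim_RtoC, LimR. }
    assert (Up : forall n, LT h (s0 - y) a (a + INR n) <= Re (L (s0 - y))).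
    { intros n. apply (is_lim_seq_incr_compare _ _ LimR). intros k. apply LT_incr; auto. }
    assert (UpS : forall K, rsum (fun j => m j * y ^ j) K <= Re (L (s0 - y))).
    { intros K. apply HmB; [lra|]. intros n. eapply Rle_trans; [|apply (Up n)].
      apply (is_lim_seq_incr_compare _ _ (Tay n y)). intros k. simpl.
      assert (0 <= mom h s0 k a (a + INR n) * y ^ k); [|lra].
      apply Rmult_le_pos; [apply mom_nonneg|apply pow_le; lra]. }
    destruct (rsum_bounded_cv (fun j => m j * y ^ j) (Re (L (s0 - y)))) as (t & Ht & Htle & Ht2); auto.
    { intros; apply Rmult_le_pos; auto. apply pow_le; lra. }
    assert (Ett : t = Re (L (s0 - y))).
    { apply Rle_antisym; auto.
      apply (is_lim_seq_le (fun n => LT h (s0 - y) a (a + INR n)) (fun _ => t) (Re (L (s0 - y))) t); auto.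
      - intros n. apply (is_lim_seq_le (rsum (fun j => mom h s0 j a (a + INR n) * y ^ j)) (fun _ => t) (LT h (s0 - y) a (a + INR n)) t); auto.
        + intros K. eapply Rle_trans; [|apply (Htle K)]. apply rsum_le. intros j _.
          apply Rmult_le_compat_r; auto. apply pow_le; lra.
        + apply is_lim_seq_const.
      - apply is_lim_seq_const. }
    rewrite ELim, <- Ett. eapply Clim_ext; [|apply Clim_RtoC, Ht].
    intros n. cbv beta. rewrite <- csum_RtoC. apply csum_ext. intros. apply RtoC_mult. }
  (* Both power series represent [L (s0 - y)] for [0 < y < rho]; the sign appears because [y]
     measures distance to the left. *)
  assert (EQ : forall j, RtoC (m j) = (l j * RtoC ((-1) ^ j))%C).
  { apply (AN_coef_unique rho (r / 2) B M _ _ rho (fun y => L (s0 - y))); auto; [lra| | |].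
    - intros n. eapply Rle_trans; [|apply (HmB rho n B); [lra|intros; apply HM]].
      apply Req_le, rsum_ext. intros j _. now rewrite Cmod_R, Rabs_pos_eq.
    - intros n. eapply Rle_trans; [|apply (Hl n)]. apply Req_le, rsum_ext. intros j _.
      rewrite Cmod_mult, Cmod_R, <- RPow_abs.
      replace (Rabs (-1)) with 1 by (rewrite Rabs_left; lra). rewrite pow1. ring.
    - intros y Hy. eapply Clim_ext; [|apply (Hl' (- y))].
      + intros n. apply csum_ext. intros j _. replace (- y) with (-1 * y) by ring.
        rewrite Rpow_mult_distr, RtoC_mult. ring.
      + rewrite Rabs_Ropp, Rabs_pos_eq by lra. unfold rho in Hy. lra. }
  assert (MB : forall K, rsum (fun j => m j * (r / 2) ^ j) K <= M).
  { intros K. eapply Rle_trans; [|apply (Hl K)]. apply Req_le, rsum_ext. intros j _.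
    f_equal. rewrite <- (Rabs_pos_eq (m j)), <- Cmod_R, EQ, Cmod_mult, Cmod_R, <- RPow_abs by auto.
    replace (Rabs (-1)) with 1 by (rewrite Rabs_left; lra). rewrite pow1. ring. }
  (* The condition [s > z - r/4] is the same as [s0 - s < r/2], where the moment series is bounded
     by [M]. *)
  exists (r / 4). split; [lra|]. intros s Hs.
  destruct (Rlt_dec z s) as [Lt|Lt]; [now apply HB|].
  exists M. intros n. replace s with (s0 - (s0 - s)) by ring.
  apply (is_lim_seq_le (rsum (fun j => mom h s0 j a (a + INR n) * (s0 - s) ^ j)) (fun _ => M) (LT h (s0 - (s0 - s)) a (a + INR n)) M); auto.
  - intros K. eapply Rle_trans; [|apply (MB K)]. apply rsum_le. intros j _.
    apply Rmult_le_compat; auto.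
    + apply mom_nonneg.
    + apply pow_le. unfold s0; lra.
    + apply pow_incr. unfold s0; lra.
  - apply is_lim_seq_const.
Qed.

Lemma landau_bounded s : alpha < s -> bounded s.
Proof.
  revert s. apply (continuation_principle alpha b).
  - intros s Hs. exists (Re (L s)). intros n.
    apply (is_lim_seq_incr_compare _ _ (Clim_Re _ _ (Hb s Hs))).
    intros k. apply LT_incr; auto.
  - intros z Hz HB. now apply landau_extend.
Qed.

Lemma landau s : alpha < s -> Clim (fun n => RtoC (LT h s a (a + INR n))) (L s).
Proof. apply landau_eq; [lra|]. intros; now apply landau_bounded. Qed.
End Landau.

(** * Complex powers and infinite products *)

Lemma Cexp_plus z w : Cexp (z + w)%C = (Cexp z * Cexp w)%C.
Proof.
  unfold Cexp. destruct z as [a b], w as [c d]. simpl.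
  rewrite exp_plus, cos_plus, sin_plus.
  apply injective_projections; simpl; ring.
Qed.

Lemma Cexp_0 : Cexp 0 = RtoC 1.
Proof.
  unfold Cexp. simpl. rewrite exp_0, cos_0, sin_0.
  apply injective_projections; simpl; ring.
Qed.

Lemma Cmod_Cexp z : Cmod (Cexp z) = exp (Re z).
Proof.
  unfold Cexp. rewrite Cmod_mult, Cmod_R, Rabs_pos_eq by (left; apply exp_pos).
  assert (E : Cmod (cos (Im z), sin (Im z)) = 1); [|rewrite E; ring].
  unfold Cmod; simpl. replace (_ + _) with 1; [apply sqrt_1|].
  generalize (sin2_cos2 (Im z)). unfold Rsqr. lra.
Qed.

Lemma cpow_plus a z w : cpow a (z + w)%C = (cpow a z * cpow a w)%C.
Proof. unfold cpow. rewrite <- Cexp_plus. f_equal. ring. Qed.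

Lemma cpow_0 a : cpow a 0 = RtoC 1.
Proof. unfold cpow. rewrite Cmult_0_l. apply Cexp_0. Qed.

Lemma cpow_opp a z : (cpow a (- z) * cpow a z)%C = RtoC 1.
Proof. rewrite <- cpow_plus, Cplus_comm, Cplus_opp_r. apply cpow_0. Qed.

Lemma Re_mul_R (z : C) (x : R) : Re (z * RtoC x)%C = Re z * x.
Proof. unfold Re; simpl. ring. Qed.

Lemma Cmod_cpow a z : Cmod (cpow a z) = exp (Re z * ln a).
Proof. unfold cpow. now rewrite Cmod_Cexp, Re_mul_R. Qed.

Lemma cpow_neq0 a z : cpow a z <> RtoC 0.
Proof. apply Cmod_gt_0. rewrite Cmod_cpow. apply exp_pos. Qed.

Lemma cpow_RtoC a x : cpow a (RtoC x) = RtoC (exp (x * ln a)).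
Proof.
  unfold cpow. rewrite <- RtoC_mult. unfold Cexp. simpl. rewrite cos_0, sin_0.
  apply injective_projections; simpl; ring.
Qed.

Lemma cpow_1 a : 0 < a -> cpow a 1 = RtoC a.
Proof. intros Ha. rewrite cpow_RtoC, Rmult_1_l, exp_ln; auto. Qed.

Lemma cpow_mult_base a b z : 0 < a -> 0 < b -> cpow (a * b) z = (cpow a z * cpow b z)%C.
Proof.
  intros Ha Hb. unfold cpow. rewrite <- Cexp_plus, ln_mult, RtoC_plus by auto. f_equal. ring.
Qed.

Lemma cpow_base_1 z : cpow 1 z = RtoC 1.
Proof. unfold cpow. rewrite ln_1, Cmult_0_r. apply Cexp_0. Qed.

Lemma cpow_add_R a s u t : cpow a (s + u, t) = (cpow a (s, t) * RtoC (exp (u * ln a)))%C.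
Proof.
  rewrite <- cpow_RtoC, <- cpow_plus. f_equal.
  apply injective_projections; simpl; ring.
Qed.

Lemma ran_cpow a (c d : R) t x0 : ran (fun x => cpow a (c * x + d, t)) x0.
Proof.
  apply ran_ext with (fun x => cpow a (d, t) * RtoC (exp ((c * ln a) * x)))%C.
  - intros x. replace (c * x + d) with (d + c * x) by ring. rewrite cpow_add_R.
    do 3 f_equal. ring.
  - apply ran_mult; [apply ran_const|apply ran_exp].
Qed.

Fixpoint cprod (f : nat -> C) (n : nat) : C :=
  match n with O => RtoC 1 | S k => (cprod f k * f k)%C end.

Lemma cprod_ext (f g : nat -> C) n : (forall k, (k < n)%nat -> f k = g k) -> cprod f n = cprod g n.
Proof.
  induction n as [|n IH]; intros H; simpl; auto.
  rewrite IH, H; auto.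
Qed.

Lemma cprod_mult (f g : nat -> C) n : cprod (fun k => f k * g k)%C n = (cprod f n * cprod g n)%C.
Proof. induction n as [|n IH]; simpl; [ring|]. rewrite IH. ring. Qed.

(** Telescoping turns an infinite product into a series, so that the results on absolutely
    convergent series and [AN_series] apply to Euler products. *)
Lemma cprod_csum (a : nat -> C) n :
  cprod (fun j => 1 + a j)%C n = (1 + csum (fun j => cprod (fun j => 1 + a j)%C j * a j) n)%C.
Proof. induction n as [|n IH]; cbn [cprod csum]; [ring|]. rewrite IH. ring. Qed.

Lemma exp_ge_1_plus x : 1 + x <= exp x.
Proof.
  destruct (Req_dec x 0) as [->|N]; [rewrite exp_0; lra|]. left. now apply exp_ineq1.
Qed.

Lemma AN_cprod r (A : nat -> R) (a : nat -> R -> C) n : 0 < r ->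
  (forall j, AN r (A j) (a j)) -> AN r (exp (rsum A n)) (fun u => cprod (fun j => 1 + a j u)%C n).
Proof.
  intros Hr Ha. induction n as [|n IH]; simpl.
  - rewrite exp_0. apply AN_weaken with (Cmod (RtoC 1)); [rewrite Cmod_1; lra|]. apply AN_const; lra.
  - rewrite exp_plus. apply AN_mult; auto. apply AN_weaken with (Cmod (RtoC 1) + A n).
    + rewrite Cmod_1. apply exp_ge_1_plus.
    + apply AN_plus; auto; [|lra]. apply AN_const; lra.
Qed.

Lemma Cmod_cprod_le (a : nat -> C) n :
  Cmod (cprod (fun j => 1 + a j)%C n) <= exp (rsum (fun j => Cmod (a j)) n).
Proof.
  induction n as [|n IH]; simpl.
  - rewrite exp_0, Cmod_1. lra.
  - rewrite Cmod_mult, exp_plus. apply Rmult_le_compat; auto; try apply Cmod_ge_0.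
    eapply Rle_trans; [apply Cmod_triangle|]. rewrite Cmod_1. apply exp_ge_1_plus.
Qed.

Lemma exp_le_mono x y : x <= y -> exp x <= exp y.
Proof. intros [H|H]; [left; now apply exp_increasing|subst; lra]. Qed.

Lemma cprod_cv (a : nat -> C) S : (forall n, rsum (fun j => Cmod (a j)) n <= S) ->
  exists l, Clim (cprod (fun j => 1 + a j)%C) l.
Proof.
  intros HS. destruct (cser_abs_cv (fun j => cprod (fun j => 1 + a j)%C j * a j)%C (exp S * S)) as [l Hl].
  - intros n. apply Rle_trans with (exp S * rsum (fun j => Cmod (a j)) n).
    + rewrite <- rsum_scal. apply rsum_le. intros j _. rewrite Cmod_mult.
      apply Rmult_le_compat_r; [apply Cmod_ge_0|].
      eapply Rle_trans; [apply Cmod_cprod_le|]. now apply exp_le_mono.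
    + apply Rmult_le_compat_l; auto. left; apply exp_pos.
  - exists (1 + l)%C. eapply Clim_ext; [|apply Clim_plus; [apply (Clim_const 1)|apply Hl]].
    intros n. symmetry. apply cprod_csum.
Qed.

(** All partial products have norm at most [exp S], so the telescoped series has total norm at most
    [exp S * S]; the leading factor contributes the 1. *)
Lemma AN_infinite_product r S (A : nat -> R) (a : nat -> R -> C) (P : R -> C) : 0 < r ->
  (forall j, AN r (A j) (a j)) -> (forall n, rsum A n <= S) ->
  (forall u, Rabs u <= r -> Clim (cprod (fun j => 1 + a j u)%C) (P u)) ->
  AN r (1 + exp S * S) P.
Proof.
  intros Hr Ha HS HP.
  apply AN_ext with (fun u => 1 + (P u - 1))%C; [intros; ring|].
  apply AN_plus; [apply AN_weaken with (Cmod (RtoC 1)); [rewrite Cmod_1; lra|]; apply AN_const; lra| |lra].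
  apply AN_series with (fun j => exp S * A j) (fun j u => cprod (fun j => 1 + a j u)%C j * a j u)%C; auto.
  - intros j. apply AN_mult; auto. apply AN_weaken with (exp (rsum A j)).
    + now apply exp_le_mono.
    + now apply AN_cprod.
  - intros n. rewrite rsum_scal. apply Rmult_le_compat_l; auto. left; apply exp_pos.
  - intros u Hu. eapply Clim_ext; [|apply Clim_minus; [apply (HP u Hu)|apply (Clim_const 1)]].
    intros n. cbv beta. rewrite cprod_csum. ring.
Qed.

(** * Products over odd primes as products over initial segments *)

Definition isp (n : nat) : bool := if prime_dec (Z.of_nat n) then true else false.

(** The filtered list [odd_primes] recast as an indicator on all indices, so that products for
    different primes or weights can be multiplied index by index. *)
Definition oddp (n : nat) : bool := (Nat.leb 3 n && isp n)%bool.

Lemma odd_primes_S n : odd_primes (S n) = odd_primes n ++ (if oddp (S n) then (S n) :: nil else nil).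
Proof.
  unfold odd_primes, oddp.
  destruct (Nat.leb_spec 3 (S n)) as [L|L].
  - replace (S n - 2)%nat with (S (n - 2)) by lia. rewrite seq_S, filter_app.
    replace (3 + (n - 2))%nat with (S n) by lia. f_equal.
  - replace (S n - 2)%nat with 0%nat by lia. replace (n - 2)%nat with 0%nat by lia. reflexivity.
Qed.

Lemma Cprod_app f l1 l2 : Cprod f (l1 ++ l2) = (Cprod f l1 * Cprod f l2)%C.
Proof.
  unfold Cprod. rewrite map_app, fold_right_app.
  induction l1 as [|x l1 IH]; simpl; [ring|]. rewrite IH. ring.
Qed.

Lemma Cprod_odd_primes f n :
  Cprod f (odd_primes n) = cprod (fun k => if oddp k then f k else RtoC 1) (S n).
Proof.
  induction n as [|n IH].
  - simpl. unfold Cprod, odd_primes. simpl. ring.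
  - rewrite odd_primes_S, Cprod_app, IH. cbn [cprod].
    destruct (oddp (S n)); unfold Cprod; simpl; ring.
Qed.

Lemma Cprod_RtoC f l : Cprod (fun n => RtoC (f n)) l = RtoC (Rprod f l).
Proof.
  unfold Cprod, Rprod. induction l as [|x l IH]; simpl; auto. now rewrite IH, RtoC_mult.
Qed.

Lemma ln_le_sub1 x : 0 < x -> ln x <= x - 1.
Proof. intros Hx. generalize (exp_ge_1_plus (ln x)). rewrite exp_ln by auto. lra. Qed.

(* Comparison with the telescoping sum of [n^-eta - (n+1)^-eta]. *)
Lemma zeta_partial_bound eta n : 0 < eta ->
  rsum (fun j => exp (- (1 + eta) * ln (INR (S j)))) n <= 1 + / eta.
Proof.
  intros He.
  assert (He' : 0 < / eta) by now apply Rinv_0_lt_compat.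
  destruct n as [|n]; [simpl; lra|].
  apply Rle_trans with (1 + / eta * (1 - exp (- eta * ln (INR (S n))))).
  - induction n as [|n IH].
    + simpl. rewrite ln_1, !Rmult_0_r, exp_0. lra.
    + change (rsum ?f (S (S n))) with (rsum f (S n) + f (S n)). cbv beta.
      set (x := INR (S (S n))). assert (Ex : INR (S n) = x - 1) by (unfold x; rewrite (S_INR (S n)); ring).
      rewrite Ex in IH.
      assert (Hx : 2 <= x) by (unfold x; rewrite !S_INR; generalize (pos_INR n); lra).
      assert (H : exp (- (1 + eta) * ln x) <= / eta * (exp (- eta * ln (x - 1)) - exp (- eta * ln x))); [|lra].
      assert (L1 : ln (x - 1) = ln x + ln (1 - / x)).
      { rewrite <- ln_mult; [f_equal; field; lra|lra|].
        assert (/ x <= / 2) by (apply Rinv_le_contravar; lra). lra. }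
      assert (L2 : ln (1 - / x) <= - / x).
      { assert (/ x <= / 2) by (apply Rinv_le_contravar; lra).
        generalize (ln_le_sub1 (1 - / x)). lra. }
      rewrite L1. replace (- eta * (ln x + ln (1 - / x))) with (- eta * ln x + - eta * ln (1 - / x)) by ring.
      (* This gives [(1 - 1/x)^(-eta) >= 1 + eta/x], which makes the telescoping difference at least
         [eta x^(-1-eta)]. *)
      rewrite exp_plus. assert (X := exp_ge_1_plus (- eta * ln (1 - / x))).
      replace (- (1 + eta) * ln x) with (- eta * ln x + - ln x) by ring.
      rewrite exp_plus, (exp_Ropp (ln x)), exp_ln by lra.
      assert (P := exp_pos (- eta * ln x)).
      replace (exp (- eta * ln x) * / x) with (/ eta * (exp (- eta * ln x) * (eta * / x))) by (field; lra).
      apply Rmult_le_compat_l; [lra|]. 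
      assert (eta * / x <= exp (- eta * ln (1 - / x)) - 1); [|nra].
      nra.
  - assert (0 < exp (- eta * ln (INR (S n)))) by apply exp_pos. nra.
Qed.

(** * The product G *)

Definition gterm (s : C) (p : nat) : C :=
  (2 / (RtoC (INR p - 2) * (cpow (INR p) (s + 1) + 1)))%C.

Definition gterm_odd (s : C) (p : nat) : C := if oddp p then gterm s p else RtoC 0.

Lemma INR_ge3 p : (3 <= p)%nat -> 3 <= INR p.
Proof. intros H. apply le_INR in H. simpl in H. lra. Qed.

Lemma oddp_ge3 p : oddp p = true -> (3 <= p)%nat.
Proof.
  unfold oddp. intros H. apply andb_prop in H. destruct H as [H _]. now apply Nat.leb_le.
Qed.

Lemma one_plus_neq0 (v : C) : Cmod v <> 1 -> (1 + v)%C <> RtoC 0.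
Proof.
  intros H E. apply H. replace v with (- RtoC 1)%C.
  - rewrite Cmod_opp. apply Cmod_1.
  - replace v with ((1 + v) - 1)%C by ring. rewrite E. ring.
Qed.

Lemma cpow_plus_one_neq0 a s : 1 < a -> -1 < Re s -> (cpow a (s + 1) + 1)%C <> RtoC 0.
Proof.
  intros Ha Hs. rewrite Cplus_comm. apply one_plus_neq0. rewrite Cmod_cpow.
  assert (0 < ln a) by (rewrite <- ln_1; apply ln_increasing; lra).
  replace (Re (s + 1)) with (Re s + 1) by (unfold Re; simpl; ring).
  assert (0 < (Re s + 1) * ln a) by (apply Rmult_lt_0_compat; lra).
  assert (X := exp_ineq1 ((Re s + 1) * ln a) ltac:(lra)). lra.
Qed.

(** In terms of [v = p^(-(s+1))], of modulus below 1, the term is [2/(p-2)] times [v/(1+v)]. The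
    denominator is written [1 - - v], the shape that [AN_neumann] takes. *)
Lemma gterm_factor s p : (3 <= p)%nat -> -1 < Re s ->
  gterm s p = (RtoC (2 / (INR p - 2)) * (cpow (INR p) (- (s + 1)) * / (1 - - cpow (INR p) (- (s + 1)))))%C.
Proof.
  intros Hp Hs. apply INR_ge3 in Hp. unfold gterm.
  assert (N := cpow_plus_one_neq0 (INR p) s ltac:(lra) Hs).
  assert (N2 := cpow_neq0 (INR p) (- (s + 1))).
  assert (E := cpow_opp (INR p) (s + 1)).
  set (w := cpow (INR p) (s + 1)) in *. set (v := cpow (INR p) (- (s + 1))) in *.
  rewrite RtoC_div by lra.
  assert (P : RtoC (INR p - 2) <> RtoC 0) by (intros X; apply RtoC_inj in X; lra).
  assert (E2 : (1 - - v)%C = (v * (w + 1))%C).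
  { replace (v * (w + 1))%C with (v * w + v)%C by ring. rewrite E. ring. }
  rewrite E2. field. repeat split; auto.
Qed.

(** The 6 comes from [2/(p-2) <= 6/p] for [p >= 3], the denominator from [p^(-eta) <= 3^(-eta)]. *)
Definition Gconst (eta : R) : R := 6 / (1 - exp (- eta * ln 3)).

Lemma exp_neg_ln_lt1 eta x : 0 < eta -> 1 < x -> exp (- eta * ln x) < 1.
Proof.
  intros He Hx. rewrite <- exp_0. apply exp_increasing.
  assert (0 < ln x) by (rewrite <- ln_1; apply ln_increasing; lra). nra.
Qed.

Lemma Gconst_pos eta : 0 < eta -> 0 < Gconst eta.
Proof.
  intros He. apply Rdiv_lt_0_compat; [lra|].
  assert (exp (- eta * ln 3) < 1) by (apply exp_neg_ln_lt1; lra). lra.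
Qed.

(** Here [eta = s0 + 1 - r] is the distance of the disc from the abscissa [-1]. On it [p^(-(s+1))]
    has norm at most [p^(-eta)], which with the factor [2/(p-2)] gives the summable majorant
    [p^(-1-eta)]. *)
Lemma AN_gterm s0 t r p : 0 < r < s0 + 1 -> (3 <= p)%nat ->
  AN r (Gconst (s0 + 1 - r) * exp (- (1 + (s0 + 1 - r)) * ln (INR p))) (fun u => gterm (s0 + u, t) p).
Proof.
  intros Hr Hp. assert (P := INR_ge3 _ Hp). set (eta := s0 + 1 - r). assert (He : 0 < eta) by (unfold eta; lra).
  set (q := exp (- eta * ln (INR p))).
  assert (L0 : 0 < ln (INR p)) by (rewrite <- ln_1; apply ln_increasing; lra).
  assert (Q1 : q < 1) by (apply exp_neg_ln_lt1; lra).
  assert (Q3 : q <= exp (- eta * ln 3)).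
  { apply exp_le_mono. assert (ln 3 <= ln (INR p)) by (apply ln_le; lra). nra. }
  assert (Q31 : exp (- eta * ln 3) < 1) by (apply exp_neg_ln_lt1; lra).
  assert (Q0 : 0 < q) by apply exp_pos.
  set (v := fun u : R => cpow (INR p) (- (((s0 + u)%R, t) + 1))%C).
  assert (Av : AN r q v).
  { apply AN_ext with (fun u => cpow (INR p) ((- (s0 + 1))%R, (- t)%R) * RtoC (exp (- ln (INR p) * u)))%C.
    - intros u _. unfold v.
      replace (- (((s0 + u)%R, t) + 1))%C with (- (s0 + 1) + - u, - t)
        by (apply injective_projections; simpl; ring).
      rewrite cpow_add_R. do 3 f_equal. ring.
    - apply AN_weaken with (Cmod (cpow (INR p) (- (s0 + 1), - t)) * exp (Rabs (- ln (INR p)) * r)).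
      + rewrite Cmod_cpow, <- exp_plus. apply exp_le_mono. simpl.
        rewrite Rabs_Ropp, Rabs_pos_eq by lra. unfold eta. lra.
      + apply AN_scal, AN_exp. lra. }
  apply AN_ext with (fun u => RtoC (2 / (INR p - 2)) * (v u * / (1 - - v u)))%C.
  - intros u Hu. symmetry. apply gterm_factor; auto. simpl. apply Rabs_le_between in Hu. lra.
  - apply AN_weaken with (Cmod (RtoC (2 / (INR p - 2))) * (q * / (1 - q))).
    + rewrite Cmod_R, Rabs_pos_eq by (left; apply Rdiv_lt_0_compat; lra).
      replace (- (1 + eta) * ln (INR p)) with (- ln (INR p) + - eta * ln (INR p)) by ring.
      rewrite exp_plus, exp_Ropp, exp_ln by lra. fold q. unfold Gconst.
      assert (2 / (INR p - 2) <= 6 * / INR p).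
      { apply Rmult_le_reg_r with (INR p * (INR p - 2)); [nra|].
        replace (2 / (INR p - 2) * (INR p * (INR p - 2))) with (2 * INR p) by (field; lra).
        replace (6 * / INR p * (INR p * (INR p - 2))) with (6 * (INR p - 2)) by (field; lra). lra. }
      assert (/ (1 - q) <= / (1 - exp (- eta * ln 3))) by (apply Rinv_le_contravar; lra).
      assert (0 < / (1 - q)) by (apply Rinv_0_lt_compat; lra).
      apply Rle_trans with (6 * / INR p * (q * / (1 - exp (- eta * ln 3)))).
      * apply Rmult_le_compat; auto.
        -- left; apply Rdiv_lt_0_compat; lra.
        -- apply Rmult_le_pos; lra.
        -- apply Rmult_le_compat_l; lra.
      * right. field. lra.
    + apply AN_scal. apply AN_mult; auto; [lra|]. apply AN_neumann; auto; [lra|]. now apply AN_opp.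
Qed.

Lemma rsum_zeta_shift eta K n : 0 < eta -> 0 <= K ->
  rsum (fun j => K * exp (- (1 + eta) * ln (INR (S j)))) n <= K * (1 + / eta).
Proof.
  intros He HK. rewrite rsum_scal. apply Rmult_le_compat_l; auto. now apply zeta_partial_bound.
Qed.

Lemma AN_gterm_odd s0 t r j : 0 < r < s0 + 1 ->
  AN r (Gconst (s0 + 1 - r) * exp (- (1 + (s0 + 1 - r)) * ln (INR (S j)))) (fun u => gterm_odd (s0 + u, t) (S j)).
Proof.
  intros Hr. unfold gterm_odd. destruct (oddp (S j)) eqn:E.
  - apply AN_gterm; auto. now apply oddp_ge3.
  - apply AN_weaken with (Cmod (RtoC 0)); [|apply AN_const; lra].
    rewrite Cmod_0. apply Rmult_le_pos; [left; apply Gconst_pos; lra|left; apply exp_pos].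
Qed.

Lemma gterm_odd_summable s : -1 < Re s ->
  exists B, forall n, rsum (fun j => Cmod (gterm_odd s (S j))) n <= B.
Proof.
  intros Hs. destruct s as [s0 t]. simpl in Hs. set (r := (s0 + 1) / 2).
  exists (Gconst (s0 + 1 - r) * (1 + / (s0 + 1 - r))). intros n.
  eapply Rle_trans; [|apply (rsum_zeta_shift (s0 + 1 - r) (Gconst (s0 + 1 - r)) n)].
  - apply rsum_le. intros j _.
    assert (A := AN_gterm_odd s0 t r j ltac:(unfold r; lra)).
    assert (X := AN_bound r _ _ 0 A). cbv beta in X. rewrite Rplus_0_r in X. apply X.
    rewrite Rabs_R0. unfold r; lra.
  - unfold r; lra.
  - left. apply Gconst_pos. unfold r; lra.
Qed.

Lemma cprod_S_first (f : nat -> C) n : cprod f (S n) = (f 0%nat * cprod (fun k => f (S k)) n)%C.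
Proof.
  induction n as [|n IH]; [simpl; ring|].
  change (cprod f (S (S n))) with (cprod f (S n) * f (S n))%C. rewrite IH. simpl. ring.
Qed.

Lemma calG_partial s n :
  Cprod (fun p => 1 + gterm s p)%C (odd_primes n) = cprod (fun j => 1 + gterm_odd s (S j))%C n.
Proof.
  rewrite Cprod_odd_primes, cprod_S_first. unfold oddp at 1. cbn [Nat.leb andb].
  rewrite Cmult_1_l. apply cprod_ext. intros k _. unfold gterm_odd.
  destruct (oddp (S k)); auto. ring.
Qed.

Lemma calG_cv s : -1 < Re s -> Clim (cprod (fun j => 1 + gterm_odd s (S j))%C) (calG s).
Proof.
  intros Hs. destruct (gterm_odd_summable s Hs) as [B HB].
  destruct (cprod_cv _ B HB) as [l Hl].
  replace (calG s) with l; auto. symmetry. unfold calG. apply Cseq_lim_correct.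
  eapply Clim_ext; [|apply Hl]. intros n. symmetry. apply (calG_partial s n).
Qed.

Lemma ran_calG t s0 : -1 < s0 -> ran (fun x => calG (x, t)) s0.
Proof.
  intros Hs. set (r := (s0 + 1) / 2). set (eta := s0 + 1 - r). assert (He : 0 < eta) by (unfold eta, r; lra).
  exists r, (1 + exp (Gconst eta * (1 + / eta)) * (Gconst eta * (1 + / eta))). split; [unfold r; lra|].
  apply AN_infinite_product with (A := fun j => Gconst eta * exp (- (1 + eta) * ln (INR (S j))))
    (a := fun j u => gterm_odd (s0 + u, t) (S j)).
  - unfold r; lra.
  - intros j. apply AN_gterm_odd. unfold r; lra.
  - intros n. apply rsum_zeta_shift; auto. left. now apply Gconst_pos.
  - intros u Hu. apply calG_cv. simpl. apply Rabs_le_between in Hu. unfold r in Hu. lra.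
Qed.

(** * Sieving Euler products *)

Lemma csum_app (a : nat -> C) n m :
  csum a (n + m) = (csum a n + csum (fun i => a (n + i)%nat) m)%C.
Proof.
  induction m as [|m IH]; [rewrite Nat.add_0_r; simpl; ring|].
  rewrite Nat.add_succ_r. cbn [csum]. rewrite IH. ring.
Qed.

Lemma csum_single_lt (a : nat -> C) n :
  (forall k, (0 < k < n)%nat -> a k = RtoC 0) -> (0 < n)%nat -> csum a n = a 0%nat.
Proof.
  intros H L. induction n as [|n IH]; [lia|]. cbn [csum].
  destruct n as [|n]; [simpl; ring|]. rewrite IH, (H (S n)) by (try lia; intros; apply H; lia). ring.
Qed.

Lemma csum_multiples (g : nat -> C) p N : (1 <= p)%nat ->
  csum (fun m => if Nat.eqb (m mod p) 0 then g m else RtoC 0) (p * N) = csum (fun n => g (p * n)%nat) N.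
Proof.
  intros Hp. induction N as [|N IH]; [rewrite Nat.mul_0_r; reflexivity|].
  rewrite Nat.mul_succ_r, csum_app, IH. cbn [csum]. f_equal.
  rewrite csum_single_lt; [|intros k Hk|lia].
  - rewrite Nat.add_0_r, (Nat.mul_comm p N), Nat.Div0.mod_mul. reflexivity.
  - rewrite Nat.add_comm, Nat.mul_comm, Nat.Div0.mod_add, Nat.mod_small by lia.
    destruct (Nat.eqb_spec k 0); auto; lia.
Qed.

Lemma Clim_subseq u l (phi : nat -> nat) : (forall n, (n <= phi n)%nat) -> Clim u l -> Clim (fun n => u (phi n)) l.
Proof.
  intros Hphi H. apply is_lim_seq_spec. intros eps. apply is_lim_seq_spec in H.
  destruct (H eps) as [N HN]. exists N. intros n Hn. apply HN. specialize (Hphi n). lia.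
Qed.

Lemma Clim_multiples (g : nat -> C) p U : (1 <= p)%nat ->
  Clim (csum (fun m => if Nat.eqb (m mod p) 0 then g m else RtoC 0)) U ->
  Clim (csum (fun n => g (p * n)%nat)) U.
Proof.
  intros Hp H. eapply Clim_ext; [|apply (Clim_subseq _ _ (fun n => p * n)%nat) in H; [apply H|intros; nia]].
  intros n. now apply csum_multiples.
Qed.

(** All divisors in [[2, k]] are excluded, not only primes, so that the sieve advances by one
    integer at a time; [rough_composite] shows that a composite step changes nothing. *)
Definition rough (k m : nat) : bool :=
  forallb (fun d => negb (Nat.eqb (m mod d) 0)) (seq 2 (k - 1)).

Lemma rough_spec k m : rough k m = true <-> forall d, (2 <= d <= k)%nat -> ~ Nat.divide d m.
Proof.
  unfold rough. rewrite forallb_forall. split.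
  - intros H d Hd Hdiv. specialize (H d). rewrite in_seq in H.
    apply Nat.Lcm0.mod_divide in Hdiv. rewrite Hdiv in H. simpl in H.
    assert (false = true) by (apply H; lia). discriminate.
  - intros H d Hd. rewrite in_seq in Hd. destruct (Nat.eqb_spec (m mod d) 0) as [E|E]; auto.
    apply Nat.Lcm0.mod_divide in E. exfalso. apply (H d); auto. lia.
Qed.

Lemma rough_S k m : rough (S k) m = true <-> rough k m = true /\ ((1 <= k)%nat -> ~ Nat.divide (S k) m).
Proof.
  rewrite !rough_spec. split.
  - intros H. split; [intros d Hd; apply H; lia|]. intros Hk. apply H. lia.
  - intros [H1 H2] d Hd. destruct (Nat.eq_dec d (S k)) as [->|N]; [apply H2; lia|apply H1; lia].
Qed.

Lemma isp_spec p : isp p = true <-> prime (Z.of_nat p).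
Proof. unfold isp. destruct (prime_dec (Z.of_nat p)); split; auto; discriminate. Qed.

Lemma divide_Z d m : Nat.divide d m <-> (Z.of_nat d | Z.of_nat m)%Z.
Proof.
  split; intros [q Hq].
  - exists (Z.of_nat q). lia.
  - destruct (Nat.eq_dec d 0) as [->|N].
    + exists 0%nat. lia.
    + exists (Z.to_nat q). assert (0 <= q)%Z by nia. nia.
Qed.

Lemma rough_composite k m : (1 <= k)%nat -> isp (S k) = false -> rough k m = true -> ~ Nat.divide (S k) m.
Proof.
  intros Hk Hp Hr Hdiv. rewrite rough_spec in Hr.
  destruct (not_prime_divide (Z.of_nat (S k))) as (d & Hd & Hdd).
  - lia.
  - intros X. apply isp_spec in X. congruence.
  - apply (Hr (Z.to_nat d)); [lia|]. apply Nat.divide_trans with (S k); auto.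
    apply divide_Z. rewrite Z2Nat.id by lia. auto.
Qed.

Lemma rough_prime_mul k n : isp (S k) = true -> rough k (S k * n) = rough k n.
Proof.
  intros Hp. apply isp_spec in Hp.
  assert (E : rough k (S k * n) = true <-> rough k n = true).
  { rewrite !rough_spec. split; intros H d Hd Hdiv; apply (H d Hd).
    - now apply Nat.divide_mul_r.
    - apply divide_Z. apply divide_Z in Hdiv. rewrite Nat2Z.inj_mul in Hdiv.
      apply Gauss with (Z.of_nat (S k)); auto. apply rel_prime_sym, prime_rel_prime; auto.
      intros D. apply Z.divide_pos_le in D; lia. }
  destruct (rough k (S k * n)), (rough k n); auto; [symmetry; tauto|tauto].
Qed.

(** The local factor [1 + c_p (chi_p + chi_p^2 + ...)] of a multiplicative weight that gains [c p]
    at the first power of [p] and does not change at higher powers, as [W_div] and [W_ndiv]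
    express. *)
Definition euler_factor (chi : nat -> C) (c : nat -> R) (p : nat) : C :=
  if isp p then (1 + RtoC (c p) * chi p / (1 - chi p))%C else RtoC 1.

Section Sieve.
Variables (chi : nat -> C) (c W : nat -> R) (B : R).
Hypothesis chi_mult : forall m n, (1 <= m)%nat -> (1 <= n)%nat -> chi (m * n)%nat = (chi m * chi n)%C.
Hypothesis chi_1 : chi 1%nat = RtoC 1.
Hypothesis chi_neq : forall p, isp p = true -> chi p <> RtoC 1.
Hypothesis W_1 : W 1%nat = 1.
Hypothesis W_div : forall p n, isp p = true -> (1 <= n)%nat -> Nat.divide p n -> W (p * n)%nat = W n.
Hypothesis W_ndiv : forall p n, isp p = true -> (1 <= n)%nat -> ~ Nat.divide p n -> W (p * n)%nat = c p * W n.

(** Index 0 is a multiple of every prime; the value 0 there keeps it out of the sieve. *)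
Let f (m : nat) : C := match m with O => RtoC 0 | S _ => (RtoC (W m) * chi m)%C end.
Hypothesis f_summable : forall n, rsum (fun m => Cmod (f m)) n <= B.

Let g (k m : nat) : C := if rough k m then f m else RtoC 0.

Lemma sub_cv (v : nat -> C) : (forall m, Cmod (v m) <= Cmod (f m)) -> exists l, Clim (csum v) l.
Proof.
  intros H. apply cser_abs_cv with B. intros n. eapply Rle_trans; [|apply f_summable].
  apply rsum_le. auto.
Qed.

Lemma g_le k m : Cmod (g k m) <= Cmod (f m).
Proof. unfold g. destruct (rough k m); [lra|]. rewrite Cmod_0. apply Cmod_ge_0. Qed.

Lemma mod_eqb_divide m p : Nat.eqb (m mod p) 0 = true <-> Nat.divide p m.
Proof. rewrite Nat.eqb_eq. apply Nat.Lcm0.mod_divide. Qed.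

(* [T] splits as [T'] plus the part [U] carried by the multiples of the prime [p = k+1], and
   [U = chi p (c p T' + U)]. *)
Lemma sieve_step k T T' : Clim (csum (g k)) T -> Clim (csum (g (S k))) T' ->
  T = (euler_factor chi c (S k) * T')%C.
Proof.
  intros HT HT'. unfold euler_factor. destruct (isp (S k)) eqn:Hp.
  2:{ rewrite Cmult_1_l. apply (Clim_unique _ _ _ HT). eapply Clim_ext; [|apply HT'].
      intros n. apply csum_ext. intros m _. unfold g.
      assert (E : rough (S k) m = true <-> rough k m = true).
      { rewrite rough_S. split; [tauto|]. intros H. split; auto. intros Hk. now apply rough_composite. }
      destruct (rough (S k) m), (rough k m); auto; exfalso; intuition congruence. }
  assert (Hk : (1 <= k)%nat).
  { apply isp_spec in Hp. apply prime_ge_2 in Hp. lia. }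
  set (p := S k) in *.
  set (u := fun m => if Nat.eqb (m mod p) 0 then g k m else RtoC 0).
  destruct (sub_cv u) as [U HU].
  { intros m. unfold u. destruct (Nat.eqb (m mod p) 0); [apply g_le|]. rewrite Cmod_0. apply Cmod_ge_0. }
  assert (E1 : T = (T' + U)%C).
  { apply (Clim_unique _ _ _ HT). eapply Clim_ext; [|apply Clim_plus; [apply HT'|apply HU]].
    intros n. cbv beta. rewrite <- csum_plus. apply csum_ext. intros m _. unfold u, g.
    assert (X := rough_S k m). fold p in X. assert (Y := mod_eqb_divide m p).
    destruct (rough p m), (rough k m), (Nat.eqb (m mod p) 0); try ring; exfalso; intuition congruence. }
  assert (E2 : U = (chi p * (RtoC (c p) * T' + U))%C).
  { apply (Clim_unique (csum (fun n => g k (p * n)%nat))).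
    - apply Clim_multiples; [lia|]. exact HU.
    - eapply Clim_ext; [|apply Clim_scal, Clim_plus; [apply Clim_scal, HT'|apply HU]].
      intros n. cbv beta. rewrite <- !csum_scal, <- csum_plus, <- csum_scal.
      apply csum_ext. intros m _. unfold u, g. unfold p at 3. rewrite rough_prime_mul by auto. fold p.
      destruct m as [|m].
      { rewrite Nat.mul_0_r. simpl f. destruct (rough p 0), (rough k 0), (Nat.eqb (0 mod p) 0); ring. }
      assert (X := rough_S k (S m)). fold p in X. assert (Y := mod_eqb_divide (S m) p).
      assert (F : f (p * S m) = (RtoC (W (p * S m)) * (chi p * chi (S m)))%C).
      { rewrite <- chi_mult by lia. unfold f. destruct (p * S m)%nat eqn:E; auto.
        exfalso. unfold p in E. simpl in E. lia. }
      rewrite F. destruct (Nat.eqb (S m mod p) 0) eqn:ED.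
      + assert (D : Nat.divide p (S m)) by tauto.
        rewrite W_div by (auto; lia).
        destruct (rough p (S m)) eqn:R1, (rough k (S m)) eqn:R2; try (simpl; ring); exfalso; intuition congruence.
      + assert (D : ~ Nat.divide p (S m)) by (intros D; apply Y in D; congruence).
        rewrite W_ndiv, RtoC_mult by (auto; lia).
        destruct (rough p (S m)) eqn:R1, (rough k (S m)) eqn:R2; try (simpl; ring); exfalso; intuition congruence. }
  assert (N : (1 - chi p)%C <> RtoC 0).
  { apply Cminus_eq_contra. intros E. apply (chi_neq p Hp). auto. }
  assert (E3 : U = (chi p * RtoC (c p) * T' / (1 - chi p))%C).
  { assert (E4 : (U * (1 - chi p) = chi p * RtoC (c p) * T')%C).
    { replace (U * (1 - chi p))%C with (U - chi p * U)%C by ring. rewrite E2 at 1. ring. }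
    rewrite <- E4. field. auto. }
  rewrite E1, E3. field. auto.
Qed.

(** After [n] steps [F] is the partial product times the sum [T n] over integers without divisors in
    [[2, n]]. Among the indices up to [n] only 1 survives in [T n], and the tail of the absolutely
    convergent series is small, so [T n] tends to 1 and may be divided out for large [n]. *)
Lemma sieve_euler_product F : Clim (csum f) F ->
  Clim (cprod (fun j => euler_factor chi c (S j))) F.
Proof.
  intros HF.
  destruct (functional_choice _ (fun k => sub_cv (g k) (g_le k))) as [T HT].
  assert (HP : forall n, F = (cprod (fun j => euler_factor chi c (S j)) n * T n)%C).
  { induction n as [|n IH].
    - cbn [cprod]. rewrite Cmult_1_l. apply (Clim_unique _ _ _ HF).
      eapply Clim_ext; [|apply (HT 0%nat)]. intros n. apply csum_ext. intros m _. unfold g.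
      reflexivity.
    - rewrite IH. cbn [cprod]. rewrite (sieve_step n (T n) (T (S n))) by auto. ring. }
  assert (T1 : Clim T 1).
  { apply is_lim_seq_spec. intros [e He]. simpl. assert (He2 : 0 < e / 2) by lra.
    destruct (rsum_tail_small (fun m => Cmod (f m)) B (e / 2)) as [N HN]; auto.
    { intros; apply Cmod_ge_0. }
    exists (S N). intros n Hn. rewrite Rminus_0_r, Rabs_pos_eq by apply Cmod_ge_0.
    assert (E : csum (g n) (S n) = RtoC 1).
    { assert (ES : S n = (2 + (n - 1))%nat) by lia. rewrite ES, csum_app.
      rewrite (csum_ext (fun i => g n (2 + i)%nat) (fun _ => RtoC 0)).
      - rewrite csum_zero. cbn [csum].
        assert (R1 : rough n 1 = true).
        { apply rough_spec. intros d Hd D. apply Nat.divide_1_r in D. lia. }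
        unfold g. rewrite R1. simpl f. rewrite W_1, chi_1. destruct (rough n 0); ring.
      - intros i Hi. unfold g. destruct (rough n (2 + i)) eqn:R1; auto.
        exfalso. rewrite rough_spec in R1. apply (R1 (2 + i)%nat); [lia|]. apply Nat.divide_refl. }
    rewrite <- E. apply Rle_lt_trans with (e / 2); [|lra].
    apply cser_tail_dom with (fun m => Cmod (f m)); auto.
    - apply g_le.
    - intros m. specialize (HN m).
      assert (rsum (fun m => Cmod (f m)) N <= rsum (fun m => Cmod (f m)) (S n)).
      { apply rsum_mono; [intros; apply Cmod_ge_0|lia]. }
      lra. }
  assert (N0 : exists N, forall n, (N <= n)%nat -> T n <> RtoC 0).
  { assert (X := T1). apply is_lim_seq_spec in X. destruct (X (mkposreal 1 Rlt_0_1)) as [N HN].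
    exists N. intros n Hn E. specialize (HN n Hn). rewrite E in HN. simpl in HN.
    rewrite Rminus_0_r, Rabs_pos_eq in HN by apply Cmod_ge_0.
    replace (0 - 1)%C with (- RtoC 1)%C in HN by ring. rewrite Cmod_opp, Cmod_1 in HN. lra. }
  destruct N0 as [N HN].
  apply Clim_ext_loc with (fun n => F * / T n)%C N.
  - intros n Hn. rewrite (HP n). field. auto.
  - replace F with (F * / 1)%C at 1 by field.
    apply Clim_scal, Clim_inv; auto. apply C1_nz.
Qed.
End Sieve.

(** * The Dirichlet series of the singular series *)

Fixpoint rprod (f : nat -> R) (n : nat) : R :=
  match n with O => 1 | S k => rprod f k * f k end.

Lemma cprod_RtoC (f : nat -> R) n : cprod (fun k => RtoC (f k)) n = RtoC (rprod f n).
Proof. induction n as [|n IH]; simpl; auto. now rewrite IH, RtoC_mult. Qed.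

Lemma rprod_ext (f g : nat -> R) n : (forall k, (k < n)%nat -> f k = g k) -> rprod f n = rprod g n.
Proof. induction n as [|n IH]; intros H; simpl; auto. rewrite IH, H; auto. Qed.

Lemma rprod_mult (f g : nat -> R) n : rprod (fun k => f k * g k) n = rprod f n * rprod g n.
Proof. induction n as [|n IH]; simpl; [ring|]. rewrite IH. ring. Qed.

Lemma rprod_nonneg (f : nat -> R) n : (forall k, 0 <= f k) -> 0 <= rprod f n.
Proof. intros H. induction n as [|n IH]; simpl; [lra|]. now apply Rmult_le_pos. Qed.

Lemma rprod_single p x n : (p < n)%nat -> rprod (fun k => if Nat.eqb k p then x else 1) n = x.
Proof.
  intros L.
  assert (E : rprod (fun k => if Nat.eqb k p then x else 1) n = if Nat.ltb p n then x else 1).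
  { clear L. induction n as [|n IH]; simpl; auto. rewrite IH.
    destruct (Nat.ltb_spec p n), (Nat.ltb_spec p (S n)), (Nat.eqb_spec n p); try lia; ring. }
  rewrite E. destruct (Nat.ltb_spec p n); auto; lia.
Qed.

Lemma rprod_stable (f : nat -> R) n m : (n <= m)%nat ->
  (forall k, (n <= k)%nat -> f k = 1) -> rprod f m = rprod f n.
Proof.
  intros L H. induction L; auto. simpl. rewrite IHL, H by auto. ring.
Qed.

Lemma Rprod_odd_primes f n :
  Rprod f (odd_primes n) = rprod (fun k => if oddp k then f k else 1) (S n).
Proof.
  apply RtoC_inj. rewrite <- Cprod_RtoC, Cprod_odd_primes, <- cprod_RtoC.
  apply cprod_ext. intros k _. now destruct (oddp k).
Qed.

Lemma Rprod_filter f q l : Rprod f (filter q l) = Rprod (fun p => if q p then f p else 1) l.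
Proof.
  unfold Rprod. induction l as [|x l IH]; simpl; auto.
  destruct (q x); simpl; rewrite IH; ring.
Qed.

Definition sratio (p : nat) : R := (INR p - 1) / (INR p - 2).

(* The singular series of an even [m] without its factor [2 C_2]. *)
Definition sweight (m : nat) : R :=
  Rprod sratio (filter (fun p => Nat.eqb (Nat.modulo m p) 0) (odd_primes m)).

Definition sterm (m k : nat) : R :=
  if oddp k then if Nat.eqb (m mod k) 0 then sratio k else 1 else 1.

(** Primes beyond [m] do not divide it, so the range may be enlarged at will; weights of different
    integers can then be compared over a common range. *)
Lemma sweight_rprod m N : (1 <= m)%nat -> (S m <= N)%nat -> sweight m = rprod (sterm m) N.
Proof.
  intros Hm HN. unfold sweight. rewrite Rprod_filter, Rprod_odd_primes. symmetry.
  apply rprod_stable; auto. intros k Hk. unfold sterm.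
  destruct (oddp k); auto. rewrite Nat.mod_small by lia. destruct (Nat.eqb_spec m 0); auto; lia.
Qed.

Lemma oddp_isp k : oddp k = true -> isp k = true.
Proof. unfold oddp. intros H. apply andb_prop in H. tauto. Qed.

Lemma isp_cases k : isp k = true -> k = 2%nat \/ oddp k = true.
Proof.
  intros H. destruct (Nat.eq_dec k 2) as [|N]; auto. right. unfold oddp. rewrite H.
  apply isp_spec in H. apply prime_ge_2 in H. destruct (Nat.leb_spec 3 k); auto. lia.
Qed.

Lemma oddp_2 : oddp 2 = false.
Proof. reflexivity. Qed.

Lemma isp_2 : isp 2 = true.
Proof. apply isp_spec. apply prime_2. Qed.

Lemma prime_divide_mul p k n : isp p = true -> isp k = true ->
  Nat.divide k (p * n) -> k <> p -> Nat.divide k n.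
Proof.
  intros Hp Hk D N. apply isp_spec in Hp. apply isp_spec in Hk.
  apply divide_Z. apply divide_Z in D. rewrite Nat2Z.inj_mul in D.
  apply prime_mult in D; auto. destruct D as [D|D]; auto.
  apply prime_div_prime in D; auto. lia.
Qed.

Lemma sterm_mul p n k : isp p = true -> k <> p -> sterm (p * n) k = sterm n k.
Proof.
  intros Hp N. unfold sterm. destruct (oddp k) eqn:Hk; auto.
  assert (E : Nat.eqb ((p * n) mod k) 0 = true <-> Nat.eqb (n mod k) 0 = true).
  { rewrite !mod_eqb_divide. split.
    - intros D. apply prime_divide_mul with p; auto. now apply oddp_isp.
    - apply Nat.divide_mul_r. }
  destruct (Nat.eqb ((p * n) mod k) 0), (Nat.eqb (n mod k) 0); auto; exfalso; intuition congruence.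
Qed.

Lemma mod_self_mul p n : Nat.eqb ((p * n) mod p) 0 = true.
Proof. apply mod_eqb_divide. apply Nat.divide_factor_l. Qed.

Lemma isp_ge2 p : isp p = true -> (2 <= p)%nat.
Proof. intros H. apply isp_spec, prime_ge_2 in H. lia. Qed.

Lemma INR_ge2 p : (2 <= p)%nat -> 2 <= INR p.
Proof. intros H. apply le_INR in H. simpl in H. lra. Qed.

Definition sfactor (p : nat) : R := if oddp p then sratio p else 1.

Lemma sweight_div p n : isp p = true -> (1 <= n)%nat -> Nat.divide p n -> sweight (p * n) = sweight n.
Proof.
  intros Hp Hn D. assert (P := isp_ge2 p Hp).
  rewrite (sweight_rprod (p * n) (S (p * n))), (sweight_rprod n (S (p * n))) by nia.
  apply rprod_ext. intros k _. destruct (Nat.eq_dec k p) as [->|N]; [|now apply sterm_mul].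
  unfold sterm. rewrite mod_self_mul. apply mod_eqb_divide in D. now rewrite D.
Qed.

Lemma sweight_ndiv p n : isp p = true -> (1 <= n)%nat -> ~ Nat.divide p n ->
  sweight (p * n) = sfactor p * sweight n.
Proof.
  intros Hp Hn D. assert (P := isp_ge2 p Hp).
  rewrite (sweight_rprod (p * n) (S (p * n))), (sweight_rprod n (S (p * n))) by nia.
  rewrite <- (rprod_single p (sfactor p) (S (p * n))) by nia. rewrite <- rprod_mult.
  apply rprod_ext. intros k _. destruct (Nat.eqb_spec k p) as [->|N].
  - unfold sterm, sfactor. rewrite mod_self_mul.
    destruct (oddp p); [|ring]. destruct (Nat.eqb (n mod p) 0) eqn:E; [|ring].
    exfalso. apply D. now apply mod_eqb_divide.
  - rewrite sterm_mul by auto. ring.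
Qed.

Lemma sweight_1 : sweight 1 = 1.
Proof. reflexivity. Qed.

Lemma sratio_bounds p : (3 <= p)%nat -> 1 <= sratio p <= 2.
Proof.
  intros H. apply INR_ge3 in H. unfold sratio. split.
  - apply Rmult_le_reg_r with (INR p - 2); [lra|]. unfold Rdiv. rewrite Rmult_assoc, Rinv_l by lra. lra.
  - apply Rmult_le_reg_r with (INR p - 2); [lra|]. unfold Rdiv. rewrite Rmult_assoc, Rinv_l by lra. lra.
Qed.

Lemma sfactor_bounds p : 1 <= sfactor p <= 2.
Proof. unfold sfactor. destruct (oddp p) eqn:E; [|lra]. apply sratio_bounds. now apply oddp_ge3. Qed.

Lemma sweight_nonneg m : 0 <= sweight m.
Proof.
  destruct m as [|m]; [unfold sweight; simpl; unfold Rprod; simpl; lra|].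
  rewrite (sweight_rprod _ (S (S m))) by lia. apply rprod_nonneg. intros k. unfold sterm.
  destruct (oddp k) eqn:E; [|lra]. destruct (Nat.eqb (S m mod k) 0); [|lra].
  assert (X := sratio_bounds k (oddp_ge3 _ E)). lra.
Qed.

Lemma prime_divisor_exists m : (2 <= m)%nat -> exists p, isp p = true /\ Nat.divide p m.
Proof.
  induction m as [m IH] using (well_founded_induction lt_wf). intros Hm.
  destruct (isp m) eqn:E; [exists m; split; auto; apply Nat.divide_refl|].
  destruct (not_prime_divide (Z.of_nat m)) as (d & Hd & Hdd); [lia| |].
  { intros X. apply isp_spec in X. congruence. }
  destruct (IH (Z.to_nat d)) as (p & Hp & D); [lia|lia|].
  exists p. split; auto. apply Nat.divide_trans with (Z.to_nat d); auto.
  apply divide_Z. now rewrite Z2Nat.id by lia.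
Qed.

(** Removing a prime factor [p] divides the weight by at most 2, hence by at most [p]. This crude
    bound gives absolute convergence for [Re s > 2]; the smaller [s] are reached by continuation. *)
Lemma sweight_le m : (1 <= m)%nat -> sweight m <= INR m.
Proof.
  induction m as [m IH] using (well_founded_induction lt_wf). intros Hm.
  destruct (Nat.eq_dec m 1) as [->|N]; [rewrite sweight_1; simpl; lra|].
  destruct (prime_divisor_exists m) as (p & Hp & n & Hn); [lia|].
  rewrite Nat.mul_comm in Hn. assert (P := isp_ge2 p Hp).
  assert (Hn1 : (1 <= n)%nat) by nia. assert (n < m)%nat by nia.
  specialize (IH n H Hn1). assert (X := sfactor_bounds p). assert (Y := sweight_nonneg n).
  assert (P2 : 2 <= INR p) by (apply le_INR in P; simpl in P; lra).
  assert (HS : sweight m <= 2 * sweight n).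
  { rewrite Hn. destruct (classic (Nat.divide p n)) as [D|D].
    - rewrite sweight_div by auto. lra.
    - rewrite sweight_ndiv by auto. nra. }
  eapply Rle_trans; [apply HS|]. rewrite Hn, mult_INR.
  apply Rle_trans with (2 * INR n); [lra|]. apply Rmult_le_compat_r; [apply pos_INR|lra].
Qed.

Definition dterm (s : C) (n : nat) : C := cpow (INR (S n)) (- s).

Lemma Cmod_dterm s n : Cmod (dterm s n) = exp (- Re s * ln (INR (S n))).
Proof. unfold dterm. rewrite Cmod_cpow. f_equal. Qed.

Lemma csum_S_first (a : nat -> C) n : csum a (S n) = (a 0%nat + csum (fun k => a (S k)) n)%C.
Proof.
  induction n as [|n IH]; [simpl; ring|].
  change (csum a (S (S n))) with (csum a (S n) + a (S n))%C. rewrite IH. simpl. ring.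
Qed.

Lemma rsum_S_first (a : nat -> R) n : rsum a (S n) = a 0%nat + rsum (fun k => a (S k)) n.
Proof.
  induction n as [|n IH]; [simpl; ring|].
  change (rsum a (S (S n))) with (rsum a (S n) + a (S n)). rewrite IH. simpl. ring.
Qed.

Lemma INR_S_ge1 n : 1 <= INR (S n).
Proof. rewrite S_INR. generalize (pos_INR n). lra. Qed.

Lemma chi_mult_cpow s m n : (1 <= m)%nat -> (1 <= n)%nat ->
  cpow (INR (m * n)) s = (cpow (INR m) s * cpow (INR n) s)%C.
Proof.
  intros Hm Hn. rewrite mult_INR. apply cpow_mult_base; apply lt_0_INR; lia.
Qed.

Lemma Cmod_cpow_lt1 s p : 0 < Re s -> (2 <= p)%nat -> Cmod (cpow (INR p) (- s)) < 1.
Proof.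
  intros Hs Hp. rewrite Cmod_cpow. apply le_INR in Hp. simpl in Hp.
  replace (Re (- s)) with (- Re s) by reflexivity. apply exp_neg_ln_lt1; lra.
Qed.

Lemma cpow_neq_1 s p : 0 < Re s -> isp p = true -> cpow (INR p) (- s) <> RtoC 1.
Proof.
  intros Hs Hp E. assert (X := Cmod_cpow_lt1 s p Hs (isp_ge2 p Hp)). rewrite E, Cmod_1 in X. lra.
Qed.

Lemma dirichlet_abs s (w : nat -> R) (d : R) : 1 + d < Re s -> (forall n, Rabs (w n) <= exp (d * ln (INR (S n)))) ->
  forall n, rsum (fun k => Cmod (RtoC (w k) * dterm s k)%C) n <= 1 + / (Re s - 1 - d).
Proof.
  intros Hs Hw n. eapply Rle_trans; [|apply (zeta_partial_bound (Re s - 1 - d) n); lra].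
  apply rsum_le. intros k _. rewrite Cmod_mult, Cmod_R, Cmod_dterm.
  replace (- (1 + (Re s - 1 - d)) * ln (INR (S k))) with (d * ln (INR (S k)) + - Re s * ln (INR (S k))) by ring.
  rewrite exp_plus. apply Rmult_le_compat_r; [left; apply exp_pos|apply Hw].
Qed.

Lemma dirichlet_euler s (c W : nat -> R) (d : R) D :
  0 < Re s -> 1 + d < Re s -> (forall n, Rabs (W (S n)) <= exp (d * ln (INR (S n)))) ->
  W 1%nat = 1 ->
  (forall p n, isp p = true -> (1 <= n)%nat -> Nat.divide p n -> W (p * n)%nat = W n) ->
  (forall p n, isp p = true -> (1 <= n)%nat -> ~ Nat.divide p n -> W (p * n)%nat = c p * W n) ->
  Clim (csum (fun n => RtoC (W (S n)) * dterm s n)%C) D ->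
  Clim (cprod (fun j => euler_factor (fun p => cpow (INR p) (- s)) c (S j))) D.
Proof.
  intros Hs0 Hs HW W1 W2 W3 HD.
  apply sieve_euler_product with (W := W) (B := 1 + / (Re s - 1 - d)); auto.
  - intros; now apply chi_mult_cpow.
  - simpl. apply cpow_base_1.
  - intros; now apply cpow_neq_1.
  - intros n. destruct n as [|n].
    { assert (0 < / (Re s - 1 - d)) by (apply Rinv_0_lt_compat; lra). simpl; lra. }
    rewrite rsum_S_first, Cmod_0, Rplus_0_l.
    apply (dirichlet_abs s (fun k => W (S k)) d); auto.
  - apply (is_lim_seq_incr_1 (fun n => Cmod (csum _ n - D)%C)).
    eapply Clim_ext; [|apply HD]. intros n. rewrite csum_S_first, Cplus_0_l. reflexivity.
Qed.

Definition is_dzeta (s Z : C) : Prop := Clim (csum (dterm s)) Z.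

Lemma zeta_euler s Z : 1 < Re s -> is_dzeta s Z ->
  Clim (cprod (fun j => euler_factor (fun p => cpow (INR p) (- s)) (fun _ => 1) (S j))) Z.
Proof.
  intros Hs HZ. apply (dirichlet_euler s (fun _ => 1) (fun _ => 1) 0); auto; try lra.
  - intros n. rewrite Rmult_0_l, exp_0, Rabs_R1. lra.
  - intros; ring.
  - eapply Clim_ext; [|apply HZ]. intros n. apply csum_ext. intros; ring.
Qed.

Lemma dzeta_exists s : 1 < Re s -> exists Z, is_dzeta s Z.
Proof.
  intros Hs. apply cser_abs_cv with (1 + / (Re s - 1 - 0)). intros n.
  eapply Rle_trans; [|apply (dirichlet_abs s (fun _ => 1) 0) with (n := n)].
  - apply Req_le, rsum_ext. intros k _. now rewrite Cmult_1_l.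
  - lra.
  - intros k. rewrite Rmult_0_l, exp_0, Rabs_R1. lra.
Qed.

Lemma zeta_factor s p : 0 < Re s -> isp p = true ->
  euler_factor (fun p => cpow (INR p) (- s)) (fun _ => 1) p = (/ (1 - cpow (INR p) (- s)))%C.
Proof.
  intros Hs Hp. unfold euler_factor. rewrite Hp.
  assert (N := Cminus_eq_contra _ _ (not_eq_sym (cpow_neq_1 s p Hs Hp))). field. auto.
Qed.

Lemma sing_series_even n : (1 <= n)%nat -> sing_series (2 * n) = 2 * twin_C2 * sweight n.
Proof.
  intros Hn. unfold sing_series. rewrite Nat.even_mul. cbn [Nat.even orb]. f_equal.
  change (sweight (2 * n) = sweight n).
  destruct (classic (Nat.divide 2 n)) as [D|D].
  - apply sweight_div; auto. apply isp_2.
  - rewrite sweight_ndiv by (auto; apply isp_2). unfold sfactor. rewrite oddp_2. ring.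
Qed.

Lemma sing_series_odd k : Nat.eqb (k mod 2) 0 = false -> sing_series k = 0.
Proof.
  intros H. unfold sing_series. destruct (Nat.even k) eqn:E; auto.
  apply Nat.even_spec in E. destruct E as [j ->].
  rewrite Nat.mul_comm, Nat.Div0.mod_mul in H. discriminate.
Qed.

Lemma sing_series_bound k : (1 <= k)%nat -> Rabs (sing_series k) <= 2 * Rabs twin_C2 * INR k.
Proof.
  intros Hk. assert (X := Rabs_pos twin_C2). assert (Y := pos_INR k).
  destruct (Nat.eqb (k mod 2) 0) eqn:E.
  - apply mod_eqb_divide in E. destruct E as [j ->]. rewrite Nat.mul_comm.
    assert (1 <= j)%nat by lia.
    rewrite sing_series_even, Rabs_mult, Rabs_mult, (Rabs_pos_eq 2), (Rabs_pos_eq (sweight j)) by (auto; try lra; apply sweight_nonneg).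
    assert (Z := sweight_le j H). assert (W := sweight_nonneg j). rewrite mult_INR. simpl. nra.
  - rewrite sing_series_odd, Rabs_R0 by auto. nra.
Qed.

Lemma cprod_single p x n : (p < n)%nat -> cprod (fun k => if Nat.eqb k p then x else RtoC 1) n = x.
Proof.
  intros L.
  assert (E : cprod (fun k => if Nat.eqb k p then x else RtoC 1) n = if Nat.ltb p n then x else RtoC 1).
  { clear L. induction n as [|n IH]; simpl; auto. rewrite IH.
    destruct (Nat.ltb_spec p n), (Nat.ltb_spec p (S n)), (Nat.eqb_spec n p); try lia; ring. }
  rewrite E. destruct (Nat.ltb_spec p n); auto; lia.
Qed.

Lemma isp_oddp_neq2 p : isp p = true -> p <> 2%nat -> oddp p = true.
Proof. intros H N. destruct (isp_cases p H); auto; contradiction. Qed.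

Lemma isp_false_oddp p : isp p = false -> oddp p = false.
Proof. intros H. destruct (oddp p) eqn:E; auto. apply oddp_isp in E. congruence. Qed.

(** With [v = p^(-(s+1))] and [x = p^(-s) = p v], after multiplication by [(1 - x)(1 - v^2)] both
    sides are [1 + p v/(p-2)] at an odd prime. At [p = 2], that is [j = 1], the weight has no factor
    and [1 + v] must be supplied by hand. *)
Lemma euler_identity_local s j : 1 < Re s ->
  (euler_factor (fun p => cpow (INR p) (- s)) sfactor (S j) *
   euler_factor (fun p => cpow (INR p) (- (2 * s + 2))) (fun _ => 1) (S j) *
   (if Nat.eqb j 1 then 1 + cpow 2 (- (s + 1)) else 1) =
   euler_factor (fun p => cpow (INR p) (- s)) (fun _ => 1) (S j) *
   euler_factor (fun p => cpow (INR p) (- (s + 1))) (fun _ => 1) (S j) *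
   (1 + gterm_odd s (S j)))%C.
Proof.
  intros Hs. set (p := S j).
  assert (R1 : Re (s + 1) = Re s + 1) by (unfold Re; simpl; ring).
  assert (R2 : Re (2 * s + 2) = 2 * Re s + 2) by (unfold Re; simpl; ring).
  destruct (isp p) eqn:Hp.
  2:{ unfold euler_factor, gterm_odd. rewrite Hp, isp_false_oddp by auto.
      destruct (Nat.eqb_spec j 1) as [->|]; [exfalso; unfold p in Hp; rewrite isp_2 in Hp; discriminate|ring]. }
  rewrite !zeta_factor by (auto; lra).
  set (v := cpow (INR p) (- (s + 1))). set (x := cpow (INR p) (- s)).
  assert (P2 := isp_ge2 p Hp). assert (P2R : 2 <= INR p) by now apply INR_ge2.
  assert (Ex : x = (RtoC (INR p) * v)%C).
  { unfold x, v. rewrite <- (cpow_1 (INR p)) by lra. rewrite <- cpow_plus. f_equal. ring. }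
  assert (Ev : cpow (INR p) (- (2 * s + 2)) = (v * v)%C).
  { unfold v. rewrite <- cpow_plus. f_equal. ring. }
  rewrite Ev. unfold euler_factor. rewrite Hp.
  assert (Nx : (1 - x)%C <> RtoC 0).
  { apply Cminus_eq_contra, not_eq_sym, cpow_neq_1; auto; lra. }
  assert (Mv : Cmod v < 1) by (apply Cmod_cpow_lt1; auto; lra).
  assert (Nv : (1 + v)%C <> RtoC 0) by (apply one_plus_neq0; lra).
  assert (Nv' : (1 - v)%C <> RtoC 0).
  { replace (1 - v)%C with (1 + - v)%C by ring. apply one_plus_neq0. rewrite Cmod_opp. lra. }
  assert (Nvv : (1 - v * v)%C <> RtoC 0).
  { replace (1 - v * v)%C with ((1 + v) * (1 - v))%C by ring. now apply Cmult_neq_0. }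
  fold x. unfold gterm_odd, sfactor.
  destruct (Nat.eqb_spec j 1) as [->|Nj].
  - change p with 2%nat in *. rewrite oddp_2.
    replace (cpow 2 (- (s + 1))) with v by (unfold v; simpl; reflexivity).
    field. auto.
  - assert (Ho : oddp p = true) by (apply isp_oddp_neq2; auto; unfold p; lia). rewrite Ho.
    assert (P3 := INR_ge3 p (oddp_ge3 p Ho)).
    rewrite (gterm_factor s p (oddp_ge3 p Ho)) by lra. fold v.
    unfold sratio. rewrite !RtoC_div, !RtoC_minus by lra.
    assert (NP : (RtoC (INR p) - 2)%C <> RtoC 0).
    { rewrite <- RtoC_minus. intros X. apply RtoC_inj in X. lra. }
    assert (N2 : (1 - - v)%C <> RtoC 0) by (replace (1 - - v)%C with (1 + v)%C by ring; auto).
    rewrite Ex in *. field. repeat split; auto.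
Qed.

(** Only even [k = 2n] contribute, so [F = 2 C_2 2^(-s) D] with [D] the Dirichlet series of
    [sweight]. Multiplying by [2^(s+1) + 1 = 2^(s+1) (1 + 2^(-(s+1)))] turns the prefactor into
    [4 C_2]. The zeta value at [2s + 2] stays on the left as a factor. *)
Lemma sing_series_dirichlet s Z1 Z2 Z3 : 3 < Re s ->
  is_dzeta s Z1 -> is_dzeta (s + 1) Z2 -> is_dzeta (2 * s + 2) Z3 ->
  exists F, Clim (csum (fun n => RtoC (sing_series (S n)) * dterm s n)%C) F /\
    (F * Z3 * (cpow 2 (s + 1) + 1) = 4 * RtoC twin_C2 * Z1 * Z2 * calG s)%C.
Proof.
  intros Hs H1 H2 H3.
  assert (R1 : Re (s + 1) = Re s + 1) by (unfold Re; simpl; ring).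
  assert (R2 : Re (2 * s + 2) = 2 * Re s + 2) by (unfold Re; simpl; ring).
  assert (HW : forall n, Rabs (sweight (S n)) <= exp (1 * ln (INR (S n)))).
  { intros n. rewrite Rmult_1_l, exp_ln by (generalize (INR_S_ge1 n); lra).
    rewrite Rabs_pos_eq by apply sweight_nonneg. apply sweight_le. lia. }
  destruct (cser_abs_cv (fun n => RtoC (sweight (S n)) * dterm s n)%C (1 + / (Re s - 1 - 1))) as [D HD].
  { apply dirichlet_abs; [lra|auto]. }
  set (g := fun m => match m with O => RtoC 0 | S _ => (RtoC (sing_series m) * cpow (INR m) (- s))%C end).
  set (g' := fun m => if Nat.eqb (m mod 2) 0 then g m else RtoC 0).
  assert (Eg : forall n, csum g' n = csum g n).
  { intros n. apply csum_ext. intros m _. unfold g', g. destruct m as [|m]; auto.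
    destruct (Nat.eqb (S m mod 2) 0) eqn:E; auto. rewrite sing_series_odd by auto. ring. }
  assert (Eh : forall n, csum (fun n => g (2 * n)%nat) (S n) =
     (2 * RtoC twin_C2 * cpow 2 (- s) * csum (fun n => RtoC (sweight (S n)) * dterm s n) n)%C).
  { intros n. rewrite csum_S_first, <- csum_scal. unfold g at 1. simpl (2 * 0)%nat. cbv iota.
    rewrite Cplus_0_l. apply csum_ext. intros m _. unfold g.
    destruct (2 * S m)%nat eqn:E; [lia|]. rewrite <- E, sing_series_even by lia.
    rewrite chi_mult_cpow by lia. unfold dterm. rewrite !RtoC_mult. replace (INR 2) with 2 by (simpl; ring). ring. }
  assert (HgU : exists U, Clim (csum g') U).
  { destruct (cser_abs_cv g (2 * Rabs twin_C2 * (1 + / (Re s - 1 - 1)))) as [U HU].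
    - intros n. destruct n as [|n].
      { simpl. apply Rmult_le_pos; [generalize (Rabs_pos twin_C2); lra|].
        assert (0 < / (Re s - 1 - 1)) by (apply Rinv_0_lt_compat; lra). lra. }
      rewrite rsum_S_first. unfold g at 1. rewrite Cmod_0, Rplus_0_l.
      apply Rle_trans with (rsum (fun k => 2 * Rabs twin_C2 * Cmod (RtoC (INR (S k)) * dterm s k)%C) n).
      + apply rsum_le. intros k _. unfold g. rewrite !Cmod_mult, !Cmod_R, <- Rmult_assoc.
        apply Rmult_le_compat_r; [apply Cmod_ge_0|].
        rewrite (Rabs_pos_eq (INR (S k))) by apply pos_INR. apply sing_series_bound. lia.
      + rewrite rsum_scal. apply Rmult_le_compat_l; [generalize (Rabs_pos twin_C2); lra|].
        apply (dirichlet_abs s (fun k => INR (S k)) 1); [lra|]. intros k.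
        rewrite Rmult_1_l, exp_ln, Rabs_pos_eq by (generalize (INR_S_ge1 k); lra). lra.
    - exists U. eapply Clim_ext; [|apply HU]. intros; symmetry; apply Eg. }
  destruct HgU as [F HF].
  assert (EF : F = (2 * RtoC twin_C2 * cpow 2 (- s) * D)%C).
  { apply (Clim_unique (fun n => csum (fun n => g (2 * n)%nat) (S n))).
    - apply (is_lim_seq_incr_1 (fun n => Cmod (csum _ n - F)%C)). apply Clim_multiples; [lia|exact HF].
    - eapply Clim_ext; [|apply Clim_scal, HD]. intros n. symmetry. apply Eh. }
  exists F. split.
  { apply Clim_ext with (fun n => csum g' (S n)).
    - intros n. rewrite Eg, csum_S_first. unfold g at 1. rewrite Cplus_0_l. reflexivity.
    - apply (is_lim_seq_incr_1 (fun n => Cmod (csum g' n - F)%C)). exact HF. }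
  assert (PD := dirichlet_euler s sfactor sweight 1 D ltac:(lra) ltac:(lra) HW sweight_1 sweight_div sweight_ndiv HD).
  assert (P1 := zeta_euler s Z1 ltac:(lra) H1).
  assert (P2 := zeta_euler (s + 1) Z2 ltac:(lra) H2).
  assert (P3 := zeta_euler (2 * s + 2) Z3 ltac:(lra) H3).
  assert (PG := calG_cv s ltac:(lra)).
  assert (Main : (D * Z3 * (1 + cpow 2 (- (s + 1))) = Z1 * Z2 * calG s)%C).
  { apply (Clim_unique (fun n => cprod (fun j => euler_factor (fun p => cpow (INR p) (- s)) (fun _ => 1) (S j)) n *
        cprod (fun j => euler_factor (fun p => cpow (INR p) (- (s + 1))) (fun _ => 1) (S j)) n *
        cprod (fun j => 1 + gterm_odd s (S j)) n)%C).
    - eapply Clim_ext_loc with (N := 2%nat); [|apply Clim_mult; [apply Clim_mult; [apply PD|apply P3]|apply (Clim_const (1 + cpow 2 (- (s + 1)))%C)]].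
      intros n Hn. cbv beta.
      rewrite <- (cprod_single 1 (1 + cpow 2 (- (s + 1)))%C n) by lia.
      rewrite <- !cprod_mult. apply cprod_ext. intros j _. apply euler_identity_local. lra.
    - apply Clim_mult; [apply Clim_mult; auto|auto]. }
  rewrite EF.
  assert (E2 : (cpow 2 (s + 1) + 1)%C = (cpow 2 (s + 1) * (1 + cpow 2 (- (s + 1))))%C).
  { replace (cpow 2 (s + 1) * (1 + cpow 2 (- (s + 1))))%C with
      (cpow 2 (s + 1) + cpow 2 (- (s + 1)) * cpow 2 (s + 1))%C by ring. now rewrite cpow_opp. }
  assert (E3 : (cpow 2 (- s) * cpow 2 (s + 1))%C = RtoC 2).
  { rewrite <- cpow_plus. replace (- s + (s + 1))%C with (RtoC 1) by ring. apply cpow_1. lra. }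
  rewrite E2.
  replace (2 * twin_C2 * cpow 2 (- s) * D * Z3 * (cpow 2 (s + 1) * (1 + cpow 2 (- (s + 1)))))%C
    with (2 * RtoC twin_C2 * (cpow 2 (- s) * cpow 2 (s + 1)) * (D * Z3 * (1 + cpow 2 (- (s + 1)))))%C by ring.
  rewrite E3, Main. ring.
Qed.

(** * The quotient K near 0 and at 1 *)

Definition c2term (p : nat) : R := if oddp p then 1 - 1 / (INR p - 1) ^ 2 else 1.

Lemma c2term_bounds p : 0 <= c2term p <= 1.
Proof.
  unfold c2term. destruct (oddp p) eqn:E; [|lra]. apply oddp_ge3, INR_ge3 in E.
  assert (0 < 1 / (INR p - 1) ^ 2) by (apply Rdiv_lt_0_compat; [lra|apply pow_lt; lra]).
  assert (1 / (INR p - 1) ^ 2 <= 1); [|lra].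
  apply Rmult_le_reg_r with ((INR p - 1) ^ 2); [apply pow_lt; lra|].
  unfold Rdiv. rewrite Rmult_assoc, Rinv_l by (apply Rgt_not_eq, pow_lt; lra). nra.
Qed.

(** All factors lie in [[0, 1]], so the partial products decrease and are bounded below. *)
Lemma twin_C2_cv : is_lim_seq (rprod (fun j => c2term (S j))) twin_C2.
Proof.
  assert (E : forall n, Rprod (fun p => 1 - 1 / (INR p - 1) ^ 2) (odd_primes n) = rprod (fun j => c2term (S j)) n).
  { intros n. rewrite Rprod_odd_primes. apply RtoC_inj. rewrite <- !cprod_RtoC, cprod_S_first.
    unfold oddp at 1. cbn [Nat.leb andb]. rewrite Cmult_1_l. reflexivity. }
  assert (Ex : ex_finite_lim_seq (rprod (fun j => c2term (S j)))).
  { apply ex_finite_lim_seq_decr with 0.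
    - intros n. simpl. assert (X := c2term_bounds (S n)).
      assert (Y : 0 <= rprod (fun j => c2term (S j)) n) by (apply rprod_nonneg; intros; apply c2term_bounds).
      nra.
    - intros n. apply rprod_nonneg; intros; apply c2term_bounds. }
  destruct Ex as [l Hl]. unfold twin_C2.
  rewrite (Lim_seq_ext _ _ E), (is_lim_seq_unique _ _ Hl). exact Hl.
Qed.

(** The prime 2 fits the same formula: with [v = 2^(-(s+1))], the factor [4 (1 - v^2)/(1/v + 1)]
    equals [1 - (1 - 2v)^2]. This absorbs the 4 and the denominator [2^(s+1) + 1]. *)
Definition kterm (s : R) (p : nat) : R :=
  if isp p then (1 - exp (- s * ln (INR p))) ^ 2 / (INR p - 1) ^ 2 else 0.

(* Writing [u = p^(s+1)], the local factor [(1 - 1/(p-1)^2) (1 + 2/((p-2)(u+1))) (1 - u^-2)]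
   equals [1 - (u-p)^2/((p-1)^2 u^2)], hence the double zero at [s = 0]. *)
Lemma K_local s j : -1/2 < s ->
  (RtoC (1 - kterm s (S j)) *
     euler_factor (fun p => cpow (INR p) (- (2 * RtoC s + 2))) (fun _ => 1) (S j) *
     (if Nat.eqb j 1 then cpow 2 (RtoC s + 1) + 1 else 1) =
   (if Nat.eqb j 1 then 4 else 1) * RtoC (c2term (S j)) * (1 + gterm_odd (RtoC s) (S j)))%C.
Proof.
  intros Hs. set (p := S j).
  assert (R2 : Re (2 * RtoC s + 2) = 2 * s + 2) by (unfold Re; simpl; ring).
  destruct (isp p) eqn:Hp.
  2:{ unfold kterm, c2term, euler_factor, gterm_odd. rewrite Hp, isp_false_oddp by auto.
      destruct (Nat.eqb_spec j 1) as [->|]; [exfalso; unfold p in Hp; rewrite isp_2 in Hp; discriminate|].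
      rewrite Rminus_0_r. ring. }
  assert (P2 := isp_ge2 p Hp). assert (P2R := INR_ge2 p P2).
  rewrite zeta_factor by (auto; lra).
  set (x := exp (- s * ln (INR p))).
  assert (Hx : 0 < x) by apply exp_pos.
  assert (Ev : cpow (INR p) (- (RtoC s + 1)) = RtoC (x / INR p)).
  { replace (- (RtoC s + 1))%C with (RtoC (- s + - (1))) by (rewrite RtoC_plus, !RtoC_opp; ring).
    rewrite cpow_RtoC, Rmult_plus_distr_r, exp_plus. fold x.
    replace (- (1) * ln (INR p)) with (- ln (INR p)) by ring. rewrite exp_Ropp, exp_ln by lra. reflexivity. }
  assert (Evv : cpow (INR p) (- (2 * RtoC s + 2)) = (RtoC (x / INR p) * RtoC (x / INR p))%C).
  { rewrite <- Ev, <- cpow_plus. f_equal. ring. }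
  rewrite Evv. set (v := x / INR p) in *.
  assert (Hv0 : 0 < v) by (apply Rdiv_lt_0_compat; lra).
  assert (Hv : v < 1).
  { assert (M := Cmod_cpow_lt1 (RtoC s + 1) p). rewrite Ev, Cmod_R, Rabs_pos_eq in M by lra.
    apply M; auto. unfold Re; simpl. lra. }
  assert (Exv : x = INR p * v) by (unfold v; field; lra).
  unfold kterm, c2term, gterm_odd. rewrite Hp. fold x. rewrite Exv.
  rewrite <- RtoC_mult, <- RtoC_minus, <- RtoC_inv by nra.
  destruct (Nat.eqb_spec j 1) as [->|Nj].
  - change p with 2%nat in *. rewrite oddp_2. replace (INR 2) with 2 in * by (simpl; ring).
    assert (E2 : cpow 2 (RtoC s + 1) = RtoC (/ v)).
    { rewrite RtoC_inv by lra. rewrite <- Ev.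
      assert (X := cpow_opp 2 (RtoC s + 1)). assert (Y := cpow_neq0 2 (- (RtoC s + 1))).
      assert (Z := cpow_neq0 2 (RtoC s + 1)).
      replace (cpow 2 (RtoC s + 1)) with ((cpow 2 (- (RtoC s + 1)) * cpow 2 (RtoC s + 1)) * / cpow 2 (- (RtoC s + 1)))%C by (field; auto).
      rewrite X. ring. }
    rewrite E2. rewrite <- !RtoC_plus, <- !RtoC_mult. apply f_equal. field. split; nra.
  - assert (Ho : oddp p = true) by (apply isp_oddp_neq2; auto; unfold p; lia). rewrite Ho.
    assert (P3 := INR_ge3 p (oddp_ge3 p Ho)).
    rewrite (gterm_factor _ p (oddp_ge3 p Ho)) by (simpl; lra). rewrite Ev. fold v.
    rewrite <- RtoC_opp, <- RtoC_minus, <- RtoC_inv by lra.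
    repeat rewrite <- ?RtoC_mult, <- ?RtoC_plus. apply f_equal. field. repeat split; nra.
Qed.

(** The condition [2 <= n] ensures that the index [j = 1] of the prime 2, which carries the two
    exceptional factors, lies in the range. *)
Lemma K_partial s n : -1/2 < s -> (2 <= n)%nat ->
  (RtoC (rprod (fun j => 1 - kterm s (S j))%R n) *
     cprod (fun j => euler_factor (fun p => cpow (INR p) (- (2 * RtoC s + 2))) (fun _ => 1) (S j)) n *
     (cpow 2 (RtoC s + 1) + 1) =
   4 * RtoC (rprod (fun j => c2term (S j)) n) * cprod (fun j => 1 + gterm_odd (RtoC s) (S j)) n)%C.
Proof.
  intros Hs Hn. rewrite <- (cprod_single 1 (cpow 2 (RtoC s + 1) + 1)%C n) by lia.
  rewrite <- (cprod_single 1 (RtoC 4) n) by lia.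
  rewrite <- !cprod_RtoC, <- !cprod_mult. apply cprod_ext. intros j _. now apply K_local.
Qed.

(** Weierstrass's product inequality. *)
Lemma rprod_ge_1_minus (x : nat -> R) n : (forall j, 0 <= x j <= 1) ->
  0 <= rprod (fun j => 1 - x j) n <= 1 /\ 1 - rsum x n <= rprod (fun j => 1 - x j) n.
Proof.
  intros H. induction n as [|n [IH1 IH2]]; simpl; [lra|]. specialize (H n). nra.
Qed.

(** From [1 - p^(-s) <= s ln p], [ln p <= 4 p^(1/4)] and [p <= 2 (p-1)] one gets at most
    [16 s^2 p^(1/2) / (p-1)^2], hence at most [64 s^2 p^(-3/2)]. *)
Lemma kterm_le s j : 0 <= s ->
  0 <= kterm s (S j) <= 1 /\ kterm s (S j) <= s ^ 2 * (64 * exp (- (1 + / 2) * ln (INR (S j)))).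
Proof.
  intros Hs. unfold kterm. destruct (isp (S j)) eqn:Hp.
  2:{ assert (X := exp_pos (- (1 + / 2) * ln (INR (S j)))). split; [lra|]. apply Rmult_le_pos; nra. }
  set (p := INR (S j)). assert (P : 2 <= p) by (apply INR_ge2, isp_ge2; auto).
  assert (L0 : 0 < ln p) by (rewrite <- ln_1; apply ln_increasing; lra).
  set (y := 1 - exp (- s * ln p)).
  assert (Y0 : 0 <= y).
  { unfold y. assert (exp (- s * ln p) <= exp 0) by (apply exp_le_mono; nra). rewrite exp_0 in H. lra. }
  assert (Y1 : y <= 1) by (unfold y; generalize (exp_pos (- s * ln p)); lra).
  assert (Y2 : y <= s * ln p).
  { unfold y. generalize (exp_ge_1_plus (- s * ln p)). lra. }
  assert (D : 0 < (p - 1) ^ 2) by (apply pow_lt; lra).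
  split.
  - split.
    + apply Rmult_le_pos; [nra|left; now apply Rinv_0_lt_compat].
    + apply Rmult_le_reg_r with ((p - 1) ^ 2); auto. unfold Rdiv. rewrite Rmult_assoc, Rinv_l by lra. nra.
  - apply Rmult_le_reg_r with ((p - 1) ^ 2); auto. unfold Rdiv. rewrite Rmult_assoc, Rinv_l by lra.
    rewrite Rmult_1_r.
    set (z := exp (/ 4 * ln p)).
    assert (Z0 : 0 < z) by apply exp_pos.
    assert (Lz : ln p <= 4 * z).
    { assert (X := exp_ge_1_plus (/ 4 * ln p)). fold z in X. lra. }
    assert (Ez : exp (- (1 + / 2) * ln p) * p ^ 2 = z ^ 2).
    { unfold z. replace (p ^ 2) with (exp (2 * ln p)).
      - rewrite <- exp_plus. replace (exp (/ 4 * ln p) ^ 2) with (exp (/ 4 * ln p) * exp (/ 4 * ln p)) by ring.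
        rewrite <- exp_plus. f_equal. field.
      - replace (2 * ln p) with (ln p + ln p) by ring. rewrite exp_plus, exp_ln by lra. ring. }
    assert (y ^ 2 <= s ^ 2 * (ln p) ^ 2) by nra.
    assert ((ln p) ^ 2 <= 16 * z ^ 2) by nra.
    assert (s ^ 2 * ln p ^ 2 <= s ^ 2 * (16 * z ^ 2)) by (apply Rmult_le_compat_l; nra).
    set (E := exp (- (1 + / 2) * ln p)) in *. assert (E0 : 0 < E) by apply exp_pos.
    assert (p ^ 2 <= 4 * (p - 1) ^ 2) by nra.
    assert (16 * z ^ 2 <= 64 * E * (p - 1) ^ 2) by nra.
    apply Rle_trans with (s ^ 2 * (64 * E * (p - 1) ^ 2)); [|right; ring].
    assert (s ^ 2 * (16 * z ^ 2) <= s ^ 2 * (64 * E * (p - 1) ^ 2)) by (apply Rmult_le_compat_l; nra).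
    lra.
Qed.

(** The product of the [1 - kterm] differs from 1 by at most the sum of the [kterm], and
    [192 = 64 * 3] with 3 bounding the sum of [n^(-3/2)]. Only [s >= 0] is treated, where [kterm]
    lies in [[0, 1]]; the behaviour at 0 is later read off along a sequence from the right. *)
Lemma K_near_0 s Z : 0 <= s -> is_dzeta (2 * RtoC s + 2) Z ->
  Cmod (4 * RtoC twin_C2 * calG (RtoC s) - Z * (cpow 2 (RtoC s + 1) + 1))%C <=
  192 * s ^ 2 * Cmod (Z * (cpow 2 (RtoC s + 1) + 1))%C.
Proof.
  intros Hs HZ.
  assert (R2 : Re (2 * RtoC s + 2) = 2 * s + 2) by (unfold Re; simpl; ring).
  assert (PZ := zeta_euler _ Z ltac:(rewrite R2; lra) HZ).
  assert (PG := calG_cv (RtoC s) ltac:(simpl; lra)).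
  assert (PC := Clim_RtoC _ _ twin_C2_cv).
  set (w := (cpow 2 (RtoC s + 1) + 1)%C) in *.
  set (e := cprod (fun j => euler_factor (fun p => cpow (INR p) (- (2 * RtoC s + 2))) (fun _ => 1) (S j))) in *.
  set (k := rprod (fun j => 1 - kterm s (S j))).
  assert (HK : forall n, Rabs (k n - 1) <= 192 * s ^ 2).
  { intros n. destruct (rprod_ge_1_minus (fun j => kterm s (S j)) n) as [A B].
    { intros j. apply kterm_le; auto. }
    fold k in A, B. rewrite Rabs_left1 by lra.
    assert (rsum (fun j => kterm s (S j)) n <= 192 * s ^ 2); [|lra].
    apply Rle_trans with (rsum (fun j => s ^ 2 * (64 * exp (- (1 + / 2) * ln (INR (S j))))) n).
    - apply rsum_le. intros j _. now apply kterm_le.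
    - rewrite rsum_scal, rsum_scal.
      assert (X := zeta_partial_bound (/ 2) n ltac:(lra)). rewrite Rinv_inv in X.
      assert (0 <= s ^ 2) by nra.
      apply Rle_trans with (s ^ 2 * (64 * 3)); [|right; ring]. apply Rmult_le_compat_l; auto. lra. }
  assert (L1 : Clim (fun n => RtoC (k n - 1) * (e n * w))%C (4 * RtoC twin_C2 * calG (RtoC s) - Z * w)%C).
  { eapply Clim_ext_loc with (N := 2%nat);
      [|apply Clim_minus; [apply Clim_mult; [apply Clim_scal, PC|apply PG]|apply Clim_mult; [apply PZ|apply (Clim_const w)]]].
    intros n Hn. cbv beta. rewrite <- K_partial by (auto; lra). fold w. fold e. fold k. rewrite RtoC_minus. ring. }
  assert (L2 : Clim (fun n => e n * w)%C (Z * w)%C) by (apply Clim_mult; [apply PZ|apply (Clim_const w)]).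
  apply Clim_Cmod in L1. apply Clim_Cmod in L2.
  apply (is_lim_seq_le _ (fun n => 192 * s ^ 2 * Cmod (e n * w)%C) (Cmod (4 * RtoC twin_C2 * calG (RtoC s) - Z * w)%C)
    (192 * s ^ 2 * Cmod (Z * w)%C)) in L1; auto.
  - intros n. rewrite Cmod_mult, Cmod_R. apply Rmult_le_compat_r; [apply Cmod_ge_0|apply HK].
  - apply is_lim_seq_mult'; [apply is_lim_seq_const|exact L2].
Qed.

(** For [s = 1] the term [kterm] is [p^(-2)], so the local factors cancel the Euler product of
    [zeta(2)]. Hence [K(1) = 1/zeta(2)], and the Dirichlet series of the singular series has residue
    1 at 1. *)
Lemma K_at_1 Z2 Z4 : is_dzeta (RtoC 2) Z2 -> is_dzeta (RtoC 4) Z4 ->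
  (4 * RtoC twin_C2 * calG (RtoC 1) * Z2 = Z4 * (cpow 2 (1 + 1) + 1))%C.
Proof.
  intros H2 H4.
  assert (P2 := zeta_euler (RtoC 2) Z2 ltac:(simpl; lra) H2).
  assert (P4 := zeta_euler (RtoC 4) Z4 ltac:(simpl; lra) H4).
  assert (PG := calG_cv (RtoC 1) ltac:(simpl; lra)).
  assert (PC := Clim_RtoC _ _ twin_C2_cv).
  apply (Clim_unique (fun n => 4 * RtoC (rprod (fun j => c2term (S j)) n) * cprod (fun j => 1 + gterm_odd (RtoC 1) (S j)) n *
    cprod (fun j => euler_factor (fun p => cpow (INR p) (- RtoC 2)) (fun _ => 1) (S j)) n)%C).
  - apply Clim_mult; auto. apply Clim_mult; auto. now apply Clim_scal.
  - eapply Clim_ext_loc with (N := 2%nat); [|apply Clim_mult; [apply P4|apply (Clim_const (cpow 2 (1 + 1) + 1)%C)]].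
    intros n Hn. cbv beta. rewrite <- K_partial by (auto; lra).
    replace (2 * RtoC 1 + 2)%C with (RtoC 4) by (rewrite <- RtoC_mult, <- RtoC_plus; f_equal; ring).
    rewrite <- cprod_RtoC.
    assert (E : (cprod (fun j => RtoC (1 - kterm 1 (S j))) n *
      cprod (fun j => euler_factor (fun p => cpow (INR p) (- RtoC 2)) (fun _ => 1) (S j)) n)%C = RtoC 1).
    { rewrite <- cprod_mult. assert (X : forall m, cprod (fun _ => RtoC 1) m = RtoC 1).
      { induction m as [|m IH]; simpl; auto. rewrite IH. ring. }
      rewrite <- (X n). apply cprod_ext. intros j _. unfold kterm. destruct (isp (S j)) eqn:Hp.
      2:{ unfold euler_factor. rewrite Hp, Rminus_0_r. ring. }
      rewrite zeta_factor by (auto; simpl; lra).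
      set (p := INR (S j)). assert (P : 2 <= p) by (apply INR_ge2, isp_ge2; auto).
      assert (Ep : exp (- (1) * ln p) = / p).
      { replace (- (1) * ln p) with (- ln p) by ring. rewrite exp_Ropp, exp_ln by lra. auto. }
      assert (Ep2 : cpow p (- RtoC 2) = RtoC (/ p * / p)).
      { rewrite <- RtoC_opp, cpow_RtoC. f_equal. rewrite <- Ep at 2. rewrite <- Ep, <- exp_plus. f_equal. ring. }
      rewrite Ep.
      assert (0 < / p <= / 2) by (split; [apply Rinv_0_lt_compat; lra|apply Rinv_le_contravar; lra]).
      rewrite Ep2, <- RtoC_minus, <- RtoC_inv, <- RtoC_mult by nra. f_equal. field. repeat split; nra. }
    set (A := cprod (fun j => RtoC (1 - kterm 1 (S j))) n) in *.
    set (B := cprod (fun j => euler_factor (fun p => cpow (INR p) (- RtoC 2)) (fun _ => 1) (S j)) n) in *.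
    set (D := cprod _ n).
    replace (A * D * (cpow 2 (1 + 1) + 1) * B)%C with ((A * B) * (D * (cpow 2 (1 + 1) + 1)))%C by ring.
    rewrite E. ring.
Qed.

(** * Transforms of summatory functions *)

Lemma RInt_extR (f g : R -> R) a b :
  (forall x, Rmin a b < x < Rmax a b -> f x = g x) -> RInt f a b = RInt g a b.
Proof. apply RInt_ext. Qed.

(** The integral of [h(x) x^(-s-2)] for complex [s]. Splitting [x^(-i Im s)] into cosine and sine
    makes both components real transforms, to which the theory of [LT] applies. *)
Definition CI (h : R -> R) (s : C) (a b : R) : C :=
  (LT (fun x => h x * cos (- Im s * ln x)) (Re s) a b,
   LT (fun x => h x * sin (- Im s * ln x)) (Re s) a b).

Lemma cont_pos_cos t : cont_pos (fun x => cos (- t * ln x)).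
Proof. apply cont_pos_derivable. intros x Hx. auto_derive. auto. Qed.

Lemma cont_pos_sin t : cont_pos (fun x => sin (- t * ln x)).
Proof. apply cont_pos_derivable. intros x Hx. auto_derive. auto. Qed.

Lemma LT_plus h1 h2 s a b : cont_pos h1 -> cont_pos h2 -> 0 < a -> 0 < b ->
  LT (fun x => h1 x + h2 x) s a b = LT h1 s a b + LT h2 s a b.
Proof.
  intros H1 H2 Ha Hb. unfold LT.
  assert (X := RInt_plus (fun x => h1 x * exp (- (s + 2) * ln x)) (fun x => h2 x * exp (- (s + 2) * ln x)) a b
    (ex_RInt_LT h1 s a b H1 Ha Hb) (ex_RInt_LT h2 s a b H2 Ha Hb)).
  unfold plus in X; simpl in X. rewrite <- X. apply RInt_extR. intros x _. ring.
Qed.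

Lemma LT_scal c h s a b : cont_pos h -> 0 < a -> 0 < b ->
  LT (fun x => c * h x) s a b = c * LT h s a b.
Proof.
  intros H1 Ha Hb. unfold LT.
  assert (X := RInt_scal (fun x => h x * exp (- (s + 2) * ln x)) a b c (ex_RInt_LT h s a b H1 Ha Hb)).
  unfold scal in X; simpl in X; unfold mult in X; simpl in X. rewrite <- X. apply RInt_extR. intros x _. ring.
Qed.

Lemma LT_ext h1 h2 s a b : a <= b -> (forall x, a <= x <= b -> h1 x = h2 x) -> LT h1 s a b = LT h2 s a b.
Proof.
  intros Hab H. unfold LT. apply RInt_extR. intros x Hx. rewrite Rmin_left, Rmax_right in Hx by auto.
  rewrite H; auto. lra.
Qed.

Lemma CI_plus h1 h2 s a b : cont_pos h1 -> cont_pos h2 -> 0 < a -> 0 < b ->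
  CI (fun x => h1 x + h2 x) s a b = (CI h1 s a b + CI h2 s a b)%C.
Proof.
  intros H1 H2 Ha Hb. unfold CI. apply injective_projections; simpl;
    rewrite <- LT_plus by (auto; apply cont_pos_mult; auto using cont_pos_cos, cont_pos_sin);
    unfold LT; apply RInt_extR; intros; ring.
Qed.

Lemma CI_scal c h s a b : cont_pos h -> 0 < a -> 0 < b ->
  CI (fun x => c * h x) s a b = (RtoC c * CI h s a b)%C.
Proof.
  intros H1 Ha Hb. unfold CI. apply injective_projections; simpl;
    rewrite Rmult_0_l, ?Rminus_0_r, ?Rplus_0_r;
    rewrite <- LT_scal by (auto; apply cont_pos_mult; auto using cont_pos_cos, cont_pos_sin);
    unfold LT; apply RInt_extR; intros; ring.
Qed.

Lemma CI_ext h1 h2 s a b : a <= b -> (forall x, a <= x <= b -> h1 x = h2 x) -> CI h1 s a b = CI h2 s a b.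
Proof.
  intros Hab H. unfold CI. f_equal; apply LT_ext; auto; intros; now rewrite H.
Qed.

Lemma CI_Chasles h s a b c : cont_pos h -> 0 < a -> 0 < b -> 0 < c ->
  (CI h s a b + CI h s b c)%C = CI h s a c.
Proof.
  intros H Ha Hb Hc. unfold CI. apply injective_projections; simpl; apply LT_Chasles; auto;
    apply cont_pos_mult; auto using cont_pos_cos, cont_pos_sin.
Qed.

Lemma CI_zero s a b : CI (fun _ => 0) s a b = RtoC 0.
Proof.
  assert (X : forall t, LT (fun x => 0 * t x) (Re s) a b = 0).
  { intros t. unfold LT. rewrite (RInt_extR _ (fun _ => 0)) by (intros; ring).
    rewrite RInt_const. unfold scal; simpl; unfold mult; simpl; ring. }
  unfold CI. rewrite (X (fun x => cos (- Im s * ln x))), (X (fun x => sin (- Im s * ln x))). reflexivity.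
Qed.

Definition Cder (Phi : R -> C) (x : R) (d : C) : Prop :=
  is_derive (fun y => Re (Phi y)) x (Re d) /\ is_derive (fun y => Im (Phi y)) x (Im d).

Lemma cpow_ReIm x (w : C) :
  cpow x w = (exp (Re w * ln x) * cos (Im w * ln x), exp (Re w * ln x) * sin (Im w * ln x)).
Proof.
  destruct w as [a b]. unfold cpow, Cexp. simpl.
  rewrite !Rmult_0_r, Rminus_0_r, Rplus_0_l.
  apply injective_projections; simpl; ring.
Qed.

Lemma cpow_pred x w : 0 < x -> cpow x (w - 1) = (cpow x w * RtoC (/ x))%C.
Proof.
  intros Hx. unfold Cminus. rewrite cpow_plus. f_equal.
  rewrite <- RtoC_opp, cpow_RtoC. f_equal. replace (- (1) * ln x) with (- ln x) by ring.
  rewrite exp_Ropp, exp_ln; auto.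
Qed.

Lemma Cder_cpow w x : 0 < x -> Cder (fun y => cpow y w) x (w * cpow x (w - 1))%C.
Proof.
  intros Hx. rewrite cpow_pred by auto. rewrite cpow_ReIm. destruct w as [a b]. split.
  - apply is_derive_ext with (fun y => exp (a * ln y) * cos (b * ln y)).
    + intros y. now rewrite cpow_ReIm.
    + auto_derive; [auto|]. unfold Re, Im; simpl. field. lra.
  - apply is_derive_ext with (fun y => exp (a * ln y) * sin (b * ln y)).
    + intros y. now rewrite cpow_ReIm.
    + auto_derive; [auto|]. unfold Re, Im; simpl. field. lra.
Qed.

Lemma Cder_ext Phi x d d' : d = d' -> Cder Phi x d -> Cder Phi x d'.
Proof. now intros ->. Qed.

Lemma Cder_plus P Q x d e : Cder P x d -> Cder Q x e -> Cder (fun y => P y + Q y)%C x (d + e)%C.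
Proof.
  intros [A B] [D E]. split.
  - apply (is_derive_plus (fun y => Re (P y)) (fun y => Re (Q y))); auto.
  - apply (is_derive_plus (fun y => Im (P y)) (fun y => Im (Q y))); auto.
Qed.

Lemma Cder_mult_r (f : R -> R) P x f' d : is_derive f x f' -> Cder P x d ->
  Cder (fun y => RtoC (f y) * P y)%C x (RtoC f' * P x + RtoC (f x) * d)%C.
Proof.
  intros Hf [A B]. split.
  - apply is_derive_ext with (fun y => f y * Re (P y)).
    + intros y. unfold Re; simpl. ring.
    + replace (Re (RtoC f' * P x + RtoC (f x) * d)%C) with (f' * Re (P x) + f x * Re d) by (unfold Re; simpl; ring).
      apply (is_derive_mult f (fun y => Re (P y))); auto. intros; apply Rmult_comm.
  - apply is_derive_ext with (fun y => f y * Im (P y)).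
    + intros y. unfold Im; simpl. ring.
    + replace (Im (RtoC f' * P x + RtoC (f x) * d)%C) with (f' * Im (P x) + f x * Im d) by (unfold Im; simpl; ring).
      apply (is_derive_mult f (fun y => Im (P y))); auto. intros; apply Rmult_comm.
Qed.

Lemma Cder_scal c P x d : Cder P x d -> Cder (fun y => c * P y)%C x (c * d)%C.
Proof.
  intros [A B]. destruct c as [a b]. split.
  - apply is_derive_ext with (fun y => a * Re (P y) - b * Im (P y)).
    + intros y. unfold Re, Im; simpl. ring.
    + replace (Re ((a, b) * d)%C) with (a * Re d - b * Im d) by (unfold Re, Im; simpl; ring).
      apply (is_derive_minus (fun y => a * Re (P y)) (fun y => b * Im (P y)));
        apply is_derive_scal; auto.
  - apply is_derive_ext with (fun y => a * Im (P y) + b * Re (P y)).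
    + intros y. unfold Re, Im; simpl. ring.
    + replace (Im ((a, b) * d)%C) with (a * Im d + b * Re d) by (unfold Re, Im; simpl; ring).
      apply (is_derive_plus (fun y => a * Im (P y)) (fun y => b * Re (P y)));
        apply is_derive_scal; auto.
Qed.

Lemma CI_FTC h s a b Phi : cont_pos h -> 0 < a <= b ->
  (forall x, 0 < x -> Cder Phi x (RtoC (h x) * cpow x (- (s + 2)))%C) ->
  CI h s a b = (Phi b - Phi a)%C.
Proof.
  intros Hh Hab H. unfold CI.
  assert (R1 : Re (- (s + 2))%C = - (Re s + 2)) by (unfold Re; simpl; ring).
  assert (R2 : Im (- (s + 2))%C = - Im s) by (unfold Im; simpl; ring).
  apply injective_projections; simpl; unfold LT; apply is_RInt_unique.
  - apply (is_RInt_derive (fun x => Re (Phi x))).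
    + intros x Hx. rewrite Rmin_left in Hx by lra.
      replace (h x * cos (- Im s * ln x) * exp (- (Re s + 2) * ln x)) with
        (Re (RtoC (h x) * cpow x (- (s + 2)))%C); [apply H; lra|].
      rewrite cpow_ReIm, R1, R2. unfold Re; simpl. ring.
    + intros x Hx. rewrite Rmin_left in Hx by lra.
      apply cont_pos_LT; [apply cont_pos_mult; auto; apply cont_pos_cos|lra].
  - apply (is_RInt_derive (fun x => Im (Phi x))).
    + intros x Hx. rewrite Rmin_left in Hx by lra.
      replace (h x * sin (- Im s * ln x) * exp (- (Re s + 2) * ln x)) with
        (Im (RtoC (h x) * cpow x (- (s + 2)))%C); [apply H; lra|].
      rewrite cpow_ReIm, R1, R2. unfold Im; simpl. ring.
    + intros x Hx. rewrite Rmin_left in Hx by lra.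
      apply cont_pos_LT; [apply cont_pos_mult; auto; apply cont_pos_sin|lra].
Qed.

Lemma cpow_lim0 w : Re w < 0 -> Clim (fun n => cpow (1 + INR n) w) 0.
Proof.
  intros Hw.
  apply is_lim_seq_ext with (fun n => exp (Re w * ln (1 + INR n))).
  { intros n. replace (cpow (1 + INR n) w - 0)%C with (cpow (1 + INR n) w) by ring. now rewrite Cmod_cpow. }
  assert (L : is_lim_seq (fun n => ln (1 + INR n)) p_infty).
  { apply (filterlim_comp _ _ _ (fun n => 1 + INR n) ln _ (Rbar_locally p_infty)).
    - replace p_infty with (Rbar_plus 1 p_infty) by reflexivity.
      apply (is_lim_seq_plus (fun _ => 1) INR 1 p_infty); [apply is_lim_seq_const|apply is_lim_seq_INR|reflexivity].
    - apply is_lim_ln_p. }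
  apply (filterlim_comp _ _ _ (fun n => Re w * ln (1 + INR n)) exp _ (Rbar_locally m_infty)).
  - assert (X := is_lim_seq_scal_l _ (Re w) _ L).
    replace (Rbar_mult (Re w) p_infty) with m_infty in X; auto.
    simpl. destruct (Rle_dec 0 (Re w)); [exfalso; lra|reflexivity].
  - apply is_lim_exp_m.
Qed.

Lemma Cneq0_Re (z : C) : Re z <> 0 -> z <> RtoC 0.
Proof. intros H E. apply H. rewrite E. reflexivity. Qed.

Lemma cont_pos_exp_ln c : cont_pos (fun x => exp (c * ln x)).
Proof. apply cont_pos_derivable. intros x Hx. auto_derive. auto. Qed.

Lemma CI_power c s : c - 1 < Re s ->
  Clim (fun n => CI (fun x => exp (c * ln x)) s 1 (1 + INR n)) (/ (s + 1 - RtoC c))%C.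
Proof.
  intros Hs. set (w := (RtoC c - (s + 1))%C).
  assert (Rw : Re w = c - (Re s + 1)) by (unfold w, Re; simpl; ring).
  assert (Nw : w <> RtoC 0) by (apply Cneq0_Re; lra).
  assert (Nw' : (s + 1 - RtoC c)%C <> RtoC 0).
  { replace (s + 1 - RtoC c)%C with (- w)%C by (unfold w; ring). intros E. apply Nw.
    replace w with (- - w)%C by ring. rewrite E. ring. }
  apply Clim_ext with (fun n => / w * cpow (1 + INR n) w - / w * 1)%C.
  - intros n. assert (X := pos_INR n).
    rewrite (CI_FTC _ _ _ _ (fun x => / w * cpow x w)%C); [now rewrite cpow_base_1|apply cont_pos_exp_ln|lra|].
    intros x Hx. apply Cder_ext with (/ w * (w * cpow x (w - 1)))%C; [|apply Cder_scal; now apply Cder_cpow].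
    rewrite <- cpow_RtoC, <- cpow_plus.
    replace (RtoC c + - (s + 2))%C with (w - 1)%C by (unfold w; ring). field. auto.
  - replace (/ (s + 1 - RtoC c))%C with (/ w * 0 - / w * 1)%C by (unfold w in *; field; split; auto).
    apply Clim_minus; [|apply Clim_const]. apply Clim_scal, cpow_lim0. lra.
Qed.

(** Half of the decay absorbs the logarithm, since [e ln x <= x^e] with [e = - Re w / 2]. *)
Lemma ln_cpow_lim0 w : Re w < 0 -> Clim (fun n => RtoC (ln (1 + INR n)) * cpow (1 + INR n) w)%C 0.
Proof.
  intros Hw. set (e := - Re w / 2).
  apply is_lim_seq_0_le with (fun n => / e * Cmod (cpow (1 + INR n) (RtoC (- e)) - 0)%C).
  - intros n. assert (X := pos_INR n). split; [apply Cmod_ge_0|].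
    assert (L := ln_ge0 (1 + INR n) ltac:(lra)).
    replace (RtoC (ln (1 + INR n)) * cpow (1 + INR n) w - 0)%C with (RtoC (ln (1 + INR n)) * cpow (1 + INR n) w)%C by ring.
    replace (cpow (1 + INR n) (RtoC (- e)) - 0)%C with (cpow (1 + INR n) (RtoC (- e))) by ring.
    rewrite Cmod_mult, Cmod_R, !Cmod_cpow, Rabs_pos_eq by auto. simpl Re.
    assert (E : e = - Re w / 2) by reflexivity.
    replace (Re w * ln (1 + INR n)) with (- e * ln (1 + INR n) + - (e * ln (1 + INR n))) by (rewrite E; field).
    rewrite exp_plus, exp_Ropp. set (y := e * ln (1 + INR n)).
    assert (He : 0 < e) by (unfold e; lra).
    assert (Y : 1 + y <= exp y) by apply exp_ge_1_plus.
    assert (P := exp_pos y). assert (Q := exp_pos (- e * ln (1 + INR n))).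
    replace (ln (1 + INR n)) with (/ e * y) at 1 by (unfold y; field; lra).
    rewrite Rmult_assoc. apply Rmult_le_compat_l; [left; now apply Rinv_0_lt_compat|].
    apply Rle_trans with (exp y * (exp (- e * ln (1 + INR n)) * / exp y)).
    + apply Rmult_le_compat_r; [|lra]. apply Rmult_le_pos; [lra|left; now apply Rinv_0_lt_compat].
    + right. field. lra.
  - replace (Finite 0) with (Finite (/ e * 0)) by (f_equal; ring).
    apply is_lim_seq_mult'; [apply is_lim_seq_const|]. apply cpow_lim0. simpl. unfold e. lra.
Qed.

Lemma CI_xlnx s : 0 < Re s ->
  Clim (fun n => CI (fun x => x * ln x) s 1 (1 + INR n)) (/ (s * s))%C.
Proof.
  intros Hs. assert (Ns : s <> RtoC 0) by (apply Cneq0_Re; lra).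
  set (Phi := fun x => (- / s * (RtoC (ln x) * cpow x (- s)) + - / (s * s) * cpow x (- s))%C).
  apply Clim_ext with (fun n => Phi (1 + INR n)%R - Phi 1)%C.
  - intros n. assert (X := pos_INR n). symmetry. apply CI_FTC; [|lra|].
    + apply cont_pos_derivable. intros x Hx. auto_derive. auto.
    + intros x Hx. unfold Phi. eapply Cder_ext; [|apply Cder_plus; [apply Cder_scal, Cder_mult_r;
        [apply is_derive_ln; auto|apply Cder_cpow; auto]|apply Cder_scal, Cder_cpow; auto]].
      rewrite !cpow_pred by auto.
      assert (E : cpow x (- (s + 2)) = (cpow x (- s) * RtoC (/ x) * RtoC (/ x))%C).
      { rewrite <- !cpow_pred by auto. f_equal. ring. }
      rewrite E, !RtoC_mult, RtoC_inv by lra.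
      assert (RtoC x <> RtoC 0) by (intros Z; apply RtoC_inj in Z; lra).
      field. auto.
  - replace (/ (s * s))%C with ((- / s * 0 + - / (s * s) * 0) - (- / s * (RtoC 0 * 1) + - / (s * s) * 1))%C by (field; auto).
    apply Clim_minus.
    + apply Clim_plus; apply Clim_scal; [apply ln_cpow_lim0|apply cpow_lim0]; change (Re (- s)) with (- Re s); lra.
    + unfold Phi. rewrite ln_1, cpow_base_1. apply Clim_const.
Qed.

(** The positive part. Writing the summands as [(x - k)_+] frees the sum from its upper limit
    [floor x] and shows its continuity. *)
Definition ppart (t : R) : R := (t + Rabs t) / 2.

Lemma ppart_pos t : 0 <= t -> ppart t = t.
Proof. intros H. unfold ppart. rewrite Rabs_pos_eq by auto. field. Qed.

Lemma ppart_neg t : t <= 0 -> ppart t = 0.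
Proof. intros H. unfold ppart. rewrite Rabs_left1 by auto. field. Qed.

Lemma continuous_ppart k x : continuous (fun x => ppart (x - k)) x.
Proof.
  unfold ppart. apply (continuous_comp (fun x => x - k) (fun t => (t + Rabs t) / 2)).
  - apply (ex_derive_continuous (fun x => x - k)). auto_derive. auto.
  - apply (continuous_mult (fun t => t + Rabs t) (fun _ => / 2)); [|apply continuous_const].
    apply (continuous_plus (fun t => t) Rabs); [apply continuous_id|apply continuous_Rabs].
Qed.

Lemma cont_pos_ppart k : cont_pos (fun x => ppart (x - k)).
Proof. intros x _. apply continuous_ppart. Qed.

(** Grouped as the integral over the whole half-line, [k^(-s)/(s(s+1))], plus a boundary term at
    [N]. *)
Lemma CI_ppart s k N : 0 < Re s -> 1 <= k <= N ->
  CI (fun x => ppart (x - k)) s 1 N =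
  (cpow k (- s) * / (s * (s + 1)) + (RtoC k * cpow N (- (s + 1)) * / (s + 1) - cpow N (- s) * / s))%C.
Proof.
  intros Hs Hk.
  assert (Ns : s <> RtoC 0) by (apply Cneq0_Re; lra).
  assert (Ns1 : (s + 1)%C <> RtoC 0) by (apply Cneq0_Re; unfold Re; simpl; unfold Re in Hs; lra).
  rewrite <- (CI_Chasles _ s 1 k N) by (try apply cont_pos_ppart; lra).
  rewrite (CI_ext (fun x => ppart (x - k)) (fun _ => 0) s 1 k), CI_zero by (try lra; intros; apply ppart_neg; lra).
  rewrite (CI_ext (fun x => ppart (x - k)) (fun x => x + - k) s k N) by (try lra; intros; rewrite ppart_pos; lra).
  rewrite (CI_FTC _ _ _ _ (fun x => - / s * cpow x (- s) + RtoC k * / (s + 1) * cpow x (- (s + 1)))%C).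
  - assert (E : cpow k (- s) = (RtoC k * cpow k (- (s + 1)))%C).
    { rewrite <- (cpow_1 k) by lra. rewrite <- cpow_plus. f_equal. ring. }
    rewrite E. field. auto.
  - apply cont_pos_derivable. intros x Hx. auto_derive. auto.
  - lra.
  - intros x Hx. eapply Cder_ext; [|apply Cder_plus; apply Cder_scal, Cder_cpow; auto].
    rewrite !cpow_pred by auto.
    assert (E : cpow x (- (s + 1)) = (cpow x (- s) * RtoC (/ x))%C).
    { rewrite <- !cpow_pred by auto. f_equal. ring. }
    assert (E2 : cpow x (- (s + 2)) = (cpow x (- s) * RtoC (/ x) * RtoC (/ x))%C).
    { rewrite <- !cpow_pred by auto. f_equal. ring. }
    rewrite E, E2, RtoC_plus, RtoC_opp, RtoC_inv by lra.
    assert (RtoC x <> RtoC 0) by (intros Z; apply RtoC_inj in Z; lra).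
    field. auto.
Qed.

(** Written exactly as the sum in [errE], so that [errE_Asum] holds by reflexivity. Besides the
    singular series it is applied to the constant 1, for the zeta function itself. *)
Definition Asum (c : nat -> R) (x : R) : R :=
  sum_n_m (fun k => (x - INR k) * c k) 1 (Z.to_nat (Int_part x)).

Lemma sum_n_m_rsum (f : nat -> R) n : sum_n_m f 1 n = rsum (fun j => f (S j)) n.
Proof.
  induction n as [|n IH]; [rewrite sum_n_m_zero by lia; reflexivity|].
  rewrite sum_n_Sm by lia. rewrite IH. reflexivity.
Qed.

Lemma floor_spec x : 0 < x -> INR (Z.to_nat (Int_part x)) <= x < INR (Z.to_nat (Int_part x)) + 1.
Proof.
  intros Hx. destruct (base_Int_part x) as [A B].
  assert (P : (-1 < Int_part x)%Z) by (apply lt_IZR; lra).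
  rewrite INR_IZR_INZ, Z2Nat.id by lia. lra.
Qed.

Lemma Asum_ppart c x N : 0 < x -> x <= INR N ->
  Asum c x = rsum (fun j => c (S j) * ppart (x - INR (S j))) N.
Proof.
  intros Hx HN. unfold Asum. rewrite sum_n_m_rsum. destruct (floor_spec x Hx) as [A B].
  set (n := Z.to_nat (Int_part x)) in *.
  assert (L : (n <= N)%nat) by (apply INR_le; lra).
  transitivity (rsum (fun j => c (S j) * ppart (x - INR (S j))) n).
  - apply rsum_ext. intros j Hj. rewrite ppart_pos; [ring|].
    assert (S j <= n)%nat by lia. apply le_INR in H. lra.
  - clear HN. induction L; auto. cbn [rsum]. rewrite IHL.
    rewrite ppart_neg; [ring|]. rewrite S_INR. apply le_INR in L. lra.
Qed.

Lemma cont_rsum (f : nat -> R -> R) n x : (forall j, continuous (f j) x) -> continuous (fun y => rsum (fun j => f j y) n) x.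
Proof.
  intros H. induction n as [|n IH]; simpl; [apply continuous_const|].
  apply (continuous_plus (fun y => rsum (fun j => f j y) n) (f n)); auto.
Qed.

Lemma cont_pos_rsum (f : nat -> R -> R) n : (forall j, cont_pos (f j)) -> cont_pos (fun y => rsum (fun j => f j y) n).
Proof. intros H x Hx. apply cont_rsum. intros; now apply H. Qed.

Lemma cont_pos_cppart (a k : R) : cont_pos (fun y => a * ppart (y - k)).
Proof. apply cont_pos_mult; [apply cont_pos_const|apply cont_pos_ppart]. Qed.

(** Within distance [min x 1] of [x] all points are positive and below [n + 1], so there [Asum] is
    one fixed finite sum of continuous functions, although the number of terms in its definition
    jumps at integers. *)
Lemma cont_pos_Asum c : cont_pos (Asum c).
Proof.
  intros x Hx. destruct (nfloor_ex (x + 1)) as [n Hn]; [lra|].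
  apply (continuous_ext_loc _ (fun y => rsum (fun j => c (S j) * ppart (y - INR (S j))) (S n))).
  - assert (P : 0 < Rmin x 1) by (apply Rmin_glb_lt; lra).
    exists (mkposreal _ P). intros y Hy. symmetry. apply Asum_ppart.
    + unfold ball in Hy; simpl in Hy; unfold AbsRing_ball, abs, minus, plus, opp in Hy; simpl in Hy.
      apply Rabs_def2 in Hy. assert (Rmin x 1 <= x) by apply Rmin_l. lra.
    + unfold ball in Hy; simpl in Hy; unfold AbsRing_ball, abs, minus, plus, opp in Hy; simpl in Hy.
      apply Rabs_def2 in Hy. assert (Rmin x 1 <= 1) by apply Rmin_r. rewrite S_INR. lra.
  - apply (cont_rsum (fun j y => c (S j) * ppart (y - INR (S j)))). intros j. now apply cont_pos_cppart.
Qed.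

Lemma CI_rsum (f : nat -> R -> R) s a b n : (forall j, cont_pos (f j)) -> 0 < a -> 0 < b ->
  CI (fun x => rsum (fun j => f j x) n) s a b = csum (fun j => CI (f j) s a b) n.
Proof.
  intros Hf Ha Hb. induction n as [|n IH]; simpl; [apply CI_zero|].
  rewrite <- IH. apply (CI_plus (fun x => rsum (fun j => f j x) n) (f n)); auto. now apply cont_pos_rsum.
Qed.

Lemma CI_Asum c s n : 0 < Re s ->
  CI (Asum c) s 1 (1 + INR n) =
  (/ (s * (s + 1)) * csum (fun j => RtoC (c (S j)) * dterm s j) (S n) +
   csum (fun j => RtoC (c (S j)) * (RtoC (INR (S j)) * cpow (1 + INR n) (- (s + 1)) * / (s + 1) - cpow (1 + INR n) (- s) * / s)) (S n))%C.
Proof.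
  intros Hs. assert (X := pos_INR n).
  rewrite (CI_ext _ (fun x => rsum (fun j => c (S j) * ppart (x - INR (S j))) (S n))).
  - rewrite (CI_rsum (fun j x => c (S j) * ppart (x - INR (S j)))) by (try lra; intros; apply cont_pos_cppart).
    rewrite <- csum_scal, <- csum_plus. apply csum_ext. intros j Hj.
    assert (L : (S j <= S n)%nat) by lia. apply le_INR in L. rewrite (S_INR n) in L.
    assert (J := INR_S_ge1 j).
    rewrite CI_scal by (try apply cont_pos_ppart; lra).
    rewrite CI_ppart by lra. unfold dterm. ring.
  - lra.
  - intros x Hx. apply Asum_ppart; rewrite ?S_INR; lra.
Qed.

(** The integral up to [N = 1 + n] is a partial sum of the Dirichlet series plus [N] boundary terms,
    each of order [N^(d - Re s)]. Together these are of order [N^(1 + d - Re s)] and vanish in the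
    limit. *)
Lemma Asum_transform c s B d F : 0 <= d -> 1 + d < Re s ->
  (forall k, (1 <= k)%nat -> Rabs (c k) <= B * exp (d * ln (INR k))) ->
  Clim (csum (fun j => RtoC (c (S j)) * dterm s j)%C) F ->
  Clim (fun n => CI (Asum c) s 1 (1 + INR n)) (F * / (s * (s + 1)))%C.
Proof.
  intros Hd Hs Hc HF.
  assert (Ns : s <> RtoC 0) by (apply Cneq0_Re; lra).
  assert (Ns1 : (s + 1)%C <> RtoC 0) by (apply Cneq0_Re; unfold Re; simpl; unfold Re in Hs; lra).
  assert (HB : 0 <= B) by (specialize (Hc 1%nat (le_n _)); simpl in Hc; rewrite ln_1, Rmult_0_r, exp_0 in Hc; generalize (Rabs_pos (c 1%nat)); lra).
  replace (F * / (s * (s + 1)))%C with (/ (s * (s + 1)) * F + 0)%C by ring.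
  eapply Clim_ext; [intros n; symmetry; apply CI_Asum; lra|].
  apply Clim_plus.
  - apply Clim_scal. apply (is_lim_seq_incr_1 (fun n => Cmod (csum _ n - F)%C)). exact HF.
  - set (K := Cmod (/ (s + 1)) + Cmod (/ s)).
    apply is_lim_seq_0_le with (fun n => (B * K) * Cmod (cpow (1 + INR n) (RtoC (1 + d - Re s)) - 0)%C).
    + intros n. assert (X := pos_INR n). split; [apply Cmod_ge_0|].
      set (N := 1 + INR n). assert (EN : INR (S n) = N) by (rewrite S_INR; unfold N; ring).
      set (q := exp (- Re s * ln N)). assert (Q0 : 0 < q) by apply exp_pos.
      replace (csum _ (S n) - 0)%C with (csum (fun j => RtoC (c (S j)) * (RtoC (INR (S j)) * cpow N (- (s + 1)) * / (s + 1) - cpow N (- s) * / s))%C (S n)) by ring.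
      replace (cpow N (RtoC (1 + d - Re s)) - 0)%C with (cpow N (RtoC (1 + d - Re s))) by ring.
      rewrite Cmod_cpow. simpl (Re (RtoC _)).
      assert (Hq : exp ((1 + d - Re s) * ln N) = N * exp (d * ln N) * q).
      { replace ((1 + d - Re s) * ln N) with (ln N + d * ln N + - Re s * ln N) by ring.
        rewrite !exp_plus, exp_ln by (unfold N; lra). reflexivity. }
      rewrite Hq. eapply Rle_trans; [apply Cmod_csum|].
      apply Rle_trans with (rsum (fun _ => B * exp (d * ln N) * (q * K)) (S n)).
      * apply rsum_le. intros j Hj. rewrite Cmod_mult, Cmod_R.
        assert (L : (S j <= S n)%nat) by lia. apply le_INR in L. rewrite EN in L.
        apply Rmult_le_compat; [apply Rabs_pos|apply Cmod_ge_0| |].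
        -- eapply Rle_trans; [apply Hc; lia|]. apply Rmult_le_compat_l; auto. apply exp_le_mono.
           apply Rmult_le_compat_l; auto. apply ln_le; auto. generalize (INR_S_ge1 j). lra.
        -- unfold Cminus. eapply Rle_trans; [apply Cmod_triangle|]. rewrite Cmod_opp, !Cmod_mult, Cmod_R, !Cmod_cpow.
           replace (Re (- (s + 1))) with (- Re s - 1) by (unfold Re; simpl; ring).
           replace (Re (- s)) with (- Re s) by reflexivity. fold q.
           assert (Hq2 : exp ((- Re s - 1) * ln N) = q * / N).
           { replace ((- Re s - 1) * ln N) with (- Re s * ln N + - ln N) by ring.
             rewrite exp_plus, exp_Ropp, exp_ln by (unfold N; lra). reflexivity. }
           rewrite Hq2, Rabs_pos_eq by apply pos_INR. unfold K. rewrite Rmult_plus_distr_l.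
           apply Rplus_le_compat_r. apply Rmult_le_compat_r; [apply Cmod_ge_0|].
           rewrite <- (Rmult_1_r q) at 2. replace (INR (S j) * (q * / N)) with (q * (INR (S j) * / N)) by ring.
           apply Rmult_le_compat_l; [lra|]. apply Rmult_le_reg_r with N; [unfold N; lra|].
           rewrite Rmult_assoc, Rinv_l by (unfold N; lra). lra.
      * assert (Ec : forall x m, rsum (fun _ => x) m = INR m * x).
        { intros x m. induction m as [|m IH]; [simpl; ring|]. rewrite S_INR. simpl. rewrite IH. ring. }
        rewrite Ec, EN. right. ring.
    + replace (Finite 0) with (Finite (B * K * 0)) by (f_equal; ring).
      apply is_lim_seq_mult'; [apply is_lim_seq_const|]. apply cpow_lim0. simpl. lra.
Qed.

(** * The zeta function on the real line *)

Lemma CI_real h s a b : CI h (RtoC s) a b = RtoC (LT h s a b).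
Proof.
  unfold CI. apply injective_projections; simpl; unfold LT.
  - apply RInt_extR. intros x _. rewrite Ropp_0, Rmult_0_l, cos_0. ring.
  - rewrite (RInt_extR _ (fun _ => 0)).
    + rewrite RInt_const. unfold scal; simpl; unfold mult; simpl; ring.
    + intros x _. rewrite Ropp_0, Rmult_0_l, sin_0. ring.
Qed.

Lemma LT_FTC h s a b (Phi : R -> R) : cont_pos h -> 0 < a <= b ->
  (forall x, 0 < x -> is_derive Phi x (h x * exp (- (s + 2) * ln x))) ->
  LT h s a b = Phi b - Phi a.
Proof.
  intros Hh Hab H. apply is_RInt_unique. apply (is_RInt_derive Phi).
  - intros x Hx. rewrite Rmin_left in Hx by lra. apply H. lra.
  - intros x Hx. rewrite Rmin_left in Hx by lra. apply cont_pos_LT; auto. lra.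
Qed.

Lemma LT_rsum (f : nat -> R -> R) s a b n : (forall j, cont_pos (f j)) -> 0 < a -> 0 < b ->
  LT (fun x => rsum (fun j => f j x) n) s a b = rsum (fun j => LT (f j) s a b) n.
Proof.
  intros Hf Ha Hb. apply RtoC_inj.
  rewrite <- CI_real, (CI_rsum f), <- csum_RtoC by auto.
  apply csum_ext. intros. apply CI_real.
Qed.

Lemma LT_power_cv c s : c - 1 < s ->
  is_lim_seq (fun n => LT (fun x => exp (c * ln x)) s 1 (1 + INR n)) (/ (s + 1 - c)).
Proof.
  intros Hs. assert (X := CI_power c (RtoC s) Hs). apply Clim_Re in X.
  replace (Re (/ (RtoC s + 1 - RtoC c))) with (/ (s + 1 - c)) in X.
  - apply is_lim_seq_ext with (fun n => Re (CI (fun x => exp (c * ln x)) (RtoC s) 1 (1 + INR n))); auto.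
    intros n. now rewrite CI_real.
  - rewrite <- RtoC_plus, <- RtoC_minus, <- RtoC_inv by lra. reflexivity.
Qed.

(* [Psi] is the antiderivative of the sawtooth function [{x} - 1/2] vanishing at integers. *)
Definition Psi (x : R) : R := (x ^ 2 - x) / 2 - Asum (fun _ => 1) x.

Lemma cont_pos_poly : cont_pos (fun x => (x ^ 2 - x) / 2).
Proof. apply cont_pos_derivable. intros x Hx. auto_derive. auto. Qed.

Lemma cont_pos_opp f : cont_pos f -> cont_pos (fun x => - f x).
Proof. intros Hf x Hx. apply (continuous_opp f); auto. Qed.

Lemma cont_pos_minus f g : cont_pos f -> cont_pos g -> cont_pos (fun x => f x - g x).
Proof. intros Hf Hg. apply (cont_pos_plus f (fun x => - g x)); auto. now apply cont_pos_opp. Qed.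

Lemma cont_pos_Psi : cont_pos Psi.
Proof. apply cont_pos_minus; [apply cont_pos_poly|apply cont_pos_Asum]. Qed.

Lemma rsum_const (c : R) n : rsum (fun _ => c) n = INR n * c.
Proof. induction n as [|n IH]; [simpl; ring|]. rewrite S_INR. cbn [rsum]. rewrite IH. ring. Qed.

Lemma rsum_INR n : rsum (fun j => INR (S j)) n = INR n * (INR n + 1) / 2.
Proof. induction n as [|n IH]; [simpl; field|]. cbn [rsum]. rewrite IH, S_INR. field. Qed.

(** With [y] the fractional part of [x], [Psi x = (y^2 - y)/2]. *)
Lemma Psi_bounds x : 0 < x -> - / 8 <= Psi x <= 0.
Proof.
  intros Hx. unfold Psi, Asum. rewrite sum_n_m_rsum. destruct (floor_spec x Hx) as [A B].
  set (n := Z.to_nat (Int_part x)) in *.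
  rewrite (rsum_ext _ (fun j => x + (-1) * INR (S j))) by (intros; ring).
  rewrite rsum_plus, rsum_scal, rsum_const, rsum_INR. set (t := INR n) in *.
  assert (0 <= (x - t - / 2) ^ 2) by apply pow2_ge_0. nra.
Qed.

(** The integral of [Psi(x) x^(-s-2)] over [[1, oo)], the remainder in the Euler-Maclaurin formula.
    It converges for [s > -1] since [Psi] is bounded. *)
Definition J (s : R) : R := real (Lim_seq (fun n => LT Psi s 1 (1 + INR n))).

Lemma LT_const_le s n : -1 < s -> LT (fun _ => / 8) s 1 (1 + INR n) <= / 8 * / (s + 1).
Proof.
  intros Hs. assert (X := pos_INR n).
  assert (L := LT_power_cv 0 s ltac:(lra)). rewrite Rminus_0_r in L.
  apply Rle_trans with (/ 8 * LT (fun x => exp (0 * ln x)) s 1 (1 + INR n)).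
  - rewrite <- LT_scal by (try apply cont_pos_exp_ln; lra). right.
    apply LT_ext; [lra|]. intros x _. rewrite Rmult_0_l, exp_0. ring.
  - apply Rmult_le_compat_l; [lra|]. apply (is_lim_seq_incr_compare _ _ L).
    intros m. apply (LT_incr (fun x => exp (0 * ln x)) s 1 m (S m)); [apply cont_pos_exp_ln|lra| |lia].
    intros; left; apply exp_pos.
Qed.

Lemma Psi_abs x : 1 <= x -> Rabs (Psi x) <= / 8.
Proof. intros Hx. destruct (Psi_bounds x); [lra|]. apply Rabs_le. lra. Qed.

Lemma J_lim s : -1 < s -> is_lim_seq (fun n => LT Psi s 1 (1 + INR n)) (J s).
Proof.
  intros Hs.
  destruct (LT_cv (fun _ => / 8) Psi 1 cont_pos_Psi (cont_pos_const _) (Rle_refl _) Psi_abs s (/ 8 * / (s + 1))) as [l Hl].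
  - intros n. now apply LT_const_le.
  - unfold J. now rewrite (is_lim_seq_unique _ _ Hl).
Qed.

Lemma ran_J s : -1 < s -> ran (fun s => RtoC (J s)) s.
Proof.
  intros Hs. apply (ran_LT (fun _ => / 8) Psi 1 cont_pos_Psi (cont_pos_const _) (Rle_refl _) Psi_abs J (-1)); auto.
  - intros t Ht. exists (/ 8 * / (t + 1)). intros n. now apply LT_const_le.
  - apply J_lim.
Qed.

Lemma J_bounds s : -1 < s -> - (/ 8 * / (s + 1)) <= J s <= 0.
Proof.
  intros Hs. assert (L := J_lim s Hs). split.
  - apply (is_lim_seq_le (fun _ => - (/ 8 * / (s + 1))) (fun n => LT Psi s 1 (1 + INR n)) (- (/ 8 * / (s + 1))) (J s)); auto.
    + intros n. assert (X := pos_INR n).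
      assert (Y := Rabs_LT_le (fun _ => / 8) Psi s 1 (1 + INR n) cont_pos_Psi (cont_pos_const _) ltac:(lra)
        (fun x Hx => Psi_abs x (proj1 Hx))).
      assert (Z := LT_const_le s n Hs). apply Rabs_le_between in Y. lra.
    + apply is_lim_seq_const.
  - apply (is_lim_seq_le (fun n => LT Psi s 1 (1 + INR n)) (fun _ => 0) (J s) 0); auto.
    + intros n. assert (X := pos_INR n).
      assert (Y := LT_ge0 (fun x => (-1) * Psi x) s 1 (1 + INR n)).
      rewrite LT_scal in Y by (try apply cont_pos_Psi; lra).
      assert (0 <= -1 * LT Psi s 1 (1 + INR n)); [|lra]. apply Y.
      * apply cont_pos_mult; [apply cont_pos_const|apply cont_pos_Psi].
      * lra.
      * intros x Hx. destruct (Psi_bounds x); lra.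
    + apply is_lim_seq_const.
Qed.

(* Equals [(s - 1) zeta(s)] for real [s > -1]; see [dzeta_real]. *)
Definition Zt (s : R) : R := (s + 1) / 2 - s * (s + 1) * (s - 1) * J s.

Lemma ran_Zt s : -1 < s -> ran (fun s => RtoC (Zt s)) s.
Proof.
  intros Hs.
  apply ran_ext with (fun x => (RtoC x + 1) * RtoC (/ 2) - RtoC x * (RtoC x + 1) * (RtoC x - 1) * RtoC (J x))%C.
  - intros x. unfold Zt. unfold Rdiv. now rewrite !RtoC_minus, !RtoC_mult, !RtoC_plus, !RtoC_minus.
  - apply ran_minus; [apply ran_mult; [apply ran_plus; [apply ran_id|apply ran_const]|apply ran_const]|].
    apply ran_mult; [|now apply ran_J].
    apply ran_mult; [|apply ran_minus; [apply ran_id|apply ran_const]].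
    apply ran_mult; [apply ran_id|apply ran_plus; [apply ran_id|apply ran_const]].
Qed.

(** For [s >= 1] the term with [J] is nonnegative because [J <= 0]. For [s < 1] the bound
    [(s+1) |J| <= 1/8] makes it at least [- s(1-s)/8], which [(s+1)/2] outweighs. Positivity permits
    division by [Zt (2s + 2)] for every [s > -1]. *)
Lemma Zt_pos s : 0 < s -> 0 < Zt s.
Proof.
  intros Hs. destruct (J_bounds s) as [A B]; [lra|]. unfold Zt.
  destruct (Rle_dec 1 s) as [H1|H1].
  - assert (0 <= s * (s + 1) * (s - 1)) by (apply Rmult_le_pos; nra). nra.
  - assert (P : 0 < s * (1 - s)) by nra.
    assert (E : / 8 * / (s + 1) * (s + 1) = / 8) by (field; lra).
    assert (Q : - / 8 <= (s + 1) * J s) by nra.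
    replace (s * (s + 1) * (s - 1) * J s) with (- ((s * (1 - s)) * ((s + 1) * J s))) by ring.
    assert (- (s * (1 - s) * / 8) <= s * (1 - s) * ((s + 1) * J s)) by nra. nra.
Qed.

Lemma Asum_1_split s n : 1 < s ->
  LT (Asum (fun _ => 1)) s 1 (1 + INR n) =
  / 2 * LT (fun x => exp (2 * ln x)) s 1 (1 + INR n) - / 2 * LT (fun x => exp (1 * ln x)) s 1 (1 + INR n) - LT Psi s 1 (1 + INR n).
Proof.
  intros Hs. assert (X := pos_INR n).
  assert (C2 := cont_pos_exp_ln 2). assert (C1 := cont_pos_exp_ln 1). assert (CP := cont_pos_Psi).
  set (e2 := fun x => exp (2 * ln x)) in *. set (e1 := fun x => exp (1 * ln x)) in *.
  assert (D2 := cont_pos_mult _ _ (cont_pos_const (/ 2)) C2).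
  assert (D1 := cont_pos_mult _ _ (cont_pos_const (- / 2)) C1).
  assert (DP := cont_pos_mult _ _ (cont_pos_const (-1)) CP).
  rewrite (LT_ext _ (fun x => (/ 2 * e2 x + (- / 2) * e1 x) + (-1) * Psi x)).
  - rewrite (LT_plus (fun x => / 2 * e2 x + (- / 2) * e1 x) (fun x => -1 * Psi x)),
      (LT_plus (fun x => / 2 * e2 x) (fun x => (- / 2) * e1 x)) by (auto; try lra; now apply cont_pos_plus).
    rewrite !LT_scal by (auto; lra). ring.
  - lra.
  - intros x Hx. unfold Psi, e1, e2. replace (2 * ln x) with (ln x + ln x) by ring.
    rewrite Rmult_1_l, exp_plus, exp_ln by lra. field.
Qed.

(** The transform of [Asum] for the constant 1 is computed twice: as [zeta(s)/(s(s+1))], and through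
    [Psi] as the transforms of [x^2/2] and [x/2] minus [J]. *)
Lemma dzeta_real s : 1 < s -> is_dzeta (RtoC s) (RtoC (Zt s / (s - 1))).
Proof.
  intros Hs. destruct (dzeta_exists (RtoC s) Hs) as [Z HZ].
  assert (T := Asum_transform (fun _ => 1) (RtoC s) 1 0 Z ltac:(lra) ltac:(simpl; lra)).
  assert (HT : Clim (fun n => CI (Asum (fun _ => 1)) (RtoC s) 1 (1 + INR n)) (Z * / (RtoC s * (RtoC s + 1)))%C).
  { apply T.
    - intros k _. rewrite Rmult_0_l, exp_0, Rabs_R1. lra.
    - eapply Clim_ext; [|apply HZ]. intros n. apply csum_ext. intros; ring. }
  assert (L : is_lim_seq (fun n => LT (Asum (fun _ => 1)) s 1 (1 + INR n)) (/ 2 * / (s + 1 - 2) - / 2 * / (s + 1 - 1) - J s)).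
  { eapply is_lim_seq_ext; [intros n; symmetry; apply Asum_1_split; lra|].
    apply is_lim_seq_minus'; [|apply J_lim; lra].
    apply is_lim_seq_minus'; apply is_lim_seq_mult'; try apply is_lim_seq_const; apply LT_power_cv; lra. }
  apply Clim_RtoC in L.
  assert (E := Clim_unique _ _ _ HT (Clim_ext _ _ _ (fun n => eq_sym (CI_real (Asum (fun _ => 1)) s 1 (1 + INR n))) L)).
  assert (Ns : RtoC s <> RtoC 0) by (intros X; apply RtoC_inj in X; lra).
  assert (Ns1 : (RtoC s + 1)%C <> RtoC 0) by (rewrite <- RtoC_plus; intros X; apply RtoC_inj in X; lra).
  replace (RtoC (Zt s / (s - 1))) with Z; auto.
  replace Z with (RtoC s * (RtoC s + 1) * (Z * / (RtoC s * (RtoC s + 1))))%C by (field; auto).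
  rewrite E, <- RtoC_plus, <- !RtoC_mult. f_equal. unfold Zt. field. lra.
Qed.

(** * The values of [J] at 0 and 1 *)

Lemma LT_ppart_0 k N : 1 <= k <= N -> LT (fun x => ppart (x - k)) 0 1 N = ln N - ln k + k / N - 1.
Proof.
  intros Hk. rewrite <- (LT_Chasles _ 0 1 k N) by (try apply cont_pos_ppart; lra).
  rewrite (LT_ext (fun x => ppart (x - k)) (fun _ => 0) 0 1 k) by (try lra; intros; apply ppart_neg; lra).
  rewrite (LT_ext (fun x => ppart (x - k)) (fun x => x - k) 0 k N) by (try lra; intros; rewrite ppart_pos; lra).
  rewrite (LT_FTC (fun _ => 0) 0 1 k (fun _ => 0)), (LT_FTC (fun x => x - k) 0 k N (fun x => ln x + k * / x)).
  - field. lra.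
  - apply cont_pos_derivable. intros x Hx. auto_derive. auto.
  - lra.
  - intros x Hx. replace (- (0 + 2) * ln x) with (- (ln x + ln x)) by ring.
    rewrite exp_Ropp, exp_plus, exp_ln by auto. auto_derive; [lra|]. field. lra.
  - apply cont_pos_const.
  - lra.
  - intros x Hx. rewrite Rmult_0_l. auto_derive; auto.
Qed.

Lemma LT_ppart_1 k N : 1 <= k <= N -> LT (fun x => ppart (x - k)) 1 1 N = / 2 * / k - / N + k / (2 * N ^ 2).
Proof.
  intros Hk. rewrite <- (LT_Chasles _ 1 1 k N) by (try apply cont_pos_ppart; lra).
  rewrite (LT_ext (fun x => ppart (x - k)) (fun _ => 0) 1 1 k) by (try lra; intros; apply ppart_neg; lra).
  rewrite (LT_ext (fun x => ppart (x - k)) (fun x => x - k) 1 k N) by (try lra; intros; rewrite ppart_pos; lra).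
  rewrite (LT_FTC (fun _ => 0) 1 1 k (fun _ => 0)), (LT_FTC (fun x => x - k) 1 k N (fun x => - / x + k / 2 * / x ^ 2)).
  - field. lra.
  - apply cont_pos_derivable. intros x Hx. auto_derive. auto.
  - lra.
  - intros x Hx. replace (- (1 + 2) * ln x) with (- (ln x + ln x + ln x)) by ring.
    rewrite exp_Ropp, !exp_plus, exp_ln by auto. auto_derive; [split; [lra|]; split; [nra|auto]|]. field. lra.
  - apply cont_pos_const.
  - lra.
  - intros x Hx. rewrite Rmult_0_l. auto_derive; auto.
Qed.

Lemma LT_Psi_expand s n : LT Psi s 1 (INR (S n)) =
  LT (fun x => (x ^ 2 - x) / 2) s 1 (INR (S n)) - rsum (fun j => LT (fun x => ppart (x - INR (S j))) s 1 (INR (S n))) (S n).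
Proof.
  assert (X := INR_S_ge1 n).
  assert (C : cont_pos (fun x => rsum (fun j => ppart (x - INR (S j))) (S n))).
  { apply cont_pos_rsum. intros j. apply cont_pos_ppart. }
  rewrite <- (LT_rsum (fun j x => ppart (x - INR (S j)))) by (try lra; intros; apply cont_pos_ppart).
  rewrite (LT_ext Psi (fun x => (x ^ 2 - x) / 2 + (-1) * rsum (fun j => ppart (x - INR (S j))) (S n))).
  - rewrite LT_plus, LT_scal by (auto; try lra; try apply cont_pos_poly; apply cont_pos_mult; auto; apply cont_pos_const). ring.
  - lra.
  - intros x Hx. unfold Psi. rewrite (Asum_ppart _ x (S n)) by lra.
    rewrite (rsum_ext (fun j => 1 * ppart (x - INR (S j))) (fun j => ppart (x - INR (S j)))) by (intros; ring). ring.
Qed.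

Definition lnfact (n : nat) : R := rsum (fun j => ln (INR (S j))) n.

Lemma LT_Psi_0 n : let N := INR (S n) in LT Psi 0 1 N = lnfact (S n) - (N + / 2) * ln N + N - 1.
Proof.
  intros N. assert (X := INR_S_ge1 n). fold N in X. unfold N. rewrite LT_Psi_expand. fold N.
  rewrite (LT_FTC (fun x => (x ^ 2 - x) / 2) 0 1 N (fun x => x / 2 - ln x / 2)).
  - rewrite (rsum_ext _ (fun j => (ln N - 1) + ((-1) * ln (INR (S j)) + / N * INR (S j)))).
    + rewrite !rsum_plus, !rsum_scal, rsum_const, rsum_INR. fold (lnfact (S n)). fold N. rewrite ln_1. field. lra.
    + intros j Hj. assert (L : (S j <= S n)%nat) by lia. apply le_INR in L. fold N in L.
      assert (Y := INR_S_ge1 j). rewrite LT_ppart_0 by lra. unfold Rdiv. ring.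
  - apply cont_pos_poly.
  - lra.
  - intros x Hx. replace (- (0 + 2) * ln x) with (- (ln x + ln x)) by ring.
    rewrite exp_Ropp, exp_plus, exp_ln by auto. auto_derive; [lra|]. field. lra.
Qed.

Lemma LT_Psi_1 n : let N := INR (S n) in
  LT Psi 1 1 N = / 2 * ln N - / 2 * rsum (fun j => / INR (S j)) (S n) + / 4 + / 4 * / N.
Proof.
  intros N. assert (X := INR_S_ge1 n). fold N in X. unfold N. rewrite LT_Psi_expand. fold N.
  rewrite (LT_FTC (fun x => (x ^ 2 - x) / 2) 1 1 N (fun x => ln x / 2 + / 2 * / x)).
  - rewrite (rsum_ext _ (fun j => - / N + (/ 2 * / INR (S j) + / (2 * N ^ 2) * INR (S j)))).
    + rewrite !rsum_plus, !rsum_scal, rsum_const, rsum_INR. fold N. rewrite ln_1. field. lra.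
    + intros j Hj. assert (L : (S j <= S n)%nat) by lia. apply le_INR in L. fold N in L.
      assert (Y := INR_S_ge1 j). rewrite LT_ppart_1 by lra. unfold Rdiv. ring.
  - apply cont_pos_poly.
  - lra.
  - intros x Hx. replace (- (1 + 2) * ln x) with (- (ln x + ln x + ln x)) by ring.
    rewrite exp_Ropp, !exp_plus, exp_ln by auto. auto_derive; [lra|]. field. lra.
Qed.

(** By [LT_Psi_1] the difference between the harmonic sum and [ln N] is [1/2 + 1/(2N)] minus twice
    the truncated integral, so the limit defining Euler's constant exists and equals
    [1/2 - 2 J(1)]. *)
Lemma J_1 : J 1 = / 4 - euler_gamma / 2.
Proof.
  assert (L := J_lim 1 ltac:(lra)).
  assert (G : is_lim_seq (fun n => sum_n_m (fun k => / INR k) 1 n - ln (INR n)) (/ 2 - 2 * J 1)).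
  { apply is_lim_seq_incr_1.
    apply is_lim_seq_ext with (fun n => (/ 2 + / 2 * / INR (S n)) - 2 * LT Psi 1 1 (1 + INR n)).
    - intros n. rewrite sum_n_m_rsum. replace (1 + INR n) with (INR (S n)) by (rewrite S_INR; ring).
      rewrite LT_Psi_1. field. generalize (INR_S_ge1 n). lra.
    - apply is_lim_seq_minus'.
      + replace (Finite (/ 2)) with (Finite (/ 2 + / 2 * 0)) by (f_equal; ring).
        apply is_lim_seq_plus'; [apply is_lim_seq_const|]. apply is_lim_seq_mult'; [apply is_lim_seq_const|].
        apply (is_lim_seq_incr_1 (fun n => / INR n)).
        replace (Finite 0) with (Rbar_inv p_infty) by reflexivity.
        apply is_lim_seq_inv; [apply is_lim_seq_INR|discriminate].
      + apply is_lim_seq_mult'; [apply is_lim_seq_const|auto]. }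
  unfold euler_gamma. rewrite (is_lim_seq_unique _ _ G). simpl. field.
Qed.

(** * Wallis's product and Stirling's constant *)

Definition wallis (n : nat) : R := RInt (fun x => sin x ^ n) 0 (PI / 2).

Lemma ex_RInt_sin_pow n a b : ex_RInt (fun x => sin x ^ n) a b.
Proof.
  apply (ex_RInt_continuous (fun x => sin x ^ n)). intros x _.
  apply (ex_derive_continuous (fun x => sin x ^ n)). auto_derive. auto.
Qed.

Lemma wallis_0 : wallis 0 = PI / 2.
Proof.
  unfold wallis. rewrite (RInt_extR _ (fun _ => 1)) by (intros; reflexivity).
  rewrite RInt_const. unfold scal; simpl; unfold mult; simpl. ring.
Qed.

Lemma wallis_1 : wallis 1 = 1.
Proof.
  unfold wallis. apply is_RInt_unique.
  replace 1 with (minus ((fun x => - cos x) (PI / 2)) ((fun x => - cos x) 0)).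
  - apply (is_RInt_derive (fun x => - cos x)).
    + intros x _. auto_derive; [auto|]. ring.
    + intros x _. apply (ex_derive_continuous (fun x => sin x ^ 1)). auto_derive. auto.
  - unfold minus, plus, opp; simpl. rewrite cos_PI2, cos_0. ring.
Qed.

(** The integrand [f] is the derivative of [sin^(n+1) cos], which vanishes at both endpoints. *)
Lemma wallis_rec n : INR (S (S n)) * wallis (S (S n)) = INR (S n) * wallis n.
Proof.
  set (f := fun x => INR (S n) * sin x ^ n - INR (S (S n)) * sin x ^ (S (S n))).
  assert (E : RInt f 0 (PI / 2) = 0).
  { apply is_RInt_unique.
    replace 0 with (minus ((fun x => sin x ^ (S n) * cos x) (PI / 2)) ((fun x => sin x ^ (S n) * cos x) 0)) at 2.
    - apply (is_RInt_derive (fun x => sin x ^ (S n) * cos x)).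
      + intros x _. unfold f. auto_derive; [auto|].
        change (match n with O => 1 | S _ => INR n + 1 end) with (INR (S n)).
        rewrite (S_INR (S n)). cbn [pow Nat.pred].
        assert (C := sin2_cos2 x). unfold Rsqr in C.
        assert (C2 : cos x * cos x = 1 - sin x * sin x) by lra.
        replace (1 * cos x * (INR (S n) * sin x ^ n) * cos x) with (INR (S n) * sin x ^ n * (cos x * cos x)) by ring.
        rewrite C2. ring.
      + intros x _. apply (ex_derive_continuous f). unfold f. auto_derive. auto.
    - unfold minus, plus, opp; simpl. rewrite cos_PI2, sin_0. ring. }
  assert (X := RInt_minus (fun x => INR (S n) * sin x ^ n) (fun x => INR (S (S n)) * sin x ^ (S (S n))) 0 (PI / 2)).
  unfold minus, plus, opp in X; cbn [AbelianGroup.opp AbelianMonoid.plus] in X.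
  assert (S1 := RInt_scal (fun x => sin x ^ n) 0 (PI / 2) (INR (S n)) (ex_RInt_sin_pow _ _ _)).
  assert (S2 := RInt_scal (fun x => sin x ^ (S (S n))) 0 (PI / 2) (INR (S (S n))) (ex_RInt_sin_pow _ _ _)).
  assert (E1 := ex_RInt_scal (fun x => sin x ^ n) 0 (PI / 2) (INR (S n)) (ex_RInt_sin_pow _ _ _)).
  assert (E2 := ex_RInt_scal (fun x => sin x ^ (S (S n))) 0 (PI / 2) (INR (S (S n))) (ex_RInt_sin_pow _ _ _)).
  specialize (X E1 E2).
  fold (wallis n) in S1. fold (wallis (S (S n))) in S2.
  assert (X' : RInt f 0 (PI / 2) = INR (S n) * wallis n - INR (S (S n)) * wallis (S (S n))).
  { assert (S1' : RInt (fun x => INR (S n) * sin x ^ n) 0 (PI / 2) = INR (S n) * wallis n) by exact S1.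
    assert (S2' : RInt (fun x => INR (S (S n)) * sin x ^ (S (S n))) 0 (PI / 2) = INR (S (S n)) * wallis (S (S n))) by exact S2.
    rewrite <- S1', <- S2'. exact X. }
  rewrite E in X'. lra.
Qed.

Lemma wallis_decr n : wallis (S n) <= wallis n.
Proof.
  apply RInt_le; try apply ex_RInt_sin_pow; [generalize PI_RGT_0; lra|].
  intros x Hx. assert (S0 : 0 <= sin x) by (apply sin_ge_0; generalize PI_RGT_0; lra).
  assert (S1 := SIN_bound x). simpl. rewrite <- (Rmult_1_l (sin x ^ n)) at 2.
  apply Rmult_le_compat_r; [now apply pow_le|lra].
Qed.

(** The Wallis quotient [4^n n!^2 / (2n)!], in the form of a product of even over odd numbers. *)
Fixpoint wq (n : nat) : R :=
  match n with O => 1 | S k => wq k * (INR (2 * k + 2) / INR (2 * k + 1)) end.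

Lemma INR_2k1 k : INR (2 * k + 1) = 2 * INR k + 1.
Proof. rewrite plus_INR, mult_INR. simpl. ring. Qed.

Lemma INR_2k2 k : INR (2 * k + 2) = 2 * INR k + 2.
Proof. rewrite plus_INR, mult_INR. simpl. ring. Qed.

Lemma wq_pos n : 0 < wq n.
Proof.
  induction n as [|n IH]; cbn [wq]; [lra|]. apply Rmult_lt_0_compat; auto.
  rewrite INR_2k1, INR_2k2. assert (X := pos_INR n). apply Rdiv_lt_0_compat; lra.
Qed.

Lemma wallis_even n : wallis (2 * n) = PI / 2 / wq n.
Proof.
  induction n as [|n IH]; [simpl (2 * 0)%nat; rewrite wallis_0; simpl; field|].
  assert (R := wallis_rec (2 * n)). replace (2 * S n)%nat with (S (S (2 * n))) by lia.
  assert (P := wq_pos n). assert (X := pos_INR n).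
  replace (S (S (2 * n))) with (2 * n + 2)%nat in * by lia. replace (S (2 * n)) with (2 * n + 1)%nat in * by lia.
  cbn [wq]. rewrite INR_2k1, INR_2k2 in *. rewrite IH in R.
  apply Rmult_eq_reg_l with (2 * INR n + 2); [|lra]. rewrite R. field. repeat split; lra.
Qed.

Lemma wallis_odd n : wallis (2 * n + 1) = wq n / (2 * INR n + 1).
Proof.
  induction n as [|n IH]; [simpl (2 * 0 + 1)%nat; rewrite wallis_1; simpl; field|].
  assert (R := wallis_rec (2 * n + 1)). replace (2 * S n + 1)%nat with (S (S (2 * n + 1))) by lia.
  assert (P := wq_pos n). assert (X := pos_INR n).
  replace (S (2 * n + 1)) with (2 * n + 2)%nat in * by lia.
  rewrite (S_INR (2 * n + 2)), INR_2k2 in R. rewrite IH in R. cbn [wq]. rewrite INR_2k1, INR_2k2, S_INR.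
  apply Rmult_eq_reg_l with (2 * INR n + 2 + 1); [|lra]. rewrite R. field. repeat split; lra.
Qed.

(** The integrals of [sin^m] decrease in [m]; comparing those for [2n], [2n + 1] and [2n + 2]
    squeezes [wq n ^ 2]. *)
Lemma wq_bounds n : PI * (2 * INR n + 1) ^ 2 / (4 * (INR n + 1)) <= wq n ^ 2 <= PI * (2 * INR n + 1) / 2.
Proof.
  assert (P := wq_pos n). assert (X := pos_INR n). assert (PI0 := PI_RGT_0).
  assert (D1 := wallis_decr (2 * n)). assert (D2 := wallis_decr (2 * n + 1)).
  replace (S (2 * n)) with (2 * n + 1)%nat in D1 by lia.
  replace (S (2 * n + 1)) with (2 * (S n))%nat in D2 by lia.
  rewrite wallis_odd, ?wallis_even in D1, D2. cbn [wq] in D2. rewrite INR_2k1, INR_2k2 in D2.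
  split.
  - apply Rmult_le_compat_r with (r := wq n * (2 * INR n + 1)) in D2; [|apply Rmult_le_pos; lra].
    replace (wq n / (2 * INR n + 1) * (wq n * (2 * INR n + 1))) with (wq n ^ 2) in D2 by (field; lra).
    eapply Rle_trans; [|apply D2]. right. field. repeat split; lra.
  - apply Rmult_le_compat_r with (r := wq n * (2 * INR n + 1)) in D1; [|apply Rmult_le_pos; lra].
    replace (wq n / (2 * INR n + 1) * (wq n * (2 * INR n + 1))) with (wq n ^ 2) in D1 by (field; lra).
    eapply Rle_trans; [apply D1|]. right. field. lra.
Qed.

Lemma lim_inv_INR_S : is_lim_seq (fun n => / INR (S n)) 0.
Proof.
  apply (is_lim_seq_incr_1 (fun n => / INR n)).
  replace (Finite 0) with (Rbar_inv p_infty) by reflexivity.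
  apply is_lim_seq_inv; [apply is_lim_seq_INR|discriminate].
Qed.

Lemma wq_lim : is_lim_seq (fun n => wq (S n) ^ 2 / INR (S n)) PI.
Proof.
  apply is_lim_seq_le_le with (fun n => PI - PI * / INR (S n)) (fun n => PI + PI * / INR (S n)).
  - intros n. destruct (wq_bounds (S n)) as [A B]. assert (X := INR_S_ge1 n). set (x := INR (S n)) in *.
    assert (P := PI_RGT_0). assert (I : 0 < / x) by (apply Rinv_0_lt_compat; lra). split.
    + apply Rmult_le_reg_r with x; [lra|]. replace (wq (S n) ^ 2 / x * x) with (wq (S n) ^ 2) by (field; lra).
      eapply Rle_trans; [|apply A]. apply Rmult_le_reg_r with (4 * (x + 1)); [lra|].
      replace ((PI - PI * / x) * x * (4 * (x + 1))) with (PI * (4 * (x - 1) * (x + 1))) by (field; lra).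
      replace (PI * (2 * x + 1) ^ 2 / (4 * (x + 1)) * (4 * (x + 1))) with (PI * (2 * x + 1) ^ 2) by (field; lra).
      apply Rmult_le_compat_l; nra.
    + apply Rmult_le_reg_r with x; [lra|]. replace (wq (S n) ^ 2 / x * x) with (wq (S n) ^ 2) by (field; lra).
      eapply Rle_trans; [apply B|]. replace ((PI + PI * / x) * x) with (PI * (x + 1)) by (field; lra). nra.
  - replace (Finite PI) with (Finite (PI - PI * 0)) by (f_equal; ring).
    apply is_lim_seq_minus'; [apply is_lim_seq_const|]. apply is_lim_seq_mult'; [apply is_lim_seq_const|apply lim_inv_INR_S].
  - replace (Finite PI) with (Finite (PI + PI * 0)) by (f_equal; ring).
    apply is_lim_seq_plus'; [apply is_lim_seq_const|]. apply is_lim_seq_mult'; [apply is_lim_seq_const|apply lim_inv_INR_S].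
Qed.

Lemma ln_wq n : ln (wq n) = 2 * INR n * ln 2 + 2 * lnfact n - lnfact (2 * n).
Proof.
  induction n as [|n IH]; [unfold lnfact; simpl; rewrite ln_1; ring|].
  assert (X := pos_INR n). cbn [wq]. rewrite ln_mult, IH by (try apply wq_pos; rewrite INR_2k1, INR_2k2; apply Rdiv_lt_0_compat; lra).
  replace (2 * S n)%nat with (S (S (2 * n))) by lia. unfold lnfact. cbn [rsum].
  replace (S (S (2 * n))) with (2 * n + 2)%nat by lia. replace (S (2 * n)) with (2 * n + 1)%nat by lia.
  rewrite ln_div, INR_2k1, INR_2k2, !S_INR by (rewrite ?INR_2k1, ?INR_2k2; lra).
  replace (2 * INR n + 2) with (2 * (INR n + 1)) by ring. rewrite ln_mult by lra. ring.
Qed.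

(** The sequence [u N = ln N! - (N + 1/2) ln N + N] tends to [k = J 0 + 1], so [2 u(N) - u(2N)] also
    tends to [k]. In that combination only the Wallis quotient remains, whose limit gives
    [k = ln(2 pi) / 2]. *)
Lemma J_0 : J 0 = ln (2 * PI) / 2 - 1.
Proof.
  assert (L := J_lim 0 ltac:(lra)). set (k := J 0 + 1).
  set (u := fun N => lnfact N - (INR N + / 2) * ln (INR N) + INR N).
  assert (Lu : is_lim_seq u k).
  { apply is_lim_seq_incr_1. apply is_lim_seq_ext with (fun n => LT Psi 0 1 (1 + INR n) + 1).
    - intros n. replace (1 + INR n) with (INR (S n)) by (rewrite S_INR; ring). rewrite LT_Psi_0. unfold u. ring.
    - apply is_lim_seq_plus'; auto. apply is_lim_seq_const. }
  assert (L2 : is_lim_seq (fun n => 2 * u (S n) - u (2 * S n)%nat) (2 * k - k)).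
  { apply is_lim_seq_minus'.
    - apply is_lim_seq_mult'; [apply is_lim_seq_const|]. now apply (is_lim_seq_incr_1 u).
    - apply (is_lim_seq_subseq u k (fun n => 2 * S n)%nat); auto.
      apply eventually_subseq. intros n. lia. }
  assert (L3 : is_lim_seq (fun n => / 2 * ln (wq (S n) ^ 2 / INR (S n)) + / 2 * ln 2) (/ 2 * ln PI + / 2 * ln 2)).
  { apply is_lim_seq_plus'; [|apply is_lim_seq_const]. apply is_lim_seq_mult'; [apply is_lim_seq_const|].
    apply (is_lim_seq_continuous ln _ PI); [|apply wq_lim].
    apply derivable_continuous_pt. exists (/ PI). apply derivable_pt_lim_ln. apply PI_RGT_0. }
  assert (E : Finite (2 * k - k) = Finite (/ 2 * ln PI + / 2 * ln 2)).
  { rewrite <- (is_lim_seq_unique _ _ L2), <- (is_lim_seq_unique _ _ L3). apply Lim_seq_ext.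
    intros n. assert (P := wq_pos (S n)). assert (X := INR_S_ge1 n).
    rewrite ln_div by (try apply pow_lt; lra).
    replace (wq (S n) ^ 2) with (wq (S n) * wq (S n)) by ring. rewrite ln_mult, ln_wq by auto.
    unfold u. rewrite mult_INR. replace (INR 2) with 2 by (simpl; ring). rewrite ln_mult by lra. field. }
  injection E. intros E'. rewrite ln_mult by (generalize PI_RGT_0; lra). unfold k in E'. lra.
Qed.

(** * Cancellation of the poles at 1 and 0 *)

Lemma RtoC_neq0 x : x <> 0 -> RtoC x <> RtoC 0.
Proof. intros H E. apply H, RtoC_inj, E. Qed.

Definition Ew (s : R) : C := (cpow 2 (RtoC s + 1) + 1)%C.

(* [K(s) = F(s) / (zeta(s) zeta(s+1))] with [F] the Dirichlet series of the singular series. *)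
Definition Kc (s : R) : C :=
  (4 * RtoC twin_C2 * calG (RtoC s) * RtoC (2 * s + 1) / (Ew s * RtoC (Zt (2 * s + 2))))%C.

Definition cE : R := 1 / 2 * (1 - euler_gamma - ln (2 * PI)).

(** The continued transform of [E] on the real line multiplied by [(s - 1) s^2], with [zeta]
    replaced by [Zt] so that no pole occurs for [s > -1]. The polynomial comes from the subtracted
    terms [x^2/2], [- x log x / 2] and [cE x]. *)
Definition Ptil (s : R) : C :=
  (Kc s * RtoC (Zt s) * RtoC (Zt (s + 1)) / RtoC (s + 1) -
   RtoC (s ^ 2 / 2 - (s - 1) / 2 + cE * s * (s - 1)))%C.

Lemma Ew_neq0 s : -1 < s -> Ew s <> RtoC 0.
Proof. intros Hs. unfold Ew. apply (cpow_plus_one_neq0 2 (RtoC s)); [lra|exact Hs]. Qed.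

Lemma ran_Ew s : ran Ew s.
Proof.
  unfold Ew. apply ran_plus; [|apply ran_const].
  apply ran_ext with (fun x => cpow 2 (1 * x + 1, 0)); [|apply ran_cpow].
  intros x. f_equal. apply injective_projections; simpl; ring.
Qed.

Lemma ran_lin a b s : ran (fun x => RtoC (a * x + b)) s.
Proof.
  apply ran_ext with (fun x => RtoC a * RtoC x + RtoC b)%C.
  - intros x. now rewrite RtoC_plus, RtoC_mult.
  - apply ran_plus; [apply ran_mult; [apply ran_const|apply ran_id]|apply ran_const].
Qed.

Lemma ran_lin' b s : ran (fun x => RtoC (x + b)) s.
Proof. apply ran_ext with (fun x => RtoC (1 * x + b)); [intros; f_equal; ring|apply ran_lin]. Qed.

Lemma Zt_neq0 s : 0 < s -> RtoC (Zt s) <> RtoC 0.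
Proof. intros Hs. apply RtoC_neq0, Rgt_not_eq, Zt_pos, Hs. Qed.

Lemma ran_Kc s : -1 < s -> ran Kc s.
Proof.
  intros Hs. unfold Kc. apply ran_div.
  - apply ran_mult; [apply ran_mult; [apply ran_const|]|apply ran_lin].
    apply (ran_calG 0 s Hs).
  - apply ran_mult; [apply ran_Ew|].
    apply (ran_affine (fun s => RtoC (Zt s)) 2 2); [lra|]. apply ran_Zt. lra.
  - apply Cmult_neq_0; [now apply Ew_neq0|]. apply Zt_neq0. lra.
Qed.

Lemma ran_Ptil s : -1 < s -> ran Ptil s.
Proof.
  intros Hs. unfold Ptil. apply ran_minus.
  - apply ran_div; [|apply ran_lin'|apply RtoC_neq0; lra].
    apply ran_mult; [apply ran_mult; [now apply ran_Kc|now apply ran_Zt]|].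
    apply (ran_shift (fun s => RtoC (Zt s)) 1). apply ran_Zt. lra.
  - apply ran_ext with (fun x => (RtoC x * RtoC x * RtoC (/ 2) - RtoC (x + - 1) * RtoC (/ 2)) + RtoC (cE * x + 0) * RtoC (x + - 1))%C.
    + intros x. rewrite <- !RtoC_mult, <- RtoC_minus, <- RtoC_plus. f_equal. field.
    + apply ran_plus; [apply ran_minus|].
      * apply ran_mult; [apply ran_mult; apply ran_id|apply ran_const].
      * apply ran_mult; [apply ran_lin'|apply ran_const].
      * apply ran_mult; [apply ran_lin|apply ran_lin'].
Qed.

Lemma Zt_0 : Zt 0 = / 2.
Proof. unfold Zt. field. Qed.

Lemma Zt_1 : Zt 1 = 1.
Proof. unfold Zt. field. Qed.

Lemma Ptil_1 : Ptil 1 = RtoC 0.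
Proof.
  assert (Z2 := dzeta_real 2 ltac:(lra)). assert (Z4 := dzeta_real 4 ltac:(lra)).
  assert (E := K_at_1 _ _ Z2 Z4).
  assert (N2 := Zt_neq0 2 ltac:(lra)). assert (N4 := Zt_neq0 4 ltac:(lra)).
  assert (NE := Ew_neq0 1 ltac:(lra)).
  replace (Zt 2 / (2 - 1)) with (Zt 2) in E by field.
  replace (Zt 4 / (4 - 1)) with (/ 3 * Zt 4) in E by field.
  fold (Ew 1) in E. rewrite RtoC_mult in E.
  unfold Ptil, Kc. replace (2 * 1 + 2) with 4 by ring. replace (1 + 1) with 2 by ring.
  replace (2 * 1 + 1) with 3 by ring. rewrite Zt_1.
  replace (1 ^ 2 / 2 - (1 - 1) / 2 + cE * 1 * (1 - 1)) with (/ 2) by field.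
  assert (E2 : (4 * RtoC twin_C2 * calG (RtoC 1))%C = (RtoC (/ 3) * RtoC (Zt 4) * Ew 1 / RtoC (Zt 2))%C).
  { rewrite <- E. field. auto. }
  rewrite E2, !RtoC_inv by lra.
  assert (RtoC 3 <> RtoC 0) by (apply RtoC_neq0; lra). assert (RtoC 2 <> RtoC 0) by (apply RtoC_neq0; lra).
  field. auto.
Qed.

Lemma Kc_near_0 s : 0 <= s -> Cmod (Kc s - 1)%C <= 192 * s ^ 2.
Proof.
  intros Hs. assert (Z := dzeta_real (2 * s + 2) ltac:(lra)).
  replace (RtoC (2 * s + 2)) with (2 * RtoC s + 2)%C in Z by now rewrite RtoC_plus, RtoC_mult.
  assert (B := K_near_0 s _ Hs Z). fold (Ew s) in B.
  set (z := Zt (2 * s + 2) / (2 * s + 2 - 1)) in *.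
  assert (P := Zt_pos (2 * s + 2) ltac:(lra)).
  assert (NZ : RtoC z <> RtoC 0).
  { apply RtoC_neq0. unfold z. apply Rgt_not_eq, Rdiv_lt_0_compat; lra. }
  assert (NE := Ew_neq0 s ltac:(lra)).
  assert (Ez : RtoC (Zt (2 * s + 2)) = (RtoC z * RtoC (2 * s + 1))%C).
  { rewrite <- RtoC_mult. f_equal. unfold z. field. lra. }
  assert (N1 : RtoC (2 * s + 1) <> RtoC 0) by (apply RtoC_neq0; lra).
  replace (Kc s - 1)%C with ((4 * RtoC twin_C2 * calG (RtoC s) - RtoC z * Ew s) / (RtoC z * Ew s))%C.
  - rewrite Cmod_div by now apply Cmult_neq_0.
    assert (0 < Cmod (RtoC z * Ew s)%C) by (apply Cmod_gt_0; now apply Cmult_neq_0).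
    apply Rmult_le_reg_r with (Cmod (RtoC z * Ew s)%C); auto.
    unfold Rdiv. rewrite Rmult_assoc, Rinv_l by lra. lra.
  - unfold Kc. rewrite Ez. field. auto.
Qed.

Lemma Kc_0 : Kc 0 = RtoC 1.
Proof.
  apply Cminus_eq0. apply Rle_antisym; [|apply Cmod_ge_0].
  eapply Rle_trans; [apply Kc_near_0; lra|]. right. ring.
Qed.

Lemma Ptil_0 : Ptil 0 = RtoC 0.
Proof.
  unfold Ptil. rewrite Kc_0, Zt_0. replace (0 + 1) with 1 by ring. rewrite Zt_1.
  replace (0 ^ 2 / 2 - (0 - 1) / 2 + cE * 0 * (0 - 1)) with (/ 2) by field.
  rewrite RtoC_inv by lra. field.
Qed.

Lemma J_cont s (u : nat -> R) : -1 < s -> is_lim_seq u 0 -> is_lim_seq (fun n => J (s + u n)) (J s).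
Proof.
  intros Hs Hu. assert (X := ran_cont (fun s => RtoC (J s)) s u (ran_J s Hs) Hu).
  apply Clim_Re in X. exact X.
Qed.

(** The derivative at 0 vanishes: [Kc - 1] is of second order and drops out, and the linear terms of
    the two zeta factors cancel against [cE]. Here the constant [1 - gamma - log(2 pi)] in [E] is
    decisive. *)
Lemma Ptil_slope_0 : Clim (fun n => Ptil (/ INR (S n)) / RtoC (/ INR (S n)))%C 0.
Proof.
  set (u := fun n => / INR (S n)). assert (Lu : is_lim_seq u 0) by apply lim_inv_INR_S.
  assert (U : forall n, 0 < u n <= 1).
  { intros n. assert (X := INR_S_ge1 n). split; [apply Rinv_0_lt_compat; lra|].
    rewrite <- Rinv_1. apply Rinv_le_contravar; lra. }
  (* [a] and [b] are the difference quotients of [Zt] at 0 and at 1. *)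
  set (a := fun n => / 2 - (u n + 1) * (u n - 1) * J (0 + u n)).
  set (b := fun n => / 2 - (1 + u n) * (2 + u n) * J (1 + u n)).
  assert (Ju := J_cont 0 u ltac:(lra) Lu). assert (J1u := J_cont 1 u ltac:(lra) Lu).
  assert (Lc : forall c : R, is_lim_seq (fun _ => c) c) by (intros; apply is_lim_seq_const).
  assert (La : is_lim_seq a (/ 2 - (0 + 1) * (0 - 1) * J 0)).
  { apply is_lim_seq_minus'; [apply Lc|]. apply is_lim_seq_mult'; auto.
    apply is_lim_seq_mult'; [apply is_lim_seq_plus'|apply is_lim_seq_minus']; auto. }
  assert (Lb : is_lim_seq b (/ 2 - (1 + 0) * (2 + 0) * J 1)).
  { apply is_lim_seq_minus'; [apply Lc|]. apply is_lim_seq_mult'; auto.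
    apply is_lim_seq_mult'; apply is_lim_seq_plus'; auto. }
  assert (Za : forall n, Zt (u n) = / 2 + u n * a n).
  { intros n. unfold Zt, a. rewrite Rplus_0_l. field. }
  assert (Zb : forall n, Zt (u n + 1) = 1 + u n * b n).
  { intros n. unfold Zt, b. replace (u n + 1) with (1 + u n) by ring. field. }
  (* [q n - (u n + 1) P(u n)], with [P] the polynomial in [Ptil], equals [u n * r n]. The limit of
     [r] is [J 0 - J 1 + 3/4 + cE], which is 0 by the values of [J]. *)
  set (r := fun n => a n + b n * / 2 + u n * (a n * b n) + u n * / 2 - u n * (u n + 1) * / 2 - cE * (u n * u n - 1)).
  assert (Lr : is_lim_seq r 0).
  { replace (Finite 0) with (Finite ((/ 2 - (0 + 1) * (0 - 1) * J 0) + (/ 2 - (1 + 0) * (2 + 0) * J 1) * / 2 +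
      0 * ((/ 2 - (0 + 1) * (0 - 1) * J 0) * (/ 2 - (1 + 0) * (2 + 0) * J 1)) + 0 * / 2 - 0 * (0 + 1) * / 2 - cE * (0 * 0 - 1))).
    2:{ f_equal. rewrite J_0, J_1. unfold cE. field. }
    apply is_lim_seq_minus'; [apply is_lim_seq_minus'; [apply is_lim_seq_plus'; [apply is_lim_seq_plus'|]|]|].
    - apply is_lim_seq_plus'; [exact La|]. apply is_lim_seq_mult'; [exact Lb|apply Lc].
    - apply is_lim_seq_mult'; [exact Lu|]. apply is_lim_seq_mult'; [exact La|exact Lb].
    - apply is_lim_seq_mult'; [exact Lu|apply Lc].
    - apply is_lim_seq_mult'; [|apply Lc]. apply is_lim_seq_mult'; [exact Lu|].
      apply is_lim_seq_plus'; [exact Lu|apply Lc].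
    - apply is_lim_seq_mult'; [apply Lc|]. apply is_lim_seq_minus'; [|apply Lc].
      apply is_lim_seq_mult'; exact Lu. }
  set (q := fun n => (/ 2 + u n * a n) * (1 + u n * b n)).
  assert (Lq : is_lim_seq q ((/ 2 + 0 * (/ 2 - (0 + 1) * (0 - 1) * J 0)) * (1 + 0 * (/ 2 - (1 + 0) * (2 + 0) * J 1)))).
  { apply is_lim_seq_mult'; (apply is_lim_seq_plus'; [apply Lc|]); apply is_lim_seq_mult'; auto. }
  assert (E : forall n, (Ptil (u n) / RtoC (u n))%C =
     (((Kc (u n) - 1) * RtoC (q n) / RtoC (u n) + RtoC (r n)) / RtoC (u n + 1))%C).
  { intros n. unfold Ptil. rewrite Za, Zb. specialize (U n).
    assert (N1 : RtoC (u n) <> RtoC 0) by (apply RtoC_neq0; lra).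
    assert (N2 : RtoC (u n + 1) <> RtoC 0) by (apply RtoC_neq0; lra).
    replace (u n ^ 2 / 2 - (u n - 1) / 2 + cE * u n * (u n - 1)) with ((q n - u n * r n) / (u n + 1)).
    2:{ unfold q, r. field. lra. }
    rewrite RtoC_div, RtoC_minus, (RtoC_mult (u n) (r n)) by lra. unfold q. rewrite RtoC_mult. field. auto. }
  eapply Clim_ext; [intros n; symmetry; apply E|].
  replace (RtoC 0) with ((0 + RtoC 0) / RtoC (0 + 1))%C.
  2:{ rewrite Rplus_0_l. field. }
  apply Clim_mult.
  - apply Clim_plus; [|now apply Clim_RtoC].
    apply is_lim_seq_0_le with (fun n => 192 * u n * Rabs (q n)).
    + intros n. split; [apply Cmod_ge_0|]. specialize (U n).
      replace ((Kc (u n) - 1) * RtoC (q n) / RtoC (u n) - 0)%C with ((Kc (u n) - 1) * RtoC (q n) / RtoC (u n))%C by ring.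
      rewrite Cmod_div, Cmod_mult, !Cmod_R, (Rabs_pos_eq (u n)) by (try apply RtoC_neq0; lra).
      assert (X := Kc_near_0 (u n) ltac:(lra)). assert (Y := Rabs_pos (q n)).
      apply Rmult_le_reg_r with (u n); [lra|]. unfold Rdiv. rewrite Rmult_assoc, Rinv_l by lra.
      rewrite Rmult_1_r. replace (192 * u n * Rabs (q n) * u n) with (192 * u n ^ 2 * Rabs (q n)) by ring.
      now apply Rmult_le_compat_r.
    + replace (Finite 0) with (Finite (192 * 0 * Rabs ((/ 2 + 0 * (/ 2 - (0 + 1) * (0 - 1) * J 0)) * (1 + 0 * (/ 2 - (1 + 0) * (2 + 0) * J 1))))) by (f_equal; ring).
      apply is_lim_seq_mult'; [apply is_lim_seq_mult'; auto|]. now apply (is_lim_seq_abs q (Finite _)).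
  - apply Clim_inv; [|apply RtoC_neq0; lra]. apply Clim_RtoC. apply is_lim_seq_plus'; auto.
Qed.

(** A simple zero at 1 and a double zero at 0 are divided out one at a time. The second zero at 0 is
    visible only after one division, as the limit in [Ptil_slope_0]. *)
Lemma Ptil_quotient : exists Q, (forall s, -1 < s -> ran Q s) /\
  (forall s, -1 < s -> Ptil s = (RtoC ((s - 1) * s ^ 2) * Q s)%C).
Proof.
  destruct (ran_quot Ptil (-1) 1 ltac:(lra) ran_Ptil Ptil_1) as (Q1 & R1 & E1).
  assert (Z1 : Q1 0 = RtoC 0).
  { assert (X := E1 0 ltac:(lra)). rewrite Ptil_0 in X.
    replace (Q1 0) with (- (RtoC (0 - 1) * Q1 0))%C.
    - rewrite <- X. ring.
    - replace (0 - 1) with (- (1)) by ring. rewrite RtoC_opp. ring. }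
  destruct (ran_quot Q1 (-1) 0 ltac:(lra) R1 Z1) as (Q2 & R2 & E2).
  assert (Z2 : Q2 0 = RtoC 0).
  { set (u := fun n => / INR (S n)). assert (Lu : is_lim_seq u 0) by apply lim_inv_INR_S.
    assert (U : forall n, 0 < u n) by (intros n; apply Rinv_0_lt_compat; generalize (INR_S_ge1 n); lra).
    assert (L1 : Clim (fun n => RtoC (u n - 1) * Q2 (0 + u n)%R)%C (RtoC (0 - 1) * Q2 0)%C).
    { apply Clim_mult.
      - apply Clim_RtoC. apply is_lim_seq_minus'; auto. apply is_lim_seq_const.
      - apply ran_cont; auto. apply R2. lra. }
    assert (L2 : (RtoC (0 - 1) * Q2 0)%C = RtoC 0).
    { apply (Clim_unique _ _ _ L1). eapply Clim_ext; [|apply Ptil_slope_0].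
      intros n. cbv beta. fold (u n). specialize (U n). rewrite E1, E2, Rplus_0_l, Rminus_0_r by lra.
      assert (N1 : RtoC (u n) <> RtoC 0) by (apply RtoC_neq0; lra). field. auto. }
    replace (Q2 0) with (- (RtoC (0 - 1) * Q2 0))%C.
    - rewrite L2. ring.
    - replace (0 - 1) with (- (1)) by ring. rewrite RtoC_opp. ring. }
  destruct (ran_quot Q2 (-1) 0 ltac:(lra) R2 Z2) as (Q & R & E).
  exists Q. split; auto. intros s Hs. rewrite E1, E2, E by auto.
  rewrite Rminus_0_r. replace ((s - 1) * s ^ 2) with ((s - 1) * (s * s)) by ring.
  rewrite !RtoC_mult. ring.
Qed.

(** Identifies [Q] with the transform of [E] where the Dirichlet series converges; for smaller [s],
    [Q] is the continuation that Landau's theorem asks for. *)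
Lemma real_line_identity Q s : (forall s, -1 < s -> Ptil s = (RtoC ((s - 1) * s ^ 2) * Q s)%C) -> 3 < s ->
  exists F, Clim (csum (fun n => RtoC (sing_series (S n)) * dterm (RtoC s) n)%C) F /\
   (F * / (RtoC s * (RtoC s + 1)) - RtoC (/ 2 * / (s - 1) - / 2 * / s ^ 2 + cE * / s) = Q s)%C.
Proof.
  intros HQ Hs.
  assert (Z1 := dzeta_real s ltac:(lra)). assert (Z2 := dzeta_real (s + 1) ltac:(lra)).
  assert (Z3 := dzeta_real (2 * s + 2) ltac:(lra)).
  replace (RtoC (s + 1)) with (RtoC s + 1)%C in Z2 by now rewrite RtoC_plus.
  replace (RtoC (2 * s + 2)) with (2 * RtoC s + 2)%C in Z3 by now rewrite RtoC_plus, RtoC_mult.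
  destruct (sing_series_dirichlet (RtoC s) _ _ _ Hs Z1 Z2 Z3) as (F & HF & E).
  exists F. split; auto. fold (Ew s) in E.
  assert (NE := Ew_neq0 s ltac:(lra)). assert (N3 := Zt_neq0 (2 * s + 2) ltac:(lra)).
  assert (Ns : RtoC s <> RtoC 0) by (apply RtoC_neq0; lra).
  assert (Ns1 : RtoC (s + 1) <> RtoC 0) by (apply RtoC_neq0; lra).
  assert (Nm1 : RtoC (s - 1) <> RtoC 0) by (apply RtoC_neq0; lra).
  assert (N21 : RtoC (2 * s + 1) <> RtoC 0) by (apply RtoC_neq0; lra).
  assert (EF : F = (Kc s * RtoC (Zt s) * RtoC (Zt (s + 1)) / (RtoC (s - 1) * RtoC s))%C).
  { replace (2 * s + 2 - 1) with (2 * s + 1) in E by ring. replace (s + 1 - 1) with s in E by ring.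
    rewrite !RtoC_div in E by lra. unfold Kc.
    replace F with ((F * (RtoC (Zt (2 * s + 2)) / RtoC (2 * s + 1)) * Ew s) * RtoC (2 * s + 1) / (RtoC (Zt (2 * s + 2)) * Ew s))%C by (field; auto).
    rewrite E. field. repeat split; auto. }
  assert (X := HQ s ltac:(lra)). unfold Ptil in X.
  assert (NQ : RtoC ((s - 1) * s ^ 2) <> RtoC 0) by (apply RtoC_neq0; apply Rgt_not_eq; apply Rmult_lt_0_compat; nra).
  replace (Q s) with ((RtoC ((s - 1) * s ^ 2) * Q s) / RtoC ((s - 1) * s ^ 2))%C by (field; auto).
  rewrite <- X, EF.
  replace (/ 2 * / (s - 1) - / 2 * / s ^ 2 + cE * / s) with
    ((s ^ 2 / 2 - (s - 1) / 2 + cE * s * (s - 1)) / ((s - 1) * s ^ 2)) by (field; lra).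
  rewrite (RtoC_div _ ((s - 1) * s ^ 2)) by (apply Rgt_not_eq; apply Rmult_lt_0_compat; nra).
  rewrite RtoC_mult in *. replace (s ^ 2) with (s * s) in * by ring. rewrite RtoC_mult in *.
  rewrite (RtoC_plus s 1) in Ns1. rewrite (RtoC_plus s 1). rewrite (RtoC_minus s 1) in *.
  field. repeat split; auto.
Qed.

(** * The given zeta function and the transform of E *)

Lemma csum_sum_n (a : nat -> C) n : csum a (S n) = sum_n (G := C_AbelianMonoid) a n.
Proof.
  induction n as [|n IH]; [rewrite sum_O; simpl; ring|].
  rewrite sum_Sn, <- IH. reflexivity.
Qed.

Lemma is_series_Clim (a : nat -> C) (l : C) :
  is_series (K := C_AbsRing) (V := C_NormedModule) a l -> Clim (csum a) l.
Proof.
  intros H. apply (is_lim_seq_incr_1 (fun n => Cmod (csum a n - l)%C)).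
  apply is_lim_seq_spec. intros eps.
  assert (X := proj1 (filterlim_locally_ball_norm (K := C_AbsRing) (U := C_NormedModule) _ _) H eps).
  destruct X as [N HN]. exists N. intros n Hn. specialize (HN n Hn).
  unfold ball_norm in HN. rewrite csum_sum_n, Rminus_0_r, Rabs_pos_eq by apply Cmod_ge_0.
  exact HN.
Qed.

Lemma zeta_is_dzeta zeta s : is_riemann_zeta zeta -> 1 < Re s -> is_dzeta s (zeta s).
Proof. intros [_ H] Hs. apply is_series_Clim. now apply H. Qed.

Lemma Clim_csum_terms_bounded (b : nat -> C) l : Clim (csum b) l -> exists B, forall k, Cmod (b k) <= B.
Proof.
  intros H. apply Clim_Cmod in H.
  destruct (filterlim_bounded (K := R_AbsRing) (V := R_NormedModule) (fun n => Cmod (csum b n))) as [M HM].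
  { exists (Cmod l). exact H. }
  exists (M + M). intros k.
  replace (b k) with (csum b (S k) + - csum b k)%C by (simpl; ring).
  eapply Rle_trans; [apply Cmod_triangle|]. rewrite Cmod_opp.
  assert (A := HM (S k)). assert (B := HM k). unfold norm in A, B; simpl in A, B. unfold abs in A, B; simpl in A, B.
  assert (C1 := Rle_abs (Cmod (csum b k + b k)%C)). assert (C2 := Rle_abs (Cmod (csum b k))).
  simpl. lra.
Qed.

(** Convergence on the open disc bounds the terms at radius [3r/4], so at radius [r/2] they are
    dominated by a geometric series of ratio 2/3, whose sum is 3. *)
Lemma analytic_ran f x0 t : analytic_at f (x0, t) -> ran (fun x => f (x, t)) x0.
Proof.
  intros (a & r & Hr & H).
  assert (Cv : forall u, Rabs u < r -> Clim (csum (fun k => a k * RtoC (u ^ k))%C) (f (x0 + u, t))).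
  { intros u Hu. specialize (H (x0 + u, t)).
    assert (E : (((x0 + u)%R, t) - (x0, t))%C = RtoC u) by (apply injective_projections; simpl; ring).
    rewrite E in H. rewrite Cmod_R in H. specialize (H Hu). apply is_series_Clim in H.
    eapply Clim_ext; [|apply H]. intros n. apply csum_ext. intros k _.
    assert (P : pow_n (K := C_AbsRing) (RtoC u) k = RtoC (u ^ k)).
    { induction k as [|k IH]; [reflexivity|]. cbn [pow_n pow]. rewrite IH, RtoC_mult. reflexivity. }
    rewrite P, Cmult_comm. reflexivity. }
  set (q := r * (3 / 4)). set (r2 := r / 2).
  destruct (Clim_csum_terms_bounded _ _ (Cv q ltac:(unfold q; rewrite Rabs_pos_eq; lra))) as [B HB].
  exists r2, (B * 3). split; [unfold r2; lra|].
  exists a. split.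
  - intros n. apply Rle_trans with (rsum (fun k => B * (2 / 3) ^ k) n).
    + apply rsum_le. intros k _. specialize (HB k). rewrite Cmod_mult, Cmod_R in HB.
      assert (Q : 0 < q ^ k) by (apply pow_lt; unfold q; lra).
      rewrite Rabs_pos_eq in HB by lra.
      replace r2 with (q * (2 / 3)) by (unfold q, r2; field).
      rewrite Rpow_mult_distr, <- Rmult_assoc. apply Rmult_le_compat_r; auto. apply pow_le; lra.
    + rewrite rsum_scal. apply Rmult_le_compat_l.
      * eapply Rle_trans; [apply Cmod_ge_0|apply (HB 0%nat)].
      * eapply Rle_trans; [apply rsum_geom_le; lra|]. right. field.
  - intros u Hu. apply Cv. unfold r2 in Hu. lra.
Qed.

Lemma zeta_ran zeta x0 t : is_riemann_zeta zeta -> t <> 0 -> ran (fun x => zeta (x, t)) x0.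
Proof.
  intros [H _] Ht. apply analytic_ran. apply H. intros E. apply Ht. now injection E.
Qed.

Lemma C_derive_first_order f x0 t (c : C) L d : 0 < d -> 0 <= L ->
  (forall u, Rabs u <= d -> Cmod (f ((x0 + u)%R, t) - f (x0, t) - RtoC u * c)%C <= L * u ^ 2) ->
  C_derive f (x0, t) = c.
Proof.
  intros Hd HL H.
  assert (Q : forall x, x <> x0 -> Rabs (x - x0) <= d ->
     Cmod ((f (x, t) - f (x0, t)) / ((x, t) - (x0, t)) - c)%C <= L * Rabs (x - x0)).
  { intros x Hx Hxd. specialize (H (x - x0) Hxd). replace (x0 + (x - x0)) with x in H by ring.
    replace ((x, t) - (x0, t))%C with (RtoC (x - x0)) by (apply injective_projections; simpl; ring).
    assert (N : RtoC (x - x0) <> RtoC 0) by (apply RtoC_neq0; lra).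
    replace ((f (x, t) - f (x0, t)) / RtoC (x - x0) - c)%C with
      ((f (x, t) - f (x0, t) - RtoC (x - x0) * c) / RtoC (x - x0))%C by (field; auto).
    rewrite Cmod_div, Cmod_R by auto. assert (P : 0 < Rabs (x - x0)) by (apply Rabs_pos_lt; lra).
    apply Rmult_le_reg_r with (Rabs (x - x0)); auto. unfold Rdiv. rewrite Rmult_assoc, Rinv_l, Rmult_1_r by lra.
    eapply Rle_trans; [apply H|]. rewrite <- pow2_abs. right. ring. }
  (* [pr] stands for either coordinate, since the limit behind [C_derive] is taken separately in the
     real and imaginary parts. *)
  assert (Lim1 : forall pr : C -> R, (forall z, Rabs (pr z) <= Cmod z) -> (forall z w, pr (z - w)%C = pr z - pr w) ->
     real (Lim (fun x => pr ((f (x, t) - f (x0, t)) / ((x, t) - (x0, t)))%C) x0) = pr c).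
  { intros pr P1 P2. apply (f_equal real (y := Finite (pr c))). apply is_lim_unique. apply is_lim_spec. intros eps.
    assert (He : 0 < Rmin d (eps / (L + 1))).
    { apply Rmin_glb_lt; auto. apply Rdiv_lt_0_compat; [apply cond_pos|lra]. }
    exists (mkposreal _ He). intros x Hx Hn.
    change (Rabs (x - x0) < Rmin d (eps / (L + 1))) in Hx. rewrite <- P2.
    assert (X1 := Rmin_l d (eps / (L + 1))). assert (X2 := Rmin_r d (eps / (L + 1))).
    eapply Rle_lt_trans; [apply P1|]. eapply Rle_lt_trans; [apply Q; auto; lra|].
    assert (Y := Rabs_pos (x - x0)).
    apply Rle_lt_trans with ((L + 1) * Rabs (x - x0)); [nra|].
    replace (pos eps) with ((L + 1) * (eps / (L + 1))) by (field; lra).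
    apply Rmult_lt_compat_l; lra. }
  unfold C_derive, C_lim. apply injective_projections; simpl fst; simpl snd.
  - apply (Lim1 fst).
    + apply Rabs_Re_le.
    + intros z w. simpl. ring.
  - apply (Lim1 snd).
    + apply Rabs_Im_le.
    + intros z w. simpl. ring.
Qed.

(* Rotating the integral onto the positive axis gives the sharp constant 1, which the comparison
   of residues needs. *)
Lemma CI_Cmod_le h s a b : cont_pos h -> 0 < a <= b -> (forall x, a <= x <= b -> 0 <= h x) ->
  Cmod (CI h s a b) <= LT h (Re s) a b.
Proof.
  intros Hh Hab H0. set (z := CI h s a b).
  assert (G0 : 0 <= LT h (Re s) a b) by now apply LT_ge0.
  destruct (Req_dec (Cmod z) 0) as [E|N]; [lra|].
  assert (P : 0 < Cmod z) by (generalize (Cmod_ge_0 z); lra).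
  set (al := Re z / Cmod z). set (be := Im z / Cmod z).
  assert (E2 : Re z ^ 2 + Im z ^ 2 = Cmod z ^ 2) by (symmetry; apply Cmod2_alt).
  assert (E1 : al ^ 2 + be ^ 2 = 1).
  { unfold al, be. replace ((Re z / Cmod z) ^ 2 + (Im z / Cmod z) ^ 2) with ((Re z ^ 2 + Im z ^ 2) / Cmod z ^ 2) by (field; lra).
    rewrite E2. field. lra. }
  assert (Cc := cont_pos_mult _ _ Hh (cont_pos_cos (Im s))). assert (Cs := cont_pos_mult _ _ Hh (cont_pos_sin (Im s))).
  assert (E3 : Cmod z = LT (fun x => al * (h x * cos (- Im s * ln x)) + be * (h x * sin (- Im s * ln x))) (Re s) a b).
  { rewrite (LT_plus (fun x => al * (h x * cos (- Im s * ln x))) (fun x => be * (h x * sin (- Im s * ln x)))).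
    - rewrite !LT_scal by (auto; lra). change (Cmod z = al * Re z + be * Im z). unfold al, be.
      replace (Re z / Cmod z * Re z + Im z / Cmod z * Im z) with ((Re z ^ 2 + Im z ^ 2) / Cmod z) by (field; lra).
      rewrite E2. field. lra.
    - apply cont_pos_mult; auto. apply cont_pos_const.
    - apply cont_pos_mult; auto. apply cont_pos_const.
    - lra.
    - lra. }
  rewrite E3. apply LT_le; auto.
  - apply cont_pos_plus; apply cont_pos_mult; auto; apply cont_pos_const.
  - intros x Hx. specialize (H0 x Hx). set (c := cos (- Im s * ln x)). set (t := sin (- Im s * ln x)).
    assert (E4 : t * t + c * c = 1) by apply sin2_cos2.
    assert (al * c + be * t <= 1).
    { assert (0 <= (al - c) ^ 2) by apply pow2_ge_0. assert (0 <= (be - t) ^ 2) by apply pow2_ge_0. nra. }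
    replace (al * (h x * c) + be * (h x * t)) with (h x * (al * c + be * t)) by ring. nra.
Qed.

Lemma errE_Asum x : errE x = Asum sing_series x - 1 / 2 * x ^ 2 + 1 / 2 * x * ln x - cE * x.
Proof. reflexivity. Qed.

Definition hdiff (e C x : R) : R := C * exp (/ 4 * ln x) - e * errE x.

(** [hdiff] rewritten, for [x > 0], as a combination of [exp (c * ln x)], [x * ln x] and [Asum],
    each of which has a known transform. *)
Definition hmain (e C x : R) : R :=
  C * exp (/ 4 * ln x) +
  (- e * Asum sing_series x + (e / 2 * exp (2 * ln x) + (- (e / 2) * (x * ln x) + e * cE * exp (1 * ln x)))).

Lemma hdiff_eq e C x : 0 < x -> hdiff e C x = hmain e C x.
Proof.
  intros Hx. unfold hdiff, hmain. rewrite errE_Asum.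
  replace (2 * ln x) with (ln x + ln x) by ring. rewrite Rmult_1_l, exp_plus, exp_ln by auto. field.
Qed.

Lemma cont_pos_xlnx : cont_pos (fun x => x * ln x).
Proof. apply cont_pos_derivable. intros x Hx. auto_derive. auto. Qed.

Lemma cont_pos_cmul c f : cont_pos f -> cont_pos (fun x => c * f x).
Proof. intros H. apply cont_pos_mult; auto. apply cont_pos_const. Qed.

Lemma cont_pos_hmain e C : cont_pos (hmain e C).
Proof.
  unfold hmain.
  assert (A := cont_pos_cmul C _ (cont_pos_exp_ln (/ 4))).
  assert (B := cont_pos_cmul (- e) _ (cont_pos_Asum sing_series)).
  assert (D := cont_pos_cmul (e / 2) _ (cont_pos_exp_ln 2)).
  assert (E := cont_pos_cmul (- (e / 2)) _ cont_pos_xlnx).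
  assert (F := cont_pos_cmul (e * cE) _ (cont_pos_exp_ln 1)).
  exact (cont_pos_plus _ _ A (cont_pos_plus _ _ B (cont_pos_plus _ _ D (cont_pos_plus _ _ E F)))).
Qed.

(** The rational part of the transform of [hmain]: poles at [-3/4], at 1, and at 0, the last one
    double because of [x log x]. *)
Definition Rterm (e C : R) (s : Complex.C) : Complex.C :=
  (RtoC C * / (s + 1 - RtoC (/ 4)) +
   (RtoC (e / 2) * / (s + 1 - RtoC 2) + (RtoC (- (e / 2)) * / (s * s) + RtoC (e * cE) * / (s + 1 - RtoC 1))))%C.

Lemma CI_hmain e C s F : 3 < Re s ->
  Clim (csum (fun n => RtoC (sing_series (S n)) * dterm s n)%C) F ->
  Clim (fun n => CI (hmain e C) s 1 (1 + INR n)) (Rterm e C s + RtoC (- e) * (F * / (s * (s + 1))))%C.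
Proof.
  intros Hs HF.
  assert (A0 := cont_pos_exp_ln (/ 4)). assert (B0 := cont_pos_Asum sing_series).
  assert (D0 := cont_pos_exp_ln 2). assert (E0 := cont_pos_xlnx). assert (F0 := cont_pos_exp_ln 1).
  assert (A := cont_pos_cmul C _ A0). assert (B := cont_pos_cmul (- e) _ B0).
  assert (D := cont_pos_cmul (e / 2) _ D0). assert (E := cont_pos_cmul (- (e / 2)) _ E0).
  assert (F' := cont_pos_cmul (e * cE) _ F0).
  cbv beta in A, B, D, E, F'.
  assert (EF := cont_pos_plus _ _ E F'). assert (DEF := cont_pos_plus _ _ D EF). assert (BDEF := cont_pos_plus _ _ B DEF).
  cbv beta in EF, DEF, BDEF.
  apply Clim_ext with (fun n =>
    RtoC C * CI (fun x => exp (/ 4 * ln x)) s 1 (1 + INR n) +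
    (RtoC (- e) * CI (Asum sing_series) s 1 (1 + INR n) +
     (RtoC (e / 2) * CI (fun x => exp (2 * ln x)) s 1 (1 + INR n) +
      (RtoC (- (e / 2)) * CI (fun x => (x * ln x)%R) s 1 (1 + INR n) +
       RtoC (e * cE) * CI (fun x => exp (1 * ln x)) s 1 (1 + INR n)))))%C.
  { intros n. assert (X := pos_INR n). assert (H1 : 0 < 1) by lra. assert (H2 : 0 < 1 + INR n) by lra.
    unfold hmain. rewrite (CI_plus _ _ s 1 (1 + INR n) A BDEF H1 H2), (CI_plus _ _ s 1 (1 + INR n) B DEF H1 H2),
     (CI_plus _ _ s 1 (1 + INR n) D EF H1 H2), (CI_plus _ _ s 1 (1 + INR n) E F' H1 H2).
    rewrite !CI_scal by auto. reflexivity. }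
  unfold Rterm.
  match goal with |- Clim _ ?l => replace l with
    (RtoC C * / (s + 1 - RtoC (/ 4)) +
    (RtoC (- e) * (F * / (s * (s + 1))) +
     (RtoC (e / 2) * / (s + 1 - RtoC 2) +
      (RtoC (- (e / 2)) * / (s * s) +
       RtoC (e * cE) * / (s + 1 - RtoC 1)))))%C by ring end.
  apply Clim_plus; [apply Clim_scal, CI_power; lra|].
  apply Clim_plus; [apply Clim_scal|].
  { apply (Asum_transform sing_series s (2 * Rabs twin_C2) 1); auto; try lra.
    intros k Hk. rewrite Rmult_1_l, exp_ln by (apply lt_0_INR; lia). now apply sing_series_bound. }
  apply Clim_plus; [apply Clim_scal, CI_power; lra|].
  apply Clim_plus; [apply Clim_scal, CI_xlnx; lra|apply Clim_scal, CI_power; lra].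
Qed.

(** * The transform on the two lines *)

Lemma INR_shift k n : 1 + INR (k + n) = 1 + INR k + INR n.
Proof. rewrite plus_INR. ring. Qed.

Lemma Clim_half_line h s k l : cont_pos h ->
  Clim (fun n => CI h s 1 (1 + INR n)) l ->
  Clim (fun n => CI h s (1 + INR k) (1 + INR k + INR n)) (l - CI h s 1 (1 + INR k))%C.
Proof.
  intros Hh H. assert (X := pos_INR k).
  apply (Clim_subseq _ _ (fun n => k + n)%nat) in H; [|intros; lia].
  eapply Clim_ext; [|apply Clim_minus; [apply H|apply (Clim_const (CI h s 1 (1 + INR k)))]].
  intros n. cbv beta. assert (Y := pos_INR n). rewrite INR_shift.
  rewrite <- (CI_Chasles h s 1 (1 + INR k) (1 + INR k + INR n)) by (auto; lra). ring.
Qed.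

(** The pole terms at 1 and 0 combine with the Dirichlet series into [- e Q], analytic for [s > -1].
    Only [C/(s + 3/4)] remains singular, so Landau's theorem reaches [-3/4]. The half-line starts at
    [1 + k] because the sign of [hmain] is known only from there on. *)
Lemma landau_real e C k : (forall x, 1 + INR k <= x -> 0 <= hmain e C x) ->
  exists Q, (forall s, -1 < s -> ran Q s) /\
  forall s, -3/4 < s -> Clim (fun n => RtoC (LT (hmain e C) s (1 + INR k) (1 + INR k + INR n)))
    (RtoC (C * / (s + 3/4)) - RtoC e * Q s - RtoC (LT (hmain e C) s 1 (1 + INR k)))%C.
Proof.
  intros H0. destruct Ptil_quotient as (Q & RQ & EQ). exists Q. split; auto.
  set (h := hmain e C) in *. assert (Hh : cont_pos h) by apply cont_pos_hmain.
  assert (X := pos_INR k).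
  apply (landau h (1 + INR k) (-3/4) 3
    (fun s => RtoC (C * / (s + 3/4)) - RtoC e * Q s - RtoC (LT h s 1 (1 + INR k)))%C); auto; [lra| |].
  - intros s Hs. apply ran_minus; [apply ran_minus|].
    + apply ran_ext_loc with (fun x => RtoC C * / RtoC (x + 3/4))%C ((s + 3/4) / 2); [lra| |].
      * intros x Hx. apply Rabs_le_between in Hx. rewrite RtoC_mult, RtoC_inv by lra. reflexivity.
      * apply ran_mult; [apply ran_const|]. apply ran_inv; [apply ran_lin'|]. apply RtoC_neq0. lra.
    + apply ran_mult; [apply ran_const|]. apply RQ. lra.
    + apply ran_LT_finite; auto. lra.
  - intros s Hs. destruct (real_line_identity Q s EQ Hs) as (F & HF & E).
    assert (L := CI_hmain e C (RtoC s) F Hs HF). fold h in L.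
    apply (Clim_half_line h (RtoC s) k) in L; auto. rewrite CI_real in L.
    apply Clim_ext with (fun n => CI h (RtoC s) (1 + INR k) (1 + INR k + INR n)); [intros; apply CI_real|].
    match type of L with Clim _ ?l => match goal with |- Clim _ ?l' => replace l' with l; auto end end.
    rewrite <- E. f_equal. unfold Rterm.
    assert (N1 : RtoC s <> RtoC 0) by (apply RtoC_neq0; lra).
    assert (E1 : (RtoC s + 1 - RtoC (/ 4))%C = RtoC (s + 3/4)) by (rewrite <- RtoC_plus, <- RtoC_minus; f_equal; field).
    assert (E2 : (RtoC s + 1 - RtoC 2)%C = RtoC (s - 1)) by (rewrite <- RtoC_plus, <- RtoC_minus; f_equal; ring).
    assert (E3 : (RtoC s + 1 - RtoC 1)%C = RtoC s) by ring.
    rewrite E1, E2, E3. rewrite <- (RtoC_mult s s), <- !RtoC_inv, <- !RtoC_mult by nra.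
    rewrite !RtoC_opp.
    replace (/ 2 * / (s - 1) - / 2 * / s ^ 2 + cE * / s) with (/ 2 * / (s - 1) - / 2 * / (s * s) + cE * / s) by (field; lra).
    replace (RtoC (- (e / 2) * / (s * s))) with (- (RtoC e * RtoC (/ 2 * / (s * s))))%C by (rewrite <- RtoC_mult, <- RtoC_opp; f_equal; field; lra).
    replace (RtoC (e / 2 * / (s - 1))) with (RtoC e * RtoC (/ 2 * / (s - 1)))%C by (rewrite <- RtoC_mult; f_equal; field; lra).
    replace (RtoC (e * cE * / s)) with (RtoC e * RtoC (cE * / s))%C by (rewrite <- RtoC_mult; f_equal; field; lra).
    rewrite RtoC_plus, RtoC_minus. ring.
Qed.

Lemma ran_CI_finite h t a s0 : cont_pos h -> 1 <= a -> ran (fun s => CI h (s, t) 1 a) s0.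
Proof.
  intros Hh Ha.
  apply ran_ext with (fun s => RtoC (LT (fun x => (h x * cos (- t * ln x))%R) s 1 a) +
     Ci * RtoC (LT (fun x => (h x * sin (- t * ln x))%R) s 1 a))%C.
  - intros s. unfold CI. apply injective_projections; simpl; ring.
  - apply ran_plus; [|apply ran_mult; [apply ran_const|]]; apply ran_LT_finite; try lra;
      apply cont_pos_mult; auto; [apply cont_pos_cos|apply cont_pos_sin].
Qed.

Lemma ran_pair a b t s0 : ran (fun s => ((a * s + b)%R, t) : C) s0.
Proof.
  apply ran_ext with (fun s => RtoC (a * s + b) + ((0, t) : C))%C.
  - intros s. apply injective_projections; simpl; ring.
  - apply ran_plus; [apply ran_lin|apply ran_const].
Qed.

(** Since [x^(-it)] has modulus 1, the nonnegative [h] dominates the integrand on every horizontal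
    line; convergence on the real line therefore gives analyticity there and the bound by the real
    transform. *)
Lemma half_line_transform h t a alpha (B : R -> R) : cont_pos h -> 1 <= a -> (forall x, a <= x -> 0 <= h x) ->
  (forall s, alpha < s -> is_lim_seq (fun n => LT h s a (a + INR n)) (B s)) ->
  exists f, (forall s, alpha < s -> ran f s) /\
    forall s, alpha < s -> Clim (fun n => CI h (s, t) a (a + INR n)) (f s) /\ Cmod (f s) <= B s.
Proof.
  intros Hh Ha H0 HB.
  set (kc := fun x => h x * cos (- t * ln x)). set (ks := fun x => h x * sin (- t * ln x)).
  assert (Cc : cont_pos kc) by (apply cont_pos_mult; auto; apply cont_pos_cos).
  assert (Cs : cont_pos ks) by (apply cont_pos_mult; auto; apply cont_pos_sin).
  assert (Hc : forall x, a <= x -> Rabs (kc x) <= h x).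
  { intros x Hx. unfold kc. rewrite Rabs_mult, (Rabs_pos_eq (h x)) by auto.
    rewrite <- (Rmult_1_r (h x)) at 2. apply Rmult_le_compat_l; auto. apply Rabs_le, COS_bound. }
  assert (Hs' : forall x, a <= x -> Rabs (ks x) <= h x).
  { intros x Hx. unfold ks. rewrite Rabs_mult, (Rabs_pos_eq (h x)) by auto.
    rewrite <- (Rmult_1_r (h x)) at 2. apply Rmult_le_compat_l; auto. apply Rabs_le, SIN_bound. }
  assert (Bd : forall s, alpha < s -> forall n, LT h s a (a + INR n) <= B s).
  { intros s Hs n. apply (is_lim_seq_incr_compare _ _ (HB s Hs)). intros m. apply LT_incr; auto. }
  destruct (choice_above alpha (fun s l => is_lim_seq (fun n => LT kc s a (a + INR n)) l)) as [f1 Hf1].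
  { intros s Hs. apply (LT_cv h kc a Cc Hh Ha Hc s (B s)). now apply Bd. }
  destruct (choice_above alpha (fun s l => is_lim_seq (fun n => LT ks s a (a + INR n)) l)) as [f2 Hf2].
  { intros s Hs. apply (LT_cv h ks a Cs Hh Ha Hs' s (B s)). now apply Bd. }
  exists (fun s => RtoC (f1 s) + Ci * RtoC (f2 s))%C. split.
  - intros s Hs. apply ran_plus; [|apply ran_mult; [apply ran_const|]].
    + apply (ran_LT h kc a Cc Hh Ha Hc f1 alpha); auto. intros; exists (B s0); now apply Bd.
    + apply (ran_LT h ks a Cs Hh Ha Hs' f2 alpha); auto. intros; exists (B s0); now apply Bd.
  - intros s Hs.
    assert (L : Clim (fun n => CI h (s, t) a (a + INR n)) (RtoC (f1 s) + Ci * RtoC (f2 s))%C).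
    { apply Clim_ext with (fun n => RtoC (LT kc s a (a + INR n)) + Ci * RtoC (LT ks s a (a + INR n)))%C.
      - intros n. unfold CI. apply injective_projections; simpl; unfold kc, ks; ring.
      - apply Clim_plus; [|apply Clim_scal]; apply Clim_RtoC; auto. }
    split; auto. apply (Clim_le _ _ _ L). intros n. assert (X := pos_INR n).
    eapply Rle_trans; [apply CI_Cmod_le; auto; [lra|]|].
    + intros x Hx. apply H0. lra.
    + simpl. now apply Bd.
Qed.

(* The identity on the line [Im s = t], with the zero of [zeta(2s+2)] kept on the left. *)
Lemma complex_line_identity zeta t e C k f : is_riemann_zeta zeta -> t <> 0 ->
  (forall s, -3/4 < s -> ran f s) ->
  (forall s, -3/4 < s -> Clim (fun n => CI (hmain e C) (s, t) (1 + INR k) (1 + INR k + INR n)) (f s)) ->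
  forall s, -3/4 < s ->
  (zeta ((2 * s + 2)%R, (2 * t)%R) * (cpow 2 ((s, t) + 1) + 1) *
     (CI (hmain e C) (s, t) 1 (1 + INR k) + f s - Rterm e C (s, t)) +
   RtoC e * (4 * RtoC twin_C2 * zeta (s, t) * zeta ((s + 1)%R, t) * calG (s, t) / ((s, t) * ((s, t) + 1))))%C = RtoC 0.
Proof.
  intros Hz Ht Rf Lf.
  assert (Nt : forall a b, (a, t) <> RtoC b) by (intros a b E; injection E; intros; contradiction).
  assert (Np : forall x b, (((x, t) : Complex.C) + 1 - RtoC b)%C <> RtoC 0).
  { intros x b E. apply (f_equal snd) in E. simpl in E. apply Ht. lra. }
  assert (Np1 : forall x, (((x, t) : Complex.C) + 1)%C <> RtoC 0).
  { intros x E. apply (f_equal snd) in E. simpl in E. apply Ht. lra. }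
  assert (Rid : forall s, ran (fun s => (s, t) : Complex.C) s).
  { intros s. apply ran_ext with (fun s => ((1 * s + 0)%R, t) : Complex.C); [intros; f_equal; ring|apply ran_pair]. }
  assert (Rid1 : forall s, ran (fun s => ((s, t) : Complex.C) + 1)%C s).
  { intros s. apply ran_plus; [apply Rid|apply ran_const]. }
  assert (X := pos_INR k).
  refine (ran_identity _ (-3/4) 3 _ _).
  - intros s Hs. apply ran_plus; apply ran_mult.
    + apply ran_mult.
      * apply (ran_affine (fun x => zeta (x, 2 * t)) 2 2); [lra|]. apply zeta_ran; auto.
      * apply ran_plus; [|apply ran_const].
        apply ran_ext with (fun x => cpow 2 (1 * x + 1, t)); [|apply ran_cpow].
        intros x. f_equal. apply injective_projections; simpl; ring.
    + apply ran_minus; [apply ran_plus; [|now apply Rf]|].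
      * apply ran_CI_finite; [apply cont_pos_hmain|lra].
      * unfold Rterm.
        assert (RI : forall b, ran (fun s => / (((s, t) : Complex.C) + 1 - RtoC b))%C s).
        { intros b. apply ran_inv; [|apply Np]. apply ran_minus; [apply Rid1|apply ran_const]. }
        apply ran_plus; [apply ran_mult; [apply ran_const|apply RI]|].
        apply ran_plus; [apply ran_mult; [apply ran_const|apply RI]|].
        apply ran_plus; (apply ran_mult; [apply ran_const|]); [|apply RI].
        apply ran_inv; [apply ran_mult; apply Rid|]. apply Cmult_neq_0; apply Nt.
    + apply ran_const.
    + apply ran_div.
      * apply ran_mult; [|apply ran_calG; lra].
        apply ran_mult; [apply ran_mult; [apply ran_const|now apply zeta_ran]|].
        apply (ran_shift (fun x => zeta (x, t)) 1). now apply zeta_ran.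
      * apply ran_mult; [apply Rid|apply Rid1].
      * apply Cmult_neq_0; [apply Nt|apply Np1].
  - intros s Hs. set (z := (s, t) : Complex.C).
    assert (E1 : ((s + 1)%R, t) = (z + 1)%C) by (apply injective_projections; simpl; ring).
    assert (E2 : ((2 * s + 2)%R, (2 * t)%R) = (2 * z + 2)%C) by (apply injective_projections; simpl; ring).
    rewrite E1, E2.
    destruct (sing_series_dirichlet z (zeta z) (zeta (z + 1)%C) (zeta (2 * z + 2)%C)) as (F & HF & E).
    + exact Hs.
    + apply zeta_is_dzeta; auto. simpl. lra.
    + apply zeta_is_dzeta; auto. simpl. lra.
    + apply zeta_is_dzeta; auto. simpl. lra.
    + assert (L := CI_hmain e C z F Hs HF).
      apply (Clim_half_line _ _ k) in L; [|apply cont_pos_hmain].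
      assert (Ef := Clim_unique _ _ _ (Lf s ltac:(lra)) L). fold z. rewrite Ef, <- E.
      rewrite RtoC_opp. field. split; [apply Np1|apply Nt].
Qed.

(** * Comparison of the residues *)

(** At [s = -3/4 + u] the argument [2s + 2] has real part [1/2 + 2u], whence the factor 2 in front
    of the derivative. *)
Lemma zeta_slope_cv zeta g : is_riemann_zeta zeta -> g <> 0 -> zeta (1 / 2, g) = RtoC 0 ->
  Clim (fun n => zeta ((2 * (-3/4 + / INR (S n)) + 2)%R, g) / RtoC (/ INR (S n)))%C (2 * C_derive zeta ((1 / 2)%R, g))%C.
Proof.
  intros Hz Hg H0.
  destruct (ran_first_order (fun x => zeta (x, g)) (1 / 2) (zeta_ran zeta _ g Hz Hg)) as (c & L & d & Hd & HL & H).
  rewrite (C_derive_first_order zeta (1 / 2) g c L d Hd HL H).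
  assert (Lu := lim_inv_INR_S).
  apply is_lim_seq_le_le_loc with (fun _ => 0) (fun n => 4 * L * / INR (S n)).
  - assert (X := Lu). apply is_lim_seq_spec in X. assert (Hd2 : 0 < d / 2) by lra.
    destruct (X (mkposreal _ Hd2)) as [N HN]. exists N. intros n Hn. specialize (HN n Hn).
    set (u := / INR (S n)) in *. assert (U : 0 < u) by (apply Rinv_0_lt_compat; generalize (INR_S_ge1 n); lra).
    simpl in HN. rewrite Rminus_0_r, Rabs_pos_eq in HN by lra.
    split; [apply Cmod_ge_0|].
    assert (B := H (2 * u) ltac:(rewrite Rabs_pos_eq; lra)). rewrite H0 in B.
    replace (2 * (-3 / 4 + u) + 2) with (1 / 2 + 2 * u) by field.
    assert (Nu : RtoC u <> RtoC 0) by (apply RtoC_neq0; lra).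
    replace (zeta ((1 / 2 + 2 * u)%R, g) / RtoC u - 2 * c)%C with
      ((zeta ((1 / 2 + 2 * u)%R, g) - 0 - RtoC (2 * u) * c) / RtoC u)%C by (rewrite RtoC_mult; field; auto).
    rewrite Cmod_div, Cmod_R, (Rabs_pos_eq u) by (auto; lra).
    apply Rmult_le_reg_r with u; auto. unfold Rdiv. rewrite Rmult_assoc, Rinv_l, Rmult_1_r by lra.
    eapply Rle_trans; [apply B|]. right. ring.
  - apply is_lim_seq_const.
  - replace (Finite 0) with (Finite (4 * L * 0)) by (f_equal; ring).
    apply is_lim_seq_mult'; [apply is_lim_seq_const|auto].
Qed.

Lemma coeff_c1_norm zeta g : C_derive zeta (1 / 2, g) <> RtoC 0 -> g <> 0 ->
  let s1 : C := (-3/4, g / 2) in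
  (2 * Cmod (C_derive zeta (1 / 2, g)) * Cmod (cpow 2 (s1 + 1) + 1)%C) * Cmod (coeff_c1 zeta g) =
  Cmod (4 * RtoC twin_C2 * zeta s1 * zeta (s1 + 1)%C * calG s1 / (s1 * (s1 + 1)))%C.
Proof.
  intros Hc Hg s1. unfold coeff_c1.
  assert (E : ((((1 / 2)%R, g) : Complex.C) / 2 - 1)%C = s1) by (unfold s1; apply injective_projections; simpl; field).
  rewrite E. set (c := C_derive zeta (1 / 2, g)) in *.
  assert (Nw : (cpow 2 (s1 + 1) + 1)%C <> RtoC 0) by (apply cpow_plus_one_neq0; [lra|unfold s1; simpl; lra]).
  assert (N1 : s1 <> RtoC 0) by (intros X; injection X; intros; lra).
  assert (N2 : (s1 + 1)%C <> RtoC 0).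
  { intros X. apply (f_equal snd) in X. simpl in X. apply Hg. lra. }
  replace (2 * Cmod c) with (Cmod (2 * c)%C) by (rewrite Cmod_mult, Cmod_R, Rabs_pos_eq; lra).
  rewrite <- !Cmod_mult. f_equal. field. auto.
Qed.

(** With [u = s + 3/4] the identity on the line gives [|N s| = |zeta(2s+2)/u| |W s| u |P s + f s|],
    where [zeta] is evaluated at ordinate [g], and [u |f s|] is at most [C - u Re (V s)]. As [u]
    tends to 0 the parts [P] and [V], regular at [-3/4], disappear, leaving
    [|N| <= 2 |zeta'(rho_1)| |W| C] at [s_1]. By [coeff_c1_norm] this is the claim times a positive
    constant. *)
Lemma one_sided_bound zeta g e C k : is_riemann_zeta zeta -> is_first_zero_ordinate zeta g ->
  Rabs e = 1 -> (forall x, 1 + INR k <= x -> e * errE x <= C * exp (/ 4 * ln x)) ->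
  Cmod (coeff_c1 zeta g) <= C.
Proof.
  intros Hz ([Z0 _] & Hg & _ & Hc & _) He HE.
  assert (Ng : g <> 0) by lra. set (t := g / 2). assert (Nt : t <> 0) by (unfold t; lra).
  assert (X := pos_INR k).
  assert (H0 : forall x, 1 + INR k <= x -> 0 <= hmain e C x).
  { intros x Hx. rewrite <- hdiff_eq by lra. unfold hdiff. specialize (HE x Hx). lra. }
  destruct (landau_real e C k H0) as (Q & RQ & HL).
  set (h := hmain e C) in *. assert (Hh : cont_pos h) by apply cont_pos_hmain.
  set (V := fun s => (RtoC e * Q s + RtoC (LT h s 1 (1 + INR k)))%C).
  destruct (half_line_transform h t (1 + INR k) (-3/4) (fun s => C * / (s + 3/4) - Re (V s)) Hh ltac:(lra) H0) as (f & Rf & Hf).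
  { intros s Hs. assert (Y := Clim_Re _ _ (HL s Hs)).
    match type of Y with is_lim_seq _ (Finite ?l) => replace (C * / (s + 3/4) - Re (V s)) with l; [exact Y|] end.
    unfold V, Re. simpl. ring. }
  assert (Id := complex_line_identity zeta t e C k f Hz Nt Rf (fun s Hs => proj1 (Hf s Hs))).
  replace (2 * t) with g in Id by (unfold t; field). fold h in Id.
  set (u := fun n => / INR (S n)). assert (Lu : is_lim_seq u 0) by apply lim_inv_INR_S.
  assert (U : forall n, 0 < u n) by (intros n; apply Rinv_0_lt_compat; generalize (INR_S_ge1 n); lra).
  set (s1 := (-3/4, t) : Complex.C).
  set (W := fun s => (cpow 2 (((s, t) : Complex.C) + 1) + 1)%C).
  set (N := fun s => (4 * RtoC twin_C2 * zeta (s, t) * zeta ((s + 1)%R, t) * calG (s, t) / (((s, t) : Complex.C) * (((s, t) : Complex.C) + 1)))%C).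
  set (P := fun s => (CI h (s, t) 1 (1 + INR k) - Rterm e C (s, t))%C).
  assert (Np : forall b, (s1 + 1 - RtoC b)%C <> RtoC 0).
  { intros b E. apply (f_equal snd) in E. simpl in E. apply Nt. lra. }
  assert (Np1 : (s1 + 1)%C <> RtoC 0).
  { intros E. apply (f_equal snd) in E. simpl in E. apply Nt. lra. }
  assert (Ns1 : s1 <> RtoC 0) by (intros E; injection E; intros; contradiction).
  assert (Rid : ran (fun s => (s, t) : Complex.C) (-3/4)).
  { apply ran_ext with (fun s => ((1 * s + 0)%R, t) : Complex.C); [intros; f_equal; ring|apply ran_pair]. }
  assert (Rid1 : ran (fun s => ((s, t) : Complex.C) + 1)%C (-3/4)).
  { apply ran_plus; [apply Rid|apply ran_const]. }
  assert (RW : ran W (-3/4)).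
  { apply ran_plus; [|apply ran_const].
    apply ran_ext with (fun x => cpow 2 (1 * x + 1, t)); [|apply ran_cpow].
    intros x. f_equal. apply injective_projections; simpl; ring. }
  assert (RN : ran N (-3/4)).
  { unfold N. apply ran_div.
    - apply ran_mult; [|apply ran_calG; lra].
      apply ran_mult; [apply ran_mult; [apply ran_const|now apply zeta_ran]|].
      apply (ran_shift (fun x => zeta (x, t)) 1). now apply zeta_ran.
    - apply ran_mult; [apply Rid|apply Rid1].
    - apply Cmult_neq_0; [apply Ns1|apply Np1]. }
  assert (RP : ran P (-3/4)).
  { unfold P. apply ran_minus; [apply ran_CI_finite; [auto|lra]|]. unfold Rterm.
    assert (RI : forall b, ran (fun s => / (((s, t) : Complex.C) + 1 - RtoC b))%C (-3/4)).
    { intros b. apply ran_inv; [|apply Np]. apply ran_minus; [apply Rid1|apply ran_const]. }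
    apply ran_plus; [apply ran_mult; [apply ran_const|apply RI]|].
    apply ran_plus; [apply ran_mult; [apply ran_const|apply RI]|].
    apply ran_plus; (apply ran_mult; [apply ran_const|]); [|apply RI].
    apply ran_inv; [apply ran_mult; apply Rid|]. apply Cmult_neq_0; apply Ns1. }
  assert (RV : ran V (-3/4)).
  { unfold V. apply ran_plus; [apply ran_mult; [apply ran_const|apply RQ; lra]|].
    apply ran_LT_finite; auto. lra. }
  assert (LW := Clim_Cmod _ _ (ran_cont W (-3/4) u RW Lu)).
  assert (LN := Clim_Cmod _ _ (ran_cont N (-3/4) u RN Lu)).
  assert (LP := Clim_Cmod _ _ (ran_cont P (-3/4) u RP Lu)).
  assert (LV := Clim_Re _ _ (ran_cont V (-3/4) u RV Lu)).
  assert (LZ := Clim_Cmod _ _ (zeta_slope_cv zeta g Hz Ng Z0)). fold u in LZ.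
  set (c := C_derive zeta (1 / 2, g)) in *.
  (* The factors 0 are the limits of [u n]; they stay in place so that the right side is the limit
     of its factors term by term. *)
  assert (Main : Cmod (N (-3/4)) <= Cmod (2 * c)%C * Cmod (W (-3/4)) * (0 * Cmod (P (-3/4)) + (C - 0 * Re (V (-3/4))))).
  { apply (is_lim_seq_le (fun n => Cmod (N (-3/4 + u n)))
     (fun n => Cmod (zeta ((2 * (-3/4 + u n) + 2)%R, g) / RtoC (u n))%C * Cmod (W (-3/4 + u n)) *
        (u n * Cmod (P (-3/4 + u n)) + (C - u n * Re (V (-3/4 + u n)))))
     (Cmod (N (-3/4))) (Cmod (2 * c)%C * Cmod (W (-3/4)) * (0 * Cmod (P (-3/4)) + (C - 0 * Re (V (-3/4)))))).
    - intros n. specialize (U n). set (s := -3/4 + u n) in *. assert (Hs : -3/4 < s) by (unfold s; lra).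
      assert (I := Id s Hs). destruct (Hf s Hs) as [_ Bf].
      assert (Nu : RtoC (u n) <> RtoC 0) by (apply RtoC_neq0; lra).
      (* The identity is solved for [e * N s], and [|e| = 1] removes the sign. The zeta value at
         [2s + 2] is divided only by [u n], and [u n] is restored in the last factor. *)
      assert (EN : Cmod (N s) = Cmod (zeta ((2 * s + 2)%R, g) / RtoC (u n))%C * Cmod (W s) * Cmod (RtoC (u n) * (P s + f s))%C).
      { rewrite <- !Cmod_mult. rewrite <- (Rmult_1_l (Cmod (N s))), <- He, <- Cmod_R, <- Cmod_mult, <- Cmod_opp.
        f_equal. unfold P.
        match type of I with (?a + ?b)%C = _ => assert (I2 : (- b)%C = a) end.
        { rewrite <- (Cplus_0_l (- _)%C), <- I. ring. }
        unfold N. rewrite I2. fold (W s). field. auto. }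
      rewrite EN. apply Rmult_le_compat_l; [apply Rmult_le_pos; apply Cmod_ge_0|].
      rewrite Cmod_mult, Cmod_R, Rabs_pos_eq by lra.
      apply Rle_trans with (u n * (Cmod (P s) + Cmod (f s))); [apply Rmult_le_compat_l; [lra|apply Cmod_triangle]|].
      rewrite Rmult_plus_distr_l. apply Rplus_le_compat_l.
      apply Rle_trans with (u n * (C * / (s + 3/4) - Re (V s))); [apply Rmult_le_compat_l; lra|].
      right. replace (s + 3/4) with (u n) by (unfold s; field). field. lra.
    - exact LN.
    - apply is_lim_seq_mult'; [apply is_lim_seq_mult'; [exact LZ|exact LW]|].
      apply is_lim_seq_plus'; [apply is_lim_seq_mult'; auto|].
      apply is_lim_seq_minus'; [apply is_lim_seq_const|]. apply is_lim_seq_mult'; auto. }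
  rewrite !Rmult_0_l, Rplus_0_l, Rminus_0_r, Cmod_mult, Cmod_R, Rabs_pos_eq in Main by lra.
  assert (Nm := coeff_c1_norm zeta g Hc Ng). cbv zeta in Nm. fold t in Nm. fold s1 in Nm. fold c in Nm.
  assert (E1 : ((-3/4 + 1)%R, t) = (s1 + 1)%C) by (apply injective_projections; simpl; ring).
  unfold N, W in Main. fold s1 in Main. rewrite E1, <- Nm in Main.
  assert (PW : 0 < Cmod (cpow 2 (s1 + 1) + 1)%C).
  { apply Cmod_gt_0, cpow_plus_one_neq0; [lra|unfold s1; simpl; lra]. }
  assert (Pc : 0 < Cmod c) by now apply Cmod_gt_0.
  apply Rmult_le_reg_l with (2 * Cmod c * Cmod (cpow 2 (s1 + 1) + 1)%C); auto.
  repeat apply Rmult_lt_0_compat; lra.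
Qed.

(** * From one-sided bounds on tails to limsup and liminf *)

Lemma Inf_seq_ge (u : nat -> Rbar) (c : R) : (forall n, Rbar_le c (u n)) -> Rbar_le c (Inf_seq u).
Proof.
  intros H. replace (Finite c) with (Inf_seq (fun _ => Finite c)); [now apply Inf_seq_le|].
  apply is_inf_seq_unique. intros eps. destruct eps as [e He]. split.
  - intros _. simpl. lra.
  - exists 0%nat. simpl. lra.
Qed.

Lemma Sup_seq_le_const (u : nat -> Rbar) (c : R) : (forall n, Rbar_le (u n) c) -> Rbar_le (Sup_seq u) c.
Proof.
  intros H. replace (Finite c) with (Sup_seq (fun _ => Finite c)); [now apply Sup_seq_le|].
  apply is_sup_seq_unique. intros eps. destruct eps as [e He]. split.
  - intros _. simpl. lra.
  - exists 0%nat. simpl. lra.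
Qed.

(** A finite supremum over the tail from [n] is itself an admissible [C]. The supremum cannot be
    minus infinity, since the tail contains [n], and for plus infinity the inequality is trivial. *)
Lemma LimSup_infty_ge (f : R -> R) (c : R) :
  (forall C k, (forall x, 1 + INR k <= x -> f x <= C) -> c <= C) -> Rbar_le c (LimSup_infty f).
Proof.
  intros H. apply Inf_seq_ge. intros n. set (E := fun y => exists x, INR n <= x /\ y = f x).
  destruct (Lub_Rbar_correct E) as [Ub _]. unfold is_ub_Rbar in Ub.
  destruct (Lub_Rbar E) as [C| |]; simpl; auto.
  - apply (H C n). intros x Hx. apply (Ub (f x)). exists x. split; auto. lra.
  - apply (Ub (f (INR n))). exists (INR n). split; auto. lra.
Qed.

Lemma LimInf_infty_le (f : R -> R) (c : R) :
  (forall C k, (forall x, 1 + INR k <= x -> C <= f x) -> C <= c) -> Rbar_le (LimInf_infty f) c.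
Proof.
  intros H. apply Sup_seq_le_const. intros n. set (E := fun y => exists x, INR n <= x /\ y = f x).
  destruct (Glb_Rbar_correct E) as [Lb _]. unfold is_lb_Rbar in Lb.
  destruct (Glb_Rbar E) as [C| |]; simpl; auto.
  - apply (H C n). intros x Hx. apply (Lb (f x)). exists x. split; auto. lra.
  - apply (Lb (f (INR n))). exists (INR n). split; auto. lra.
Qed.

Theorem theorem2 (zeta : C -> C) (Hzeta : is_riemann_zeta zeta)
  (gamma1 : R) (Hgamma1 : is_first_zero_ordinate zeta gamma1) :
  Rbar_le (Finite (Cmod (coeff_c1 zeta gamma1)))
          (LimSup_infty (fun x => errE x / Rpower x (1 / 4))) /\
  Rbar_le (LimInf_infty (fun x => errE x / Rpower x (1 / 4)))
          (Finite (- Cmod (coeff_c1 zeta gamma1))).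
Proof.
  assert (Rp : forall x, Rpower x (1 / 4) = exp (/ 4 * ln x)) by (intros; unfold Rpower; do 2 f_equal; field).
  assert (Pos : forall x, 0 < exp (/ 4 * ln x)) by (intros; apply exp_pos).
  split.
  - apply LimSup_infty_ge. intros C k H.
    apply (one_sided_bound zeta gamma1 1 C k); auto; [apply Rabs_R1|].
    intros x Hx. specialize (H x Hx). rewrite Rp in H. specialize (Pos x).
    apply Rmult_le_compat_r with (r := exp (/ 4 * ln x)) in H; [|lra].
    unfold Rdiv in H. rewrite Rmult_assoc, Rinv_l in H by lra. lra.
  - apply LimInf_infty_le. intros C k H.
    assert (B : Cmod (coeff_c1 zeta gamma1) <= - C); [|lra].
    apply (one_sided_bound zeta gamma1 (-1) (- C) k); auto; [rewrite Rabs_left; lra|].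
    intros x Hx. specialize (H x Hx). rewrite Rp in H. specialize (Pos x).
    apply Rmult_le_compat_r with (r := exp (/ 4 * ln x)) in H; [|lra].
    unfold Rdiv in H. rewrite Rmult_assoc, Rinv_l in H by lra. lra.
Qed.
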